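(* Let $\Omega=(-1,1)$ and let $u,u',\dots,u^{(k-1)}\in\mathrm{AC}([-1,1])$ with $k\in\mathbb N$, $k\ge1$. (i) Let $\mu\in(k-1,k)$ and $\theta\in(-1,1)$, and suppose ${}^{C}\!D_{\theta+}^{\mu}u\in\mathrm{BV}([\theta,1])$ and ${}^{C}\!D_{\theta-}^{\mu}u\in\mathrm{BV}([-1,\theta])$. Put $$U_\theta^{(\mu)}:=V_{[-1,\theta]}[{}^{C}\!D_{\theta-}^{\mu}u]+V_{[\theta,1]}[{}^{C}\!D_{\theta+}^{\mu}u]+|({}^{C}\!D_{\theta-}^{\mu}u)(\theta-)|+|({}^{C}\!D_{\theta+}^{\mu}u)(\theta+)|.$$ Then for every integer $N$ with $-1/2<\mu<N$, $$\|u-\pi_N^Lu\|_{L^2(\Omega)}\le\sqrt{\frac{2}{(2\mu+1)\pi}\,\frac{\Gamma(N-\mu)}{\Gamma(N+\mu+1)}}\;U_\theta^{(\mu)}.$$ (ii) If $u^{(k)}\in\mathrm{BV}([-1,1])$, then for every integer $N>k$ the same estimate holds with $\mu=k$ and with $U_\theta^{(\mu)}$ replaced by the total variation $V_{[-1,1]}[u^{(k)}]$.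
   Context: $P_n$ is the Legendre polynomial of degree $n$, $\hat u_n^L=\frac{2n+1}{2}\int_{-1}^1u(x)P_n(x)\,\mathrm dx$, and $\pi_N^Lu=\sum_{n=0}^N\hat u_n^LP_n$ is the $L^2(-1,1)$-orthogonal projection onto polynomials of degree at most $N$. $\mathrm{AC}$ and $\mathrm{BV}$ denote absolutely continuous functions and functions of bounded variation on the indicated closed interval; $V_{[c,d]}[h]$ is the total variation of $h$ on $[c,d]$; $h(c\pm)$ are one-sided limits. Fractional integrals: for $\rho>0$ and $f\in L^1(a,b)$, $(I_{a+}^\rho f)(x)=\frac1{\Gamma(\rho)}\int_a^x\frac{f(y)}{(x-y)^{1-\rho}}\,\mathrm dy$ and $(I_{b-}^\rho f)(x)=\frac1{\Gamma(\rho)}\int_x^b\frac{f(y)}{(y-x)^{1-\rho}}\,\mathrm dy$; $I^0$ is the identity. Caputo derivatives: for $\mu\in(k-1,k]$, $({}^{C}\!D_{a+}^{\mu}f)(x)=(I_{a+}^{k-\mu}f^{(k)})(x)$ and $({}^{C}\!D_{b-}^{\mu}f)(x)=(-1)^k(I_{b-}^{k-\mu}f^{(k)})(x)$. These (and $u^{(k)}$) are defined almost everywhere; saying that such a function is in BV means it agrees a.e. with a BV function, with which it is then identified. *)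

(* Defs.v *)
From HB Require Import structures.
From mathcomp Require Import all_boot all_order all_algebra.
From mathcomp Require Import all_classical all_reals all_analysis.

Set Implicit Arguments.
Unset Strict Implicit.
Unset Printing Implicit Defensive.

Import Order.TTheory GRing.Theory Num.Theory.
Import numFieldNormedType.Exports.

Local Open Scope classical_set_scope.
Local Open Scope ring_scope.

(* Rodrigues' formula. *)
Definition legendre (R : realType) (n : nat) : {poly R} :=
  (2 ^+ n * n`!%:R)^-1 *: (('X^2 - 1) ^+ n)^`(n).

Definition legendre_coef (R : realType) (u : R -> R) (n : nat) : R :=
  (2 * n%:R + 1) / 2 *
  \int[@lebesgue_measure R]_(x in `]-1, 1[) (u x * (legendre R n).[x]).

Definition legendre_proj (R : realType) (N : nat) (u : R -> R) : {poly R} :=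
  \sum_(n < N.+1) legendre_coef u n *: legendre R n.

Definition L2norm (R : realType) (D : set R) (f : R -> R) : \bar R :=
  ('N[@lebesgue_measure R]_(2%:E)[EFin \o (f \_ D)])%E.

(* The integral is the Gamma function only for 0 < x. *)
Definition Gamma (R : realType) (x : R) : R :=
  \int[@lebesgue_measure R]_(t in `]0, +oo[) (t `^ (x - 1) * expR (- t)).

Definition abs_cont (R : realType) (a b : R) (f : R -> R) : Prop :=
  forall e : R, 0 < e -> exists2 d : R, 0 < d &
    forall (n : nat) (c c' : 'I_n -> R),
      (forall i, a <= c i /\ c i <= c' i /\ c' i <= b) ->
      trivIset setT (fun i => `]c i, c' i[%classic) ->
      \sum_(i < n) (c' i - c i) < d ->
      \sum_(i < n) `|f (c' i) - f (c i)| < e.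

Definition diff_quot (R : realType) (f : R -> R) (x : R) : R -> R :=
  fun y => (f y - f x) / (y - x).

(* Derivative of f as a function on [a, b]: one-sided at a and at b, and equal
   to the ordinary derivative inside. As for any [lim], the value carries
   no information where the limit does not exist. *)
Definition derivable_in (R : realType) (a b : R) (f : R -> R) (x : R) : Prop :=
  cvg (diff_quot f x @ within `[a, b] x^').

Definition deriv_in (R : realType) (a b : R) (f : R -> R) (x : R) : R :=
  lim (diff_quot f x @ within `[a, b] x^').

Definition derivn_in (R : realType) (a b : R) (n : nat) (f : R -> R) : R -> R :=
  iter n (deriv_in a b) f.

(* f, f', ..., f^(k-1) are in AC([a, b]), including their existence
   everywhere on [a, b]. *)
Definition derivs_abs_cont (R : realType) (a b : R) (k : nat) (f : R -> R) : Prop :=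
  (forall j : nat, (j.+1 < k)%N ->
     forall x, x \in `[a, b] -> derivable_in a b (derivn_in a b j f) x) /\
  (forall j : nat, (j < k)%N -> abs_cont a b (derivn_in a b j f)).

Definition frac_int_left (R : realType) (a rho : R) (f : R -> R) (x : R) : R :=
  if rho == 0 then f x else
  (Gamma rho)^-1 *
  \int[@lebesgue_measure R]_(y in `]a, x[) (f y / (x - y) `^ (1 - rho)).

Definition frac_int_right (R : realType) (b rho : R) (f : R -> R) (x : R) : R :=
  if rho == 0 then f x else
  (Gamma rho)^-1 *
  \int[@lebesgue_measure R]_(y in `]x, b[) (f y / (y - x) `^ (1 - rho)).

(* Caputo derivatives of order mu in (k-1, k] of a function on [a, b], based at
   a (left) and at b (right). *)
Definition caputo_left (R : realType) (a b : R) (k : nat) (mu : R)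
    (f : R -> R) : R -> R :=
  frac_int_left a (k%:R - mu) (derivn_in a b k f).

Definition caputo_right (R : realType) (a b : R) (k : nat) (mu : R)
    (f : R -> R) : R -> R :=
  fun x => (-1) ^+ k * frac_int_right b (k%:R - mu) (derivn_in a b k f) x.

(* g is a BV representative on [a, b] of the a.e. defined function f. *)
Definition BV_repr (R : realType) (a b : R) (f g : R -> R) : Prop :=
  bounded_variation a b g /\ ae_eq (@lebesgue_measure R) `[a, b]%classic f g.

(* gl and gr stand for the Caputo derivatives of u on [-1, theta] and on
   [theta, 1]. *)
Definition U_theta (R : realType) (theta : R) (gl gr : R -> R) : \bar R :=
  ((total_variation (-1) theta gl)%R + (total_variation theta 1 gr)%R
   + `|lim (gl x @[x --> theta^'-])|%:E + `|lim (gr x @[x --> theta^'+])|%:E)%E.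

Definition L2_const (R : realType) (mu : R) (N : nat) : R :=
  Num.sqrt (2 / ((2 * mu + 1) * pi) *
            (Gamma (N%:R - mu) / Gamma (N%:R + mu + 1))).

(* Main.v *)
Require Import Defs.
From HB Require Import structures.
From mathcomp Require Import all_boot all_order all_algebra.
From mathcomp Require Import all_classical all_reals all_analysis.
From mathcomp Require Import measurable_realfun ring lra.

(* The residual e = u - pi_N u is orthogonal to polynomials of degree at most N, so
   |e|^2 = <e, u - T> where T is the Taylor polynomial of u at theta. By the
   semigroup law of fractional integrals, to the right of theta u - T is the
   fractional integral of order mu of the Caputo derivative g, and symmetrically
   to the left. Approximating g by step functions and summing by parts gives
     |<e, I^mu g>| <= (|g(theta+)| + V[g]) sup_t |<e, K_t>|,
   with K_t(x) = (x - t)_+^mu / Gamma(mu + 1), and |<e, K_t>| is at most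
   |e| |K_t - pi_N K_t|. The moments y_n(t) = <K_t, P_n> satisfy
     (1 - t^2) y_n' = (n - mu) t y_n - (n + mu + 2) y_(n+1),
     (1 - t^2) y_(n+1)' = - (n + mu + 2) t y_(n+1) + (n - mu) y_n,
   from which, by induction on N,
     |K_t - pi_N K_t|^2 = ((1 - t^2) y_N'^2 + (N - mu)^2 y_N^2) / (2 (2 mu + 1)).
   Sonin's monotonicity argument bounds this by its analogue at t = 0, where the
   y_n are quotients of Gamma values, estimated by log-convexity. *)

Set Implicit Arguments.
Unset Strict Implicit.
Unset Printing Implicit Defensive.

Import Order.TTheory GRing.Theory Num.Theory.
Import numFieldNormedType.Exports.

Local Open Scope classical_set_scope.
Local Open Scope ring_scope.

(** * Absolutely continuous functions are primitives *)

Section absolute_continuity.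
Variable R : realType.
Implicit Types (a b d e x y : R) (f : R -> R).

Definition small_var a b f e d :=
    forall (n : nat) (c c' : 'I_n -> R),
      (forall i, a <= c i /\ c i <= c' i /\ c' i <= b) ->
      trivIset setT (fun i => `]c i, c' i[%classic) ->
      \sum_(i < n) (c' i - c i) < d ->
      \sum_(i < n) `|f (c' i) - f (c i)| < e.

Lemma small_var_fin a b f e d (I : finType) (c c' : I -> R) :
  small_var a b f e d ->
  (forall i, a <= c i /\ c i <= c' i /\ c' i <= b) ->
  trivIset setT (fun i => `]c i, c' i[%classic) ->
  \sum_i (c' i - c i) < d -> \sum_i `|f (c' i) - f (c i)| < e.
Proof.
move=> H cc' tri lt.
have re (F : I -> R) : \sum_i F i = \sum_(k < #|I|) F (enum_val k).
  exact: (reindex enum_val (onW_bij _ (@enum_val_bij I))).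
rewrite re; apply: (H _ (fun k => c (enum_val k)) (fun k => c' (enum_val k))).
- by move=> i; exact: cc'.
- move=> i j _ _ /= ij; apply: enum_val_inj; exact: tri.
- by rewrite -(re (fun i => c' i - c i)).
Qed.

Lemma partition_trivIset a b (s : seq R) : itv_partition a b s ->
  trivIset setT (fun k : 'I_(size s) => `]nth b (a :: s) k, nth b (a :: s) k.+1[%classic).
Proof.
move=> [ps ls].
have mono i j : (i < size (a :: s))%N -> (j < size (a :: s))%N -> (i <= j)%N ->
    nth b (a :: s) i <= nth b (a :: s) j.
  have ss : sorted <=%O (a :: s) by exact: (sub_path (@ltW _ _)).
  move=> si sj ij; apply: (sorted_leq_nth le_trans lexx b ss) => //; exact.
have key i j : (i < size s)%N -> (j < size s)%N -> (i < j)%N ->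
    forall z, ~ (z < nth b (a :: s) i.+1 /\ nth b (a :: s) j < z).
  move=> si sj ij z [z1 z2].
  have := lt_trans z2 z1; rewrite ltNge mono //=; last by rewrite ltnS ltnW.
move=> i j _ _ [z [/= ]]; rewrite !in_itv/= => /andP[z1 z2] /andP[z3 z4].
apply: val_inj => /=.
have [ij|ij|//] := ltngtP (i : nat) j.
- by case: (key i j (ltn_ord i) (ltn_ord j) ij z).
- by case: (key j i (ltn_ord j) (ltn_ord i) ij z).
Qed.

Lemma small_var_partitions a b f e d n (c c' : 'I_n -> R) (s : 'I_n -> seq R) :
  small_var a b f e d ->
  (forall i, a <= c i /\ c i <= c' i /\ c' i <= b) ->
  trivIset setT (fun i => `]c i, c' i[%classic) ->
  \sum_(i < n) (c' i - c i) < d ->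
  (forall i, itv_partition (c i) (c' i) (s i)) ->
  \sum_(i < n) variation (c i) (c' i) f (s i) < e.
Proof.
move=> H cc' tri lt ps.
pose J := {i : 'I_n & 'I_(size (s i))}.
pose N i k := nth (c' i) (c i :: s i) k.
have Nmono i k : (k < size (s i))%N -> N i k <= N i k.+1.
  move=> ks; have ss : sorted <=%O (c i :: s i).
    by apply: (sub_path (@ltW _ _)); case: (ps i).
  apply: (sorted_leq_nth le_trans lexx (c' i) ss); rewrite ?inE //=.
  by rewrite ltnS ltnW.
have Nge i k : (k <= size (s i))%N -> c i <= N i k.
  by move=> ks; apply: (itv_partition_nth_ge _ (ps i)).
have Nle i k : (k <= size (s i))%N -> N i k <= c' i.
  by move=> ks; apply: (itv_partition_nth_le _ (ps i)).
have sumI (F : forall i : 'I_n, nat -> R) :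
    \sum_(i < n) \sum_(0 <= k < size (s i)) F i k =
    \sum_(p : J) F (tag p) (tagged p).
  under eq_bigr do rewrite big_mkord.
  by rewrite sig_big_dep /=; apply: eq_bigr => -[].
rewrite /variation (sumI (fun i k => `|f (N i k.+1) - f (N i k)|)).
apply: (small_var_fin (c := fun p : J => N (tag p) (tagged p))
   (c' := fun p : J => N (tag p) (tagged p).+1) H).
- move=> [i k] /=; have [ac [_ cb]] := cc' i; split; last split.
  + by apply: (le_trans ac); apply: Nge; exact: ltnW.
  + exact: Nmono.
  + by apply: le_trans cb; exact: Nle.
- move=> [i k] [j l] _ _ /= [z [/=]]; rewrite !in_itv/= => /andP[z1 z2] /andP[z3 z4].
  have ij : i = j.
    apply: (tri i j I) => //; exists z; split; rewrite /= in_itv/=.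
    + by rewrite (le_lt_trans (Nge i k (ltnW (ltn_ord k))) z1) (lt_le_trans z2 (Nle i _ (ltn_ord k))).
    + by rewrite (le_lt_trans (Nge j l (ltnW (ltn_ord l))) z3) (lt_le_trans z4 (Nle j _ (ltn_ord l))).
  subst j; congr existT; apply: (partition_trivIset (ps i)) => //.
  by exists z; split; rewrite /= in_itv/= ?z1 ?z3.
- rewrite -(sumI (fun i k => N i k.+1 - N i k)).
  rewrite (eq_bigr (fun i => c' i - c i)) // => i _.
  rewrite telescope_sumr // /N nth0 /=; congr (_ - _).
  by have [_ /eqP lst] := ps i; rewrite -[in RHS]lst (last_nth (c' i)).
Qed.

Lemma small_var_TV a b f e d n (c c' : 'I_n -> R) :
  bounded_variation a b f ->
  small_var a b f e d ->
  (forall i, a <= c i /\ c i <= c' i /\ c' i <= b) ->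
  trivIset setT (fun i => `]c i, c' i[%classic) ->
  \sum_(i < n) (c' i - c i) < d ->
  \sum_(i < n) fine (total_variation (c i) (c' i) f) <= e.
Proof.
move=> bv H cc' tri lt.
apply/ler_addgt0Pl => r r0.
have r'0 : 0 < r / n.+1%:R by rewrite divr_gt0.
have ex i : exists s, itv_partition (c i) (c' i) s /\
    fine (total_variation (c i) (c' i) f) <= variation (c i) (c' i) f s + r / n.+1%:R.
  have [ac [ci cb]] := cc' i.
  have bvi : bounded_variation (c i) (c' i) f.
    by apply: (bounded_variationl ci cb); apply: (bounded_variationr ac (le_trans ci cb)).
  have /(bounded_variationP _ ci) fin := bvi.
  have [_ [v [s ps <-] <-]] := ub_ereal_sup_adherent r'0 fin.
  rewrite -/(total_variation _ _ _) -(fineK fin) -EFinB lte_fin => hv.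
  exists s; split => //; rewrite -lerBlDr; exact: ltW.
have [s hs] := choice ex.
have := small_var_partitions H cc' tri lt (fun i => (hs i).1) => hlt.
apply: (@le_trans _ _ (\sum_(i < n) (variation (c i) (c' i) f (s i) + r / n.+1%:R))).
  by apply: ler_sum => i _; exact: (hs i).2.
rewrite big_split /= sumr_const card_ord addrC lerD // ?(ltW hlt) //.
rewrite -[leLHS]mulr_natr -mulrA ger_pMr // mulrC ler_pdivrMr // mul1r ler_nat.
exact: leqnSn.
Qed.

Lemma small_var_BV a b f e d : 0 < d -> small_var a b f e d ->
  forall (n : nat) x, a <= x -> x <= b -> x <= a + n%:R * (d / 2) -> bounded_variation a x f.
Proof.
move=> d0 H; elim=> [|n IH] x ax xb.
  rewrite mul0r addr0 => xa; have -> : x = a by apply/le_anti; rewrite xa.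
  exact: bounded_variationxx.
move=> xn; pose y := a + n%:R * (d / 2).
have ay : a <= y by rewrite lerDl mulr_ge0 // ltW // divr_gt0.
have [xy|yx] := leP x y; first exact: IH.
apply/(bounded_variationP _ ax); rewrite (total_variationD _ ay (ltW yx)).
rewrite fin_numD; apply/andP; split.
  by apply/(bounded_variationP _ ay); apply: IH => //; rewrite (le_trans (ltW yx)).
apply/(bounded_variationP _ (ltW yx)); exists e => _ [s ps <-].
apply/ltW; have := @small_var_partitions _ _ _ _ _ 1 (fun=> y) (fun=> x) (fun=> s) H.
rewrite !big_ord1; apply => //.
- by move=> _; split => //; split => //; exact: ltW.
- by move=> i j _ _ _; rewrite (ord1 i) (ord1 j).
- move: xn; rewrite -natr1 mulrDl mul1r addrA -/y => ?; lra.
Qed.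

Lemma abs_cont_BV a b f : a <= b -> abs_cont a b f -> bounded_variation a b f.
Proof.
move=> ab /(_ 1 ltr01)[d d0 H].
have d20 : 0 < d / 2 by rewrite divr_gt0.
have /archi_boundP : 0 <= (b - a) / (d / 2).
  by rewrite divr_ge0 ?subr_ge0 // ltW.
set n := Num.bound _.
rewrite ltr_pdivrMr // => lt.
by apply: (small_var_BV d0 H (n := n)) => //; lra.
Qed.

End absolute_continuity.

Section density.
Variable R : realType.
Implicit Types (a b d e x y : R) (f F : R -> R).
Local Notation mu := (@lebesgue_measure R).

Definition small_incr F e d :=
  forall (n : nat) (c c' : 'I_n -> R), (forall i, c i <= c' i) ->
      trivIset setT (fun i => `]c i, c' i[%classic) ->
      \sum_(i < n) (c' i - c i) < d ->
      \sum_(i < n) (F (c' i) - F (c i)) <= e.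

Lemma stieltjes_ocitv (F : cumulative R R) x y : x <= y ->
  lebesgue_stieltjes_measure F `]x, y]%classic = (F y - F x)%:E.
Proof.
move=> xy; rewrite /lebesgue_stieltjes_measure /measure_extension.
by rewrite measurable_mu_extE /=; [rewrite wlength_itv_bnd|exact: is_ocitv].
Qed.

Lemma stieltjes_le (F : cumulative R R) (A B : set R) :
  measurable A -> measurable B -> A `<=` B ->
  (lebesgue_stieltjes_measure F A <= lebesgue_stieltjes_measure F B)%E.
Proof. by move=> mA mB AB; apply: le_measure; rewrite ?inE. Qed.

Lemma open_bounded_interval (I : set R) : open I -> is_interval I ->
  (mu I < +oo)%E -> exists c c', [/\ c <= c', I = `]c, c'[%classic & mu I = (c' - c)%:E].
Proof.
move=> oI iI fI; have [->|/set0P[z Iz]] := eqVneq I set0.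
  by exists 0, 0; rewrite measure0 subrr; split => //; rewrite set_itv_ge ?bnd_simp ?ltxx.
have hl : has_lbound I.
  apply: contrapT => nl; have [hu|nu] := pselect (has_ubound I).
  - have := interval_left_unbounded_interior iI nl hu.
    have /interior_id -> := oI => IE; move: fI; rewrite IE.
    rewrite (_ : [set r | _] = `]-oo, sup I[%classic); last by apply/seteqP; split => r /=; rewrite in_itv.
    by rewrite lebesgue_measure_itv /= ?ltNyr ?ltry ?ltxx.
  - have := interval_unbounded_setT iI nl nu => IE; move: fI; rewrite IE.
    by rewrite -set_itvNyy lebesgue_measure_itv.
have hu : has_ubound I.
  apply: contrapT => nu.
  have := interval_right_unbounded_interior iI hl nu.
  have /interior_id -> := oI => IE; move: fI; rewrite IE.
  rewrite (_ : [set r | _] = `]inf I, +oo[%classic); last by apply/seteqP; split => r /=; rewrite in_itv /= andbT.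
  by rewrite lebesgue_measure_itv /= ?ltNyr ?ltry ?ltxx.
exists (inf I), (sup I).
have IE : I = `]inf I, sup I[%classic.
  have := interval_bounded_interior iI hl hu; have /interior_id {1}-> := oI => {1}->.
  by apply/seteqP; split => r /=; rewrite in_itv.
have le : inf I <= sup I by rewrite (le_trans (ge_inf hl Iz)) // ub_le_sup.
split => //; rewrite {1}IE lebesgue_measure_itv /= lte_fin.
by move: le; rewrite le_eqVlt => /predU1P[->|->] //; rewrite ltxx subrr.
Qed.

Lemma small_incr_dominates (F : cumulative R R) :
  (forall e, 0 < e -> exists2 d, 0 < d & small_incr F e d) ->
  forall A : set R, measurable A -> mu A = 0%E -> lebesgue_stieltjes_measure F A = 0%E.
Proof.
move=> P A mA A0; apply/eqP; rewrite eq_le measure_ge0 andbT.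
apply/lee_addgt0Pr => e e0; rewrite add0e.
have [d d0 H] := P e e0.
have [|U [oU AU UA]] := @lebesgue_regularity_outer R A d mA _ d0.
  by apply: (@le_lt_trans _ _ 0%E); [rewrite -A0|exact: ltry].
have mU : measurable U by exact: open_measurable.
have Ud : (mu U < d%:E)%E.
  rewrite (_ : U = A `|` (U `\` A)); last by rewrite setUDr setDv setD0 setUC -{1}(setUidl AU).
  apply: (@le_lt_trans _ _ (mu A + mu (U `\` A))%E).
    by apply: measureU2 => //; exact: measurableD.
  by rewrite (_ : mu A = 0%E) // add0e.
pose I := open_disjoint_itv oU.
have mI q : measurable (I q) by apply: open_measurable; exact: open_disjoint_itv_open.
have tI := @open_disjoint_itv_trivIset _ _ oU.
have UI := @open_disjoint_itv_bigcup _ _ oU.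
have IU q : I q `<=` U by rewrite [X in _ `<=` X]UI; exact: bigcup_sup.
have ex q : exists cc : R * R, [/\ cc.1 <= cc.2, I q = `]cc.1, cc.2[%classic & mu (I q) = (cc.2 - cc.1)%:E].
  have [|||c [c' [? ? ?]]] := @open_bounded_interval (I q) _ _ _; last by exists (c, c').
  - exact: open_disjoint_itv_open.
  - exact: open_disjoint_itv_is_interval.
  - rewrite (@le_lt_trans _ _ (mu U)) ?(lt_trans Ud) ?ltry //.
    by apply: le_measure; rewrite ?inE; [exact: mI|exact: mU|exact: IU].
have [cc hcc] := choice ex.
apply: (@le_trans _ _ (lebesgue_stieltjes_measure F U)).
  by apply: le_measure; rewrite ?inE; [exact: mA|exact: mU|exact: AU].
rewrite UI measure_bigcup //; last by move=> q _; exact: mI.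
apply: lime_le.
  by apply: is_cvg_nneseries => n _ _; exact: measure_ge0.
apply: nearW => n.
apply: (@le_trans _ _ (\sum_(0 <= q < n) (F (cc q).2 - F (cc q).1)%:E)%E).
  rewrite big_mkcond /=.
  apply: lee_sum => q _; rewrite in_setT.
  have [c12 Ie _] := hcc q; rewrite -[open_disjoint_itv oU q]/(I q) Ie -stieltjes_ocitv //.
  by apply: stieltjes_le; [exact: measurable_itv|exact: measurable_itv|exact: subset_itv_oo_oc].
rewrite sumEFin lee_fin big_mkord.
apply: (H n (fun i : 'I_n => (cc i).1) (fun i => (cc i).2)).
- by move=> i; have [] := hcc i.
- move=> /= i j _ _ /=; have [_ <- _] := hcc i; have [_ <- _] := hcc j => ne.
  by apply: val_inj; apply: (tI i j) => //.
- rewrite -lte_fin; apply: le_lt_trans Ud.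
  rewrite -sumEFin -(big_mkord xpredT (fun q => ((cc q).2 - (cc q).1)%:E)).
  rewrite (eq_bigr (fun q => mu (I q))); last by move=> q _; have [_ _ ->] := hcc q.
  rewrite [X in (_ <= mu X)%E]UI measure_bigcup //; last by move=> q _; exact: mI.
  rewrite (eq_eseriesl (Q := xpredT)); last by move=> q; rewrite in_setT.
  by apply: nneseries_lim_ge => q _ _; exact: measure_ge0.
Qed.

Lemma small_incr_density F a b : a <= b ->
  {homo F : x y / x <= y} -> continuous F ->
  (forall e, 0 < e -> exists2 d, 0 < d & small_incr F e d) ->
  exists2 g : R -> R, mu.-integrable setT (EFin \o g) &
    forall x y, a <= x -> x <= y -> y <= b -> F y - F x = \int[mu]_(t in `]x, y]) g t.
Proof.
move=> ab ndF cF P.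
pose FC : cumulative R R := HB.pack F (isCumulative.Build _ _ R F ndF (right_continuousW cF)).
pose nu := lebesgue_stieltjes_measure FC.
have mab : measurable (`]a, b]%classic : set (measurableTypeR R)) by exact: measurable_itv.
have nufin : (nu `]a, b]%classic < +oo)%E by rewrite /nu stieltjes_ocitv // ltry.
pose nur : {finite_measure set (measurableTypeR R) -> \bar R} := mfrestr mab nufin.
have dom : nur `<< mu.
  apply/null_content_dominatesP => A mA A0.
  rewrite /nur /= /mfrestr /mrestr; apply/eqP; rewrite eq_le measure_ge0 andbT.
  rewrite -(small_incr_dominates (F := FC) P mA A0).
  by apply: stieltjes_le; [exact: measurableI|exact: mA|exact: subIsetl].
have [g [g0 gfin gint gE]] := radon_nikodym_sigma_finite dom.
have EFg : EFin \o (fine \o g) = g by apply/funext => x /=; rewrite fineK.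
exists (fine \o g); first by rewrite EFg.
move=> x y ax xy yb; rewrite /Rintegral.
have -> : (\int[mu]_(t in `]x, y]) ((fine \o g) t)%:E = \int[mu]_(t in `]x, y]) g t)%E.
  by apply: eq_integral => t _; rewrite /= fineK.
rewrite -gE; last exact: measurable_itv.
rewrite /nur /= /mfrestr /mrestr setIidl ?stieltjes_ocitv //.
by apply: subset_itv; rewrite bnd_simp.
Qed.

End density.

Section derivatives.
Variable R : realType.
Implicit Types (a b d e x y : R) (f F : R -> R).
Local Notation mu := (@lebesgue_measure R).

Lemma within_dnbhs_itv a b x : x \in `]a, b[ -> within `[a, b]%classic x^' = x^'.
Proof.
move=> xab; apply/seteqP; split => P; rewrite /within /=.
- move=> H; near=> y; apply: (near H y) => //.
  by near: y; apply: nbhs_dnbhs; apply: filterS (near_in_itvoo xab) => y; exact: subset_itv_oo_cc.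
- by apply: filterS.
Unshelve. all: by end_near. Qed.

Lemma deriv_in_local a b a' b' f f' x : x \in `]a, b[ -> x \in `]a', b'[ ->
  {near x, f =1 f'} -> deriv_in a b f x = deriv_in a' b' f' x.
Proof.
move=> xab xab' ff'; rewrite /deriv_in !within_dnbhs_itv //.
have E (g g' : R -> R) : {near x, g =1 g'} ->
    diff_quot g x @ x^' `=>` diff_quot g' x @ x^'.
  move=> gg' P; rewrite /= /fmap /= => H; near=> y.
  have e1 : g x = g' x by exact: (nbhs_singleton gg').
  have e2 : g y = g' y by exact: (near (nbhs_dnbhs gg') y).
  change (P (diff_quot g x y)).
  have -> : diff_quot g x y = diff_quot g' x y by rewrite /diff_quot e1 e2.
  exact: (near H y).
congr lim; apply/seteqP; split; apply: E => //.
by apply: filterS ff' => y ->.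
Unshelve. all: by end_near. Qed.

Lemma derivn_in_sub a b a' b' j f x : a <= a' -> b' <= b -> x \in `]a', b'[ ->
  derivn_in a' b' j f x = derivn_in a b j f x.
Proof.
move=> aa' bb'; elim: j x => [//|j IH] x xab.
apply: deriv_in_local => //.
  by move: xab; rewrite !in_itv /= => /andP[x1 x2]; rewrite (le_lt_trans aa') // (lt_le_trans x2).
by apply: filterS (near_in_itvoo xab) => y; exact: IH.
Qed.

Lemma derivable_diff_quot F f a b x (l : R) : x \in `]a, b[ -> {near x, forall y, f y - f x = F y - F x} ->
  derivable F x 1 -> derive1 F x = l -> diff_quot f x @ x^' --> l.
Proof.
move=> xab E dF <-; apply/cvgrPdist_lt => e e0.
have := dF; rewrite /derivable => /cvgrPdist_lt /(_ e e0).
rewrite -[lim _]/('D_1 F x) -derive1E => /nbhs_ballP[d /= d0 H].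
have [d' /= d'0 E'] := E; near=> y.
have xy : y - x != 0 by rewrite subr_eq0; near: y; exact: nbhs_dnbhs_neq.
have := H (y - x); rewrite /ball /= sub0r normrN /= => H'.
rewrite /diff_quot E'; last first.
  by near: y; apply: nbhs_dnbhs; exact: nbhsx_ballx.
have -> : (F y - F x) / (y - x) = (y - x)^-1 *: (F ((y - x)%:A + x) - F x).
  by rewrite /GRing.scale /= mulr1 subrK mulrC.
apply: H' => //; rewrite distrC.
by near: y; apply: nbhs_dnbhs; exact: nbhsx_ballx.
Unshelve. all: by end_near. Qed.

Definition clamp a b x := Num.max a (Num.min b x).

Lemma clamp_itv a b x : a <= b -> a <= clamp a b x /\ clamp a b x <= b.
Proof.
by move=> ab; rewrite /clamp le_max lexx ge_max ab ge_min lexx.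
Qed.

Lemma clamp_le a b x y : a <= b -> x <= y -> clamp a b x <= clamp a b y /\
  clamp a b y - clamp a b x <= y - x.
Proof.
move=> ab xy; rewrite /clamp; case: (leP b x) => bx; case: (leP b y) => by'.
- by split => //; lra.
- by exfalso; lra.
- by case: (leP a x) => ax; case: (leP a b) => ab'; split; lra.
- by case: (leP a x) => ax; case: (leP a y) => ay; split; lra.
Qed.

Lemma clamp_oo a b x y z : a <= b -> clamp a b x < z -> z < clamp a b y -> x < z /\ z < y.
Proof.
move=> ab; rewrite /clamp; case: (leP b x) => bx; case: (leP b y) => by';
  case: (leP a b) => ?; case: (leP a x) => ?; case: (leP a y) => ? ? ?; split; lra.
Qed.

Lemma clamp_id a b x : a <= x -> x <= b -> clamp a b x = x.
Proof. by move=> ax xb; rewrite /clamp min_r // max_r. Qed.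

Lemma small_incr_continuous F : {homo F : x y / x <= y} ->
  (forall e, 0 < e -> exists2 d, 0 < d & small_incr F e d) -> continuous F.
Proof.
move=> ndF H x; apply/cvgrPdist_le => e e0.
have [d d0 Hd] := H e e0.
have key u v : u <= v -> v - u < d -> F v - F u <= e.
  move=> uv lt; have := Hd 1 (fun=> u) (fun=> v); rewrite !big_ord1; apply => //.
  by move=> i j _ _ _; rewrite (ord1 i) (ord1 j).
near=> y.
have xy : `|x - y| < d by near: y; exact: (@nbhsx_ballx _ _ x d d0).
have [yx|xy'] := leP y x.
- rewrite ger0_norm ?subr_ge0 ?ndF //; apply: key => //.
  by apply: le_lt_trans xy; exact: ler_norm.
- rewrite distrC ger0_norm ?subr_ge0 ?ndF ?(ltW xy') //; apply: key; first exact: ltW.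
  by apply: le_lt_trans xy; rewrite distrC; exact: ler_norm.
Unshelve. all: by end_near. Qed.

Lemma abs_cont_continuous a b f : a <= b -> abs_cont a b f -> {within `[a, b], continuous f}.
Proof.
move=> ab H; apply/subspace_continuousP => x xab; apply/cvgrPdist_le => e e0.
have [d d0 Hd] := H e e0.
have key u v : a <= u -> u <= v -> v <= b -> v - u < d -> `|f v - f u| <= e.
  move=> au uv vb lt; have := Hd 1 (fun=> u) (fun=> v); rewrite !big_ord1 => {}Hd; apply/ltW/Hd => //.
  by move=> i j _ _ _; rewrite (ord1 i) (ord1 j).
rewrite nearE /within /=; apply: filterS (@nbhsx_ballx _ _ x d d0) => y xy yab.
move: xab yab; rewrite /= !in_itv /= => /andP[ax xb] /andP[ay yb].
have [yx|xy'] := leP y x.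
- by apply: key => //; apply: le_lt_trans xy; exact: ler_norm.
- rewrite distrC; apply: key => //; first exact: ltW.
  by apply: le_lt_trans xy; rewrite distrC; exact: ler_norm.
Qed.

Lemma abs_cont_FTC a b f : a < b -> abs_cont a b f ->
  exists2 g : R -> R, mu.-integrable setT (EFin \o g) &
    (forall x y, a <= x -> x <= y -> y <= b -> f y - f x = \int[mu]_(t in `]x, y]) g t) /\
    {ae mu, forall x, x \in `]a, b[ -> deriv_in a b f x = g x}.
Proof.
move=> ab acf; have ab' := ltW ab.
have bv := abs_cont_BV ab' acf.
pose T x := fine (total_variation a (clamp a b x) f).
have bvxy x y : a <= x -> x <= y -> y <= b -> bounded_variation x y f.
  by move=> ax xy yb; apply: (bounded_variationl xy yb); apply: (bounded_variationr ax (le_trans xy yb)).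
have fin x y : a <= x -> x <= y -> y <= b -> total_variation x y f \is a fin_num.
  by move=> ax xy yb; apply/bounded_variationP => //; exact: bvxy.
have TD x y : x <= y -> T y - T x = fine (total_variation (clamp a b x) (clamp a b y) f).
  move=> xy; have [ax xb] := clamp_itv x ab'; have [ay yb] := clamp_itv y ab'.
  have [cxy _] := clamp_le ab' xy.
  rewrite /T (total_variationD _ ax cxy) fineD ?fin //.
  by rewrite addrC addKr.
have TVge x y : x <= y -> `|f (clamp a b y) - f (clamp a b x)| <= T y - T x.
  move=> xy; rewrite TD // -lee_fin fineK; first by apply: total_variation_ge; have [] := clamp_le ab' xy.
  have [ax xb] := clamp_itv x ab'; have [ay yb] := clamp_itv y ab'.
  by apply: fin => //; have [] := clamp_le ab' xy.
have Tsmall e : 0 < e -> exists2 d, 0 < d & small_incr T e d.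
  move=> e0; have [d d0 Hd] := acf e e0; exists d => // n c c' cc' tri lt.
  under eq_bigr do rewrite TD //.
  apply: (small_var_TV bv Hd) => //.
  - move=> i; have [ax xb] := clamp_itv (c i) ab'; have [ay yb] := clamp_itv (c' i) ab'.
    by have [cxy _] := clamp_le ab' (cc' i).
  - move=> i j _ _ [z [/= ]]; rewrite !in_itv /= => /andP[z1 z2] /andP[z3 z4].
    have [u1 u2] := clamp_oo ab' z1 z2; have [u3 u4] := clamp_oo ab' z3 z4.
    by apply: (tri i j) => //; exists z; rewrite /= !in_itv /= u1 u2 u3 u4.
  - apply: le_lt_trans lt; apply: ler_sum => i _.
    by have [_ ] := clamp_le ab' (cc' i).
have Tnd : {homo T : x y / x <= y}.
  by move=> x y /TVge H; rewrite -subr_ge0 (le_trans _ H).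
pose S x := T x - f (clamp a b x).
have Snd : {homo S : x y / x <= y}.
  move=> x y /TVge; rewrite ler_norml /S => /andP[_]; lra.
have Ssmall e : 0 < e -> exists2 d, 0 < d & small_incr S e d.
  move=> e0; have e20 : 0 < e / 2 by rewrite divr_gt0.
  have [d d0 Hd] := Tsmall _ e20; exists d => // n c c' cc' tri lt.
  have := Hd n c c' cc' tri lt => {}Hd.
  apply: (@le_trans _ _ (\sum_(i < n) 2 * (T (c' i) - T (c i)))).
    apply: ler_sum => i _; have := TVge _ _ (cc' i); rewrite ler_norml /S => /andP[]; lra.
  rewrite -mulr_sumr; lra.
have [g1 ig1 g1E] := small_incr_density ab' Tnd (small_incr_continuous Tnd Tsmall) Tsmall.
have [g2 ig2 g2E] := small_incr_density ab' Snd (small_incr_continuous Snd Ssmall) Ssmall.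
have ig : mu.-integrable setT (EFin \o (g1 \- g2)).
  by rewrite (_ : _ \o _ = (EFin \o g1) \- (EFin \o g2))%E //; exact: integrableB.
have igs (D : set R) (g : R -> R) : measurable D -> mu.-integrable setT (EFin \o g) -> mu.-integrable D (EFin \o g).
  by move=> mD; apply: integrableS.
have fE x y : a <= x -> x <= y -> y <= b -> f y - f x = \int[mu]_(t in `]x, y]) (g1 \- g2) t.
  move=> ax xy yb; rewrite RintegralB //; [|exact: igs|exact: igs].
  rewrite -g1E // -g2E // /S !clamp_id //; first by lra.
  - exact: le_trans yb.
  - exact: le_trans xy.
exists (g1 \- g2) => //; split => //.
have li : locally_integrable setT (g1 \- g2).
  by apply: open_integrable_locally => //; exact: openT.
pose G x := \int[mu]_(t in `]a, x]) (g1 \- g2) t.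
have := @FTC1 R (g1 \- g2) (BRight a) (fun y => igs _ _ (measurable_itv _) ig) li.
rewrite -/G; apply: filterS; first exact: (ae_filter_ringOfSetsType mu).
move=> x H xab.
have ax : a < x by move: xab; rewrite in_itv => /andP[].
have [dG G'] := H ax.
rewrite /deriv_in within_dnbhs_itv //; apply: cvg_lim => //.
apply: (derivable_diff_quot (F := G) xab) => //.
apply: filterS (near_in_itvoo xab) => y yab.
move: xab yab; rewrite !in_itv /= => /andP[_ xb] /andP[ay yb].
have GE z : a < z -> z < b -> G z = f z - f a by move=> az zb; rewrite /G -fE // ltW.
rewrite !GE //; ring.
Qed.

End derivatives.

(** * The Beta and Gamma functions *)

Section substitution.
Variable R : realType.
Local Notation mu := (@lebesgue_measure R).

Lemma open_continuous_measurableE (D : set R) (f : R -> R) : open D ->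
  {in D, continuous f} -> measurable_fun D (EFin \o f).
Proof.
by move=> oD cf; apply/measurable_EFinP; apply: open_continuous_measurable_fun.
Qed.

Lemma closed_itv_continuous_measurableE a b (D : set R) (f : R -> R) : open D ->
  {in D, continuous f} -> `[a, b]%classic `<=` D -> measurable_fun (`[a, b]%classic : set R) (EFin \o f).
Proof.
move=> oD cf abD; apply: (measurable_funS _ abD); first exact: open_measurable.
exact: open_continuous_measurableE.
Qed.

Lemma ge0_substitution_exhaustion (D E : set R) (a b : nat -> R) (F f G : R -> R) :
  (forall n, a n < b n) -> {homo a : m n / (m <= n)%N >-> n <= m} ->
  {homo b : m n / (m <= n)%N >-> m <= n} ->
  open D -> D = \bigcup_n `[a n, b n]%classic ->
  open E -> E = \bigcup_n `[F (a n), F (b n)]%classic ->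
  {in D &, {homo F : x y / x < y}} ->
  {in D, forall x : R, is_derive x 1 F (f x)} ->
  {in D, continuous f} -> {in D, forall x, 0 <= f x} ->
  {in E, continuous G} -> {in E, forall y, 0 <= G y} ->
  (\int[mu]_(y in E) (G y)%:E = \int[mu]_(x in D) (G (F x) * f x)%:E)%E.
Proof.
move=> ab nia ndb oD DE oE EE incF dF cf f0 cG G0.
have abD n : `[a n, b n]%classic `<=` D by move=> x xab; rewrite DE; exists n.
have FabE n : `[F (a n), F (b n)]%classic `<=` E by move=> x xab; rewrite EE; exists n.
have aD n : D (a n) by apply: (abD n); rewrite /= in_itv /= lexx ltW.
have bD n : D (b n) by apply: (abD n); rewrite /= in_itv /= lexx ltW.
have inD (x : R) : D x -> x \in D by move=> ?; rewrite inE.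
have dF' (x : R) : D x -> derivable F x 1 by move=> Dx; have [] := dF x (inD _ Dx).
have cF (x : R) : D x -> {for x, continuous F}.
  by move=> Dx; apply: differentiable_continuous; apply/derivable1_diffP; exact: dF'.
have ltF x y : D x -> D y -> x <= y -> F x <= F y.
  move=> Dx Dy; rewrite le_eqVlt => /predU1P[->//|xy].
  by apply/ltW/incF => //; exact: inD.
have FE x : D x -> E (F x).
  move=> Dx; have := Dx; rewrite {1}DE => -[n _ /= xab]; apply: (FabE n).
  by move: xab; rewrite /= !in_itv /= => /andP[ax xb]; rewrite !ltF.
have E0 (x : R) : D x -> derive1 F x = f x.
  by move=> Dx; rewrite derive1E; have dd := dF x (inD _ Dx); rewrite derive_val.
have step n : (\int[mu]_(y in `[F (a n), F (b n)]) (G y)%:E =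
    \int[mu]_(x in `[a n, b n]) (G (F x) * f x)%:E)%E.
  have near_eq (x : R) : D x -> {near x, f =1 derive1 F}.
    move=> Dx; have : nbhs x D by exact: open_nbhs_nbhs.
    by apply: filterS => y Dy; rewrite E0.
  rewrite (@integration_by_substitution_increasing R F G (a n) (b n)); first 1 last.
  - exact: ltW.
  - by move=> x y xab yab; apply: incF; apply: inD; exact: (abD n).
  - move=> x /subset_itv_oo_cc /(abD n) Dx.
    by rewrite /continuous_at E0 //; apply: cvg_trans (cf x (inD _ Dx)); exact: near_eq_cvg (near_eq x Dx).
  - apply/cvg_ex; exists (f (a n)); apply: cvg_at_right_filter.
    by apply: cvg_trans (cf _ (inD _ (aD n))); exact: near_eq_cvg (near_eq _ (aD n)).
  - apply/cvg_ex; exists (f (b n)); apply: cvg_at_left_filter.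
    by apply: cvg_trans (cf _ (inD _ (bD n))); exact: near_eq_cvg (near_eq _ (bD n)).
  - split; first by move=> x /subset_itv_oo_cc /(abD n) Dx; exact: dF'.
    + by apply: cvg_at_right_filter; exact: cF.
    + by apply: cvg_at_left_filter; exact: cF.
  - apply: continuous_in_subspaceT => y /[!inE] yab; apply: cG; rewrite inE.
    exact: (FabE n).
  by apply: eq_integral => x /[!inE] xab; rewrite !fctE /= E0 //; exact: (abD n).
have lim1 : (fun n => \int[mu]_(y in `[F (a n), F (b n)]) (G y)%:E)%E @ \oo -->
    (\int[mu]_(y in E) (G y)%:E)%E.
  rewrite EE; apply: ge0_nondecreasing_set_cvg_integral.
  - apply/nondecreasing_seqP => n; rewrite subsetEset.
    apply: subset_itv; rewrite bnd_simp; apply: ltF => //.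
    + exact: nia. + exact: ndb.
  - by move=> n; exact: measurable_itv.
  - by move=> n; apply: (@closed_itv_continuous_measurableE _ _ E).
  - by move=> n y /(FabE n) Ey; rewrite lee_fin G0 // inE.
have lim2 : (fun n => \int[mu]_(x in `[a n, b n]) (G (F x) * f x)%:E)%E @ \oo -->
    (\int[mu]_(x in D) (G (F x) * f x)%:E)%E.
  rewrite DE; apply: ge0_nondecreasing_set_cvg_integral.
  - apply/nondecreasing_seqP => n; rewrite subsetEset.
    by apply: subset_itv; rewrite bnd_simp; [exact: nia|exact: ndb].
  - by move=> n; exact: measurable_itv.
  - move=> n; apply: (@closed_itv_continuous_measurableE _ _ D) => //.
    move=> x /[!inE] Dx; apply: cvgM; last exact: cf (inD _ Dx).
    apply: (@continuous_comp _ _ _ F G); first exact: cF.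
    by apply: cG; rewrite inE; exact: FE.
  - move=> n x /(abD n) Dx; rewrite lee_fin mulr_ge0 ?f0 ?inE // G0 // inE; exact: FE.
have : (fun n => \int[mu]_(y in `[F (a n), F (b n)]) (G y)%:E)%E =
       (fun n => \int[mu]_(x in `[a n, b n]) (G (F x) * f x)%:E)%E.
  by apply/funext => n; exact: step.
move=> eq12; move: lim1; rewrite eq12 => /cvg_unique; apply => //.
Qed.

End substitution.

Section substitution_itv.
Variable R : realType.
Local Notation mu := (@lebesgue_measure R).

Lemma ex_div_natS_le (c e : R) : 0 < e -> exists n : nat, c / n.+3%:R <= e.
Proof.
move=> e0; exists (Num.trunc (`|c| / e)); rewrite ler_pdivrMr // mulrC -ler_pdivrMr //.
apply: (@le_trans _ _ (`|c| / e)); first by rewrite ler_pM2r ?invr_gt0 // ler_norm.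
by apply/ltW/(lt_trans (truncnS_gt _)); rewrite ltr_nat.
Qed.

Lemma div_natS_le (c : R) m n : 0 <= c -> (m <= n)%N -> c / n.+3%:R <= c / m.+3%:R.
Proof.
by move=> c0 mn; apply: ler_wpM2l => //; rewrite lef_pV2 ?posrE ?ltr0n // ler_nat !ltnS.
Qed.

Lemma ge0_substitution_oo (a b : R) (F f G : R -> R) : a < b ->
  {in `[a, b] &, {homo F : x y / x < y}} ->
  {within `[a, b], continuous F} ->
  {in `]a, b[, forall x : R, is_derive x 1 F (f x)} ->
  {in `]a, b[, continuous f} -> {in `]a, b[, forall x, 0 <= f x} ->
  {in `]F a, F b[, continuous G} -> {in `]F a, F b[, forall y, 0 <= G y} ->
  (\int[mu]_(y in `]F a, F b[) (G y)%:E = \int[mu]_(x in `]a, b[) (G (F x) * f x)%:E)%E.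
Proof.
move=> ab incF cF dF cf f0 cG G0.
have ba0 : 0 < b - a by rewrite subr_gt0.
pose r n := (b - a) / n.+3%:R.
have r0 n : 0 < r n by rewrite divr_gt0.
have r3 n : r n <= (b - a) / 3%:R by apply: (@div_natS_le _ 0); rewrite // ltW.
have abn n : a < a + r n /\ a + r n < b - r n /\ b - r n < b.
  by have := r3 n; have := r0 n; move: ba0; lra.
have itvoc (x : R) : x \in `]a, b[ -> x \in `[a, b] by exact: subset_itv_oo_cc.
have ea : a \in `[a, b] by rewrite in_itv /= lexx ltW.
have eb : b \in `[a, b] by rewrite in_itv /= lexx ltW.
apply: (@ge0_substitution_exhaustion _ _ _ (fun n => a + r n) (fun n => b - r n)).
- by move=> n; have [_ []] := abn n.
- by move=> m n mn; rewrite lerD2l; apply: div_natS_le => //; exact: ltW.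
- by move=> m n mn; rewrite lerD2l lerN2; apply: div_natS_le => //; exact: ltW.
- exact: interval_open.
- apply/seteqP; split => [x /=|x [n _] /=]; rewrite !in_itv /=.
    move=> /andP[ax xb].
    have [n hn] := @ex_div_natS_le (b - a) (Num.min (x - a) (b - x)) ltac:(by rewrite lt_min !subr_gt0 ax xb).
    move: hn; rewrite -/(r n) le_min => /andP[h1 h2]; exists n => //=; rewrite in_itv /=; lra.
  by have := abn n; lra.
- exact: interval_open.
- apply/seteqP; split => [y /=|y [n _] /=]; rewrite !in_itv /=.
    move=> /andP[ay yb].
    have [|x xab Fx] := @IVT _ F a b y (ltW ab) cF.
      by rewrite min_l ?max_r ?(ltW (lt_trans ay yb)) // !ltW.
    have {}xab : a < x < b.
      move: xab; rewrite in_itv /= => /andP[].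
      rewrite !le_eqVlt => /predU1P[xa|->] /predU1P[xb|->] //; move: ay yb; rewrite -Fx.
      + by rewrite xa xb ltxx. + by rewrite -xa ltxx. + by rewrite xb ltxx.
    move: xab => /andP[ax xb].
    have [n hn] := @ex_div_natS_le (b - a) (Num.min (x - a) (b - x)) ltac:(by rewrite lt_min !subr_gt0 ax xb).
    move: hn; rewrite -/(r n) le_min => /andP[h1 h2]; exists n => //=; rewrite in_itv /= -Fx.
    have leF (u v : R) : u \in `[a, b] -> v \in `[a, b] -> u <= v -> F u <= F v.
      by move=> uab vab; rewrite le_eqVlt => /predU1P[->//|uv]; apply/ltW/incF.
    by apply/andP; split; apply: leF; rewrite ?in_itv /=; have := abn n; lra.
  have Fa : F a < F (a + r n) by apply: incF; rewrite ?in_itv /=; have := abn n; lra.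
  have Fb : F (b - r n) < F b by apply: incF; rewrite ?in_itv /=; have := abn n; lra.
  by move=> /andP[h1 h2]; rewrite (lt_le_trans Fa h1) (le_lt_trans h2 Fb).
- by move=> x y; rewrite !inE /= => /itvoc xab /itvoc yab; exact: incF.
- by move=> x; rewrite inE /=; exact: dF.
- by move=> x; rewrite inE /=; exact: cf.
- by move=> x; rewrite inE /=; exact: f0.
- by move=> x; rewrite inE /=; exact: cG.
- by move=> x; rewrite inE /=; exact: G0.
Qed.

Lemma ge0_substitution_oy (a : R) (F f G : R -> R) :
  {in `[a, +oo[ &, {homo F : x y / x < y}} ->
  (forall b, a < b -> {within `[a, b], continuous F}) ->
  (forall M, exists2 x, a < x & M < F x) ->
  {in `]a, +oo[, forall x : R, is_derive x 1 F (f x)} ->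
  {in `]a, +oo[, continuous f} -> {in `]a, +oo[, forall x, 0 <= f x} ->
  {in `]F a, +oo[, continuous G} -> {in `]F a, +oo[, forall y, 0 <= G y} ->
  (\int[mu]_(y in `]F a, +oo[) (G y)%:E = \int[mu]_(x in `]a, +oo[) (G (F x) * f x)%:E)%E.
Proof.
move=> incF cF Fy dF cf f0 cG G0.
pose r (n : nat) : R := 1 / n.+3%:R.
have r0 n : 0 < r n by rewrite divr_gt0.
have r3 n : r n <= 1 / 3%:R by apply: (@div_natS_le _ 0).
have n0 n : 0 <= n%:R :> R by rewrite ler0n.
have abn n : a < a + r n /\ a + r n < a + n.+1%:R.
  by have := r3 n; have := r0 n; have := n0 n; have := @natr1 R n; lra.
have itvoc (x : R) : x \in `]a, +oo[ -> x \in `[a, +oo[ by rewrite !in_itv /= !andbT => /ltW.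
have leF (u v : R) : a <= u -> u <= v -> F u <= F v.
  move=> uab; rewrite le_eqVlt => /predU1P[->//|uv]; apply/ltW/incF => //; rewrite in_itv /= andbT //.
  by rewrite (le_trans uab) // ltW.
have cover (x : R) : a < x -> exists n, a + r n <= x /\ x <= a + n.+1%:R.
  move=> ax; have [n hn] := @ex_div_natS_le 1 (x - a) ltac:(by rewrite subr_gt0).
  pose m := Num.trunc (x - a); exists (maxn n m); split.
    by rewrite addrC -lerBrDr (le_trans _ hn) // div_natS_le // leq_maxl.
  have h : (m.+1%:R <= (maxn n m).+1%:R :> R) by rewrite ler_nat ltnS leq_maxr.
  have := truncnS_gt (x - a); rewrite -/m; lra.
apply: (@ge0_substitution_exhaustion _ _ _ (fun n => a + r n) (fun n => a + n.+1%:R)).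
- by move=> n; have [] := abn n.
- by move=> m n mn; rewrite lerD2l; apply: div_natS_le.
- by move=> m n mn; rewrite lerD2l ler_nat.
- exact: interval_open.
- apply/seteqP; split => [x /=|x [n _] /=]; rewrite !in_itv /= ?andbT.
    by move=> /cover[n [h1 h2]]; exists n => //=; rewrite in_itv /= h1.
  by have := abn n; lra.
- exact: interval_open.
- apply/seteqP; split => [y /=|y [n _] /=]; rewrite !in_itv /= ?andbT.
    move=> ay; have [b ab yb] := Fy y.
    have [|x xab Fx] := @IVT _ F a b y (ltW ab) (cF _ ab).
      by rewrite min_l ?max_r ?(ltW (lt_trans ay yb)) // !ltW.
    have {}xab : a < x.
      move: xab; rewrite in_itv /= => /andP[].
      by rewrite le_eqVlt => /predU1P[xa|//] ; move: ay; rewrite -Fx -xa ltxx.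
    have [n [h1 h2]] := cover _ xab; exists n => //=; rewrite in_itv /= -Fx.
    by apply/andP; split; apply: leF => //; have := abn n; lra.
  have Fa : F a < F (a + r n) by apply: incF; rewrite ?in_itv /=; have := abn n; lra.
  by move=> /andP[h1 h2]; rewrite (lt_le_trans Fa h1).
- by move=> x y; rewrite !inE /= => /itvoc xab /itvoc yab; exact: incF.
- by move=> x; rewrite inE /=; exact: dF.
- by move=> x; rewrite inE /=; exact: cf.
- by move=> x; rewrite inE /=; exact: f0.
- by move=> x; rewrite inE /=; exact: cG.
- by move=> x; rewrite inE /=; exact: G0.
Qed.

End substitution_itv.

Section gamma_beta.
Variable R : realType.
Local Notation mu := (@lebesgue_measure R).
Implicit Types (a b p x y z t s u : R).

Lemma continuous_powR p x : 0 < x -> {for x, continuous (fun y => y `^ p)}.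
Proof.
move=> x0; apply: differentiable_continuous; apply/derivable1_diffP.
by apply: derivable_powR; rewrite in_itv /= x0.
Qed.

Lemma within_continuous_powR p (M : R) : 0 < p -> 0 < M ->
  {within `[0, M], continuous (fun y : R => y `^ p)}.
Proof.
move=> p0 M0; apply/continuous_within_itvP => //; split.
- by move=> x; rewrite in_itv /= => /andP[x0 _]; exact: continuous_powR.
- by rewrite powR0 ?gt_eqF //; exact: powR_cvg0.
- by apply: cvg_at_left_filter; exact: continuous_powR.
Qed.

Lemma measurable_powR_cstB c p : measurable_fun setT (fun z : R => (c - z) `^ p).
Proof.
apply: (measurableT_comp (measurable_powR _)).
by apply: measurable_funB; [exact: measurable_cst|exact: measurable_id].
Qed.

Lemma measurable_powR_Bcst c p : measurable_fun setT (fun z : R => (z - c) `^ p).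
Proof.
apply: (measurableT_comp (measurable_powR _)).
by apply: measurable_funB; [exact: measurable_id|exact: measurable_cst].
Qed.

Lemma ge0_measurable_powRE p (D : set R) : measurable D -> measurable_fun D (fun t => (t `^ p)%:E).
Proof.
by move=> mD; apply/measurable_EFinP; apply: measurable_funTS; exact: measurable_powR.
Qed.

Lemma integral_powR01 a : 0 < a ->
  (\int[mu]_(z in `]0%R, 1%R[) (z `^ (a - 1))%:E = (a^-1)%:E)%E.
Proof.
move=> a0; have := @ge0_substitution_oo R 0 1 (fun z => z `^ a) (fun z => a * z `^ (a - 1)) (fun=> 1).
rewrite powR0 ?gt_eqF // powR1 => H.
have {}H : (\int[mu]_(y in `]0%R, 1%R[) 1%:E = \int[mu]_(z in `]0%R, 1%R[) (1 * (a * z `^ (a - 1)))%:E)%E.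
  apply: H => //.
  - move=> x y; rewrite !in_itv /= => /andP[x0 _] /andP[y0 _] xy.
    by apply: gt0_ltr_powR.
  - exact: within_continuous_powR.
  - by move=> x; rewrite in_itv /= => /andP[x0 _]; exact: is_derive1_powR.
  - move=> x; rewrite in_itv /= => /andP[x0 _]; apply: cvgM; first exact: cvg_cst.
    exact: continuous_powR.
  - by move=> x _; rewrite mulr_ge0 ?powR_ge0 ?ltW.
  - by move=> x _; exact: cvg_cst.
have m01 : mu `]0%R, 1%R[%classic = 1%E.
  by rewrite lebesgue_measure_itv /= lte_fin ltr01 oppr0 adde0.
have i1 : (\int[mu]_(y in `]0%R, 1%R[) 1%:E = 1)%E.
  by rewrite integral_cst ?mul1e; [exact: m01|exact: measurable_itv].
move: H; rewrite i1.
under eq_integral do rewrite mul1r EFinM.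
rewrite ge0_integralZl_EFin; [|exact: measurable_itv|by move=> x _; rewrite lee_fin powR_ge0|exact: ge0_measurable_powRE|exact: ltW].
by move=> H; rewrite -[RHS]mule1 H muleA -EFinM mulVf ?gt_eqF // mul1e.
Qed.

Definition gammaf x t : R := t `^ (x - 1) * expR (- t).
Definition gammaE x : \bar R := (\int[mu]_(t in `]0%R, +oo[) (gammaf x t)%:E)%E.
Definition betaE a b : \bar R := (\int[mu]_(z in `]0%R, 1%R[) ((1 - z) `^ (a - 1) * z `^ (b - 1))%:E)%E.

Lemma gammaf_ge0 x t : 0 <= gammaf x t.
Proof. by rewrite mulr_ge0 ?powR_ge0 ?expR_ge0. Qed.

Lemma measurable_gammaf x : measurable_fun setT (gammaf x).
Proof.
apply: measurable_funM; first exact: measurable_powR.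
by apply: measurableT_comp; [exact: measurable_expR|exact: oppr_measurable].
Qed.

Lemma continuous_expRN : continuous (fun t : R => expR (- t)).
Proof.
by move=> t; apply: (@continuous_comp _ _ _ (fun t : R => - t) expR); [exact: opp_continuous|exact: continuous_expR].
Qed.

Lemma continuous_gammaf x t : 0 < t -> {for t, continuous (gammaf x)}.
Proof.
by move=> t0; apply: cvgM; [exact: continuous_powR|exact: continuous_expRN].
Qed.

Lemma betaE_ge0 a b : (0 <= betaE a b)%E.
Proof. by apply: integral_ge0 => z _; rewrite lee_fin mulr_ge0 ?powR_ge0. Qed.

Lemma gammaE_ge0 a : (0 <= gammaE a)%E.
Proof. by apply: integral_ge0 => z _; rewrite lee_fin gammaf_ge0. Qed.

Lemma integral_expRNc c : 0 < c -> (\int[mu]_(t in `]0%R, +oo[) (expR (- (c * t)))%:E = (c^-1)%:E)%E.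
Proof.
move=> c0.
have cc : continuous (fun t : R => expR (- (c * t))).
  move=> t; apply: (@continuous_comp _ _ _ (fun t : R => c * t) (fun t => expR (- t))).
    by apply: cvgM; [exact: cvg_cst|exact: cvg_id].
  exact: continuous_expRN.
rewrite integral_itv_obnd_cbnd; last first.
  by apply: measurable_funTS; apply/measurable_EFinP; exact: continuous_measurable_fun.
have dF (t : R) : is_derive t 1 (fun t : R => - c^-1 * expR (- (c * t))) (expR (- (c * t))).
  apply: is_derive_eq; rewrite /GRing.scale /= ?mulr1 ?mulr0 ?addr0 ?add0r.
  by rewrite -[RHS]mul1r -(mulVf (lt0r_neq0 c0)); ring.
rewrite (@ge0_continuous_FTC2y R _ (fun t => - c^-1 * expR (- (c * t))) 0 0).
- by rewrite mulr0 oppr0 expR0 mulr1 -EFinB sub0r opprK.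
- by move=> t _; exact: expR_ge0.
- exact: continuous_subspaceT.
- rewrite -[X in _ --> X](mulr0 (- c^-1)); apply: cvgM; first exact: cvg_cst.
  apply: (@cvg_comp _ _ _ (fun t => c * t) (fun t : R => expR (- t)) _ +oo%R _ _ (@cvgr_expR R)).
  by apply: gt0_cvgMry => //; exact: cvg_id.
- by move=> t _; have [] := dF t.
- apply: cvg_at_right_filter; apply: cvgM; first exact: cvg_cst.
  exact: cc.
- by move=> t _; rewrite derive1E; have := dF t => ?; rewrite derive_val.
Qed.

Lemma gammaf_bound x t : 1 <= t ->
  gammaf x t <= (Num.trunc `|x|).+1.*2%:R ^+ (Num.trunc `|x|).+1 * expR (- (2^-1 * t)).
Proof.
set m := (Num.trunc `|x|).+1 => t1; rewrite /gammaf.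
have m0 : 0 < m%:R :> R by rewrite ltr0n.
have t0 : 0 < t by exact: lt_le_trans t1.
have xm : x - 1 <= m%:R.
  by have := truncnS_gt `|x|; rewrite -/m; have := ler_norm x; lra.
apply: (@le_trans _ _ (t ^+ m * expR (- t))).
  by rewrite ler_wpM2r ?expR_ge0 // -powR_mulrn ?(ltW t0) //; exact: ler_powR.
have -> : expR (- t) = expR (- (2^-1 * t)) * expR (- (2^-1 * t)) by rewrite -expRD; congr expR; lra.
rewrite mulrA ler_wpM2r ?expR_ge0 // expRN ler_pdivrMr ?expR_gt0 //.
have -> : 2^-1 * t = m%:R * (t / m.*2%:R).
  rewrite -muln2 natrM; field; rewrite gt_eqF //.
have m20 : 0 < m.*2%:R :> R by rewrite ltr0n double_gt0.
rewrite expRM_natl -exprMn; apply: lerXn2r; rewrite ?nnegrE.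
- exact: ltW.
- by apply: ltW; rewrite mulr_gt0 ?expR_gt0.
- rewrite -ler_pdivrMl // mulrC.
  by apply: le_trans (expR_ge1Dx _); rewrite lerDr.
Qed.

Lemma gammaE_lty x : 0 < x -> (gammaE x < +oo)%E.
Proof.
move=> x0; rewrite /gammaE.
have mg (D : set R) : measurable D -> measurable_fun D (fun t => (gammaf x t)%:E).
  by move=> mD; apply/measurable_EFinP; apply: measurable_funTS; exact: measurable_gammaf.
have -> : `]0, +oo[%classic = `]0, 1[%classic `|` `[1, +oo[%classic :> set R.
  apply/seteqP; split => t /=; rewrite !in_itv /= ?andbT.
    by move=> t0; have [|] := ltP t 1; rewrite t0; [left|right].
  by case=> [/andP[]//|]; exact: lt_le_trans.
rewrite ge0_integral_setU; first last.
- by apply/disj_setPS => t /= []; rewrite !in_itv /= andbT => /andP[_ t1]; rewrite leNgt t1.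
- by move=> t _; rewrite lee_fin gammaf_ge0.
- by apply: mg; apply: measurableU; exact: measurable_itv.
- exact: measurable_itv.
- exact: measurable_itv.
apply: lte_add_pinfty.
- apply: (@le_lt_trans _ _ (\int[mu]_(z in `]0%R, 1%R[) (z `^ (x - 1))%:E)%E).
    apply: ge0_le_integral.
    + exact: measurable_itv.
    + by move=> t _; rewrite lee_fin gammaf_ge0.
    + by apply: mg; exact: measurable_itv.
    + by apply: ge0_measurable_powRE; exact: measurable_itv.
    + move=> t; rewrite /= in_itv /= => /andP[t0 _]; rewrite lee_fin /gammaf ger_pMr ?powR_gt0 //.
      by rewrite -expR0 ler_expR; lra.
  by rewrite integral_powR01 // ltry.
- set C := (Num.trunc `|x|).+1.*2%:R ^+ (Num.trunc `|x|).+1 : R.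
  have C0 : 0 <= C by rewrite exprn_ge0.
  have me : measurable_fun setT (fun t : R => (expR (- (2^-1 * t)))%:E).
    apply/measurable_EFinP; apply: measurableT_comp; first exact: measurable_expR.
    by apply: measurableT_comp; [exact: oppr_measurable|exact: mulrl_measurable].
  apply: (@le_lt_trans _ _ (\int[mu]_(t in `[1%R, +oo[) (C * expR (- (2^-1 * t)))%:E)%E).
    apply: ge0_le_integral.
    + exact: measurable_itv.
    + by move=> t _; rewrite lee_fin gammaf_ge0.
    + by apply: mg; exact: measurable_itv.
    + apply: (measurable_funS measurableT) => //; under eq_fun do rewrite EFinM.
      by apply: emeasurable_funM => //; exact: measurable_cst.
    + by move=> t; rewrite /= in_itv /= andbT => t1; rewrite lee_fin; exact: gammaf_bound.
  under eq_integral do rewrite EFinM.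
  rewrite ge0_integralZl_EFin; [|exact: measurable_itv|by move=> t _; rewrite lee_fin expR_ge0|exact: (measurable_funS measurableT)|by []].
  apply: lte_mul_pinfty => //.
  apply: (@le_lt_trans _ _ (\int[mu]_(t in `]0%R, +oo[) (expR (- (2^-1 * t)))%:E)%E).
    apply: ge0_subset_integral; [exact: measurable_itv|exact: measurable_itv| | |].
    + exact: (measurable_funS measurableT).
    + by move=> t _; rewrite lee_fin expR_ge0.
    + by apply: subset_itv; rewrite bnd_simp.
  by rewrite integral_expRNc // ltry.
Qed.

End gamma_beta.

Section gamma_beta_theory.
Variable R : realType.
Local Notation mu := (@lebesgue_measure R).
Implicit Types (a b p x y z t s u : R).

Lemma integral_beta_kernel a b y x : y < x ->
  (\int[mu]_(z in `]y, x[) ((x - z) `^ (a - 1) * (z - y) `^ (b - 1))%:E =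
   ((x - y) `^ (a + b - 1))%:E * betaE a b)%E.
Proof.
move=> yx; have xy0 : 0 < x - y by rewrite subr_gt0.
pose F z : R := y + (x - y) * z.
have F0 : F 0 = y by rewrite /F mulr0 addr0.
have F1 : F 1 = x by rewrite /F mulr1; ring.
have cF z : {for z, continuous F}.
  by apply: cvgD; [exact: cvg_cst|apply: cvgM; [exact: cvg_cst|exact: cvg_id]].
have := @ge0_substitution_oo R 0 1 F (fun=> x - y) (fun z => (x - z) `^ (a - 1) * (z - y) `^ (b - 1)) ltr01.
rewrite F0 F1 => ->; first last.
- by move=> z _; rewrite mulr_ge0 ?powR_ge0.
- move=> z; rewrite in_itv /= => /andP[yz zx].
  apply: cvgM.
  + apply: (@continuous_comp _ _ _ (fun z => x - z) (fun z : R => z `^ (a - 1))).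
      by apply: cvgB; [exact: cvg_cst|exact: cvg_id].
    by apply: continuous_powR; rewrite subr_gt0.
  + apply: (@continuous_comp _ _ _ (fun z => z - y) (fun z : R => z `^ (b - 1))).
      by apply: cvgB; [exact: cvg_id|exact: cvg_cst].
    by apply: continuous_powR; rewrite subr_gt0.
- by move=> z _; exact: ltW.
- by move=> z _; exact: cvg_cst.
- move=> z _; rewrite /F; apply: is_derive_eq.
  by rewrite /GRing.scale /=; ring.
- by apply: continuous_subspaceT => z; exact: cF.
- by move=> z1 z2 _ _ z12; rewrite /F ltrD2l ltr_pM2l.
rewrite /betaE -ge0_integralZl_EFin; first last.
- exact: powR_ge0.
- apply/measurable_EFinP; apply: measurable_funTS; apply: measurable_funM.
    exact: measurable_powR_cstB.
  exact: measurable_powR.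
- by move=> z _; rewrite lee_fin mulr_ge0 ?powR_ge0.
- exact: measurable_itv.
apply: eq_integral => z /[!inE] /=; rewrite in_itv /= => /andP[z0 z1].
rewrite -EFinM; congr EFin; rewrite /F.
have -> : x - (y + (x - y) * z) = (x - y) * (1 - z) by ring.
have -> : y + (x - y) * z - y = (x - y) * z by ring.
rewrite !powRM ?subr_ge0 ?ltW //.
have xyn : x - y != 0 by rewrite gt_eqF.
have -> : a + b - 1 = (a - 1) + (b - 1) + 1 by ring.
have P r q : (x - y) `^ (r + q) = (x - y) `^ r * (x - y) `^ q by apply: powRD; rewrite xyn implybT.
rewrite (P (a - 1 + (b - 1))) (P (a - 1)) (powRr1 (ltW xy0)); ring.
Qed.

Lemma measurable_triangle p q (h : R -> R) : measurable_fun setT h ->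
  measurable_fun setT (fun su : R * R =>
   if (0 < su.1) && (su.1 < su.2) then su.1 `^ p * (su.2 - su.1) `^ q * h su.2 else 0).
Proof.
move=> mh; apply: measurable_fun_ifT.
- apply: measurable_and.
    by apply: measurable_fun_ltr; [exact: measurable_cst|exact: measurable_fst].
  by apply: measurable_fun_ltr; [exact: measurable_fst|exact: measurable_snd].
- apply: measurable_funM; last exact: (measurableT_comp mh measurable_snd).
  apply: measurable_funM; first exact: (measurableT_comp (measurable_powR p) measurable_fst).
  apply: (measurableT_comp (measurable_powR q)).
  by apply: measurable_funB; [exact: measurable_snd|exact: measurable_fst].
- exact: measurable_cst.
Qed.

Lemma gammaE_shift b s : (gammaE b = \int[mu]_(u in `]s, +oo[) (gammaf b (u - s))%:E)%E.
Proof.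
have := @ge0_substitution_oy R s (fun u => u - s) (fun=> 1) (gammaf b).
rewrite subrr -/(gammaE b) => ->.
- by apply: eq_integral => u _; rewrite mulr1.
- by move=> u v _ _ uv; rewrite ltrD2r.
- move=> v _; apply: continuous_subspaceT => u.
  by apply: cvgB; [exact: cvg_id|exact: cvg_cst].
- by move=> M; exists (s + `|M| + 1); have := ler_norm M; have := normr_ge0 M; lra.
- by move=> u _; apply: is_derive_eq; rewrite subr0.
- by move=> u _; exact: cvg_cst.
- by [].
- by move=> u; rewrite in_itv /= andbT; exact: continuous_gammaf.
- by move=> u _; exact: gammaf_ge0.
Qed.

Lemma gammaE_betaE a b : (gammaE a * gammaE b = gammaE (a + b) * betaE b a)%E.
Proof.
pose h (su : R * R) := if (0 < su.1) && (su.1 < su.2) then su.1 `^ (a - 1) * (su.2 - su.1) `^ (b - 1) * expR (- su.2) else 0.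
have mh : measurable_fun setT (EFin \o h).
  apply/measurable_EFinP; apply: (measurable_triangle (a - 1) (b - 1) (h := fun u : R => expR (- u))).
  by apply: measurableT_comp; [exact: measurable_expR|exact: oppr_measurable].
have h0 su : (0 <= (EFin \o h) su)%E.
  by rewrite lee_fin /h; case: ifP => // _; rewrite !mulr_ge0 ?powR_ge0 ?expR_ge0.
have mg x (D : set R) : measurable D -> measurable_fun D (EFin \o gammaf x).
  by move=> mD; apply/measurable_EFinP; apply: measurable_funTS; exact: measurable_gammaf.
have E1 : (gammaE a * gammaE b = \int[mu]_s \int[mu]_u (EFin \o h) (s, u))%E.
  rewrite {1}/gammaE -ge0_integralZr; first last.
  - exact: gammaE_ge0.
  - by move=> t _; rewrite lee_fin gammaf_ge0.
  - by apply: mg; exact: measurable_itv.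
  - exact: measurable_itv.
  rewrite integral_mkcond; apply: eq_integral => s _; rewrite patchE.
  case: ifPn => [|/negP] /[!inE] /=; rewrite in_itv /= andbT => s0; last first.
    rewrite integral0_eq // => u _; rewrite /h /=.
    by rewrite (negbTE (_ : ~~ (0 < s))) //; exact/negP.
  rewrite (gammaE_shift b s) -ge0_integralZl_EFin; first last.
  - exact: gammaf_ge0.
  - apply/measurable_EFinP; apply: measurable_funTS; apply: (measurableT_comp (measurable_gammaf b)).
    by apply: measurable_funB; [exact: measurable_id|exact: measurable_cst].
  - by move=> t _; rewrite lee_fin gammaf_ge0.
  - exact: measurable_itv.
  rewrite integral_mkcond; apply: eq_integral => u _; rewrite patchE /h /= s0 /=.
  case: ifPn => [|/negP] /[!inE] /=; rewrite in_itv /= andbT => su; last by rewrite (negbTE (introN idP su)).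
  rewrite su -EFinM; congr EFin; rewrite /gammaf.
  have -> : - u = - s + - (u - s) by ring.
  rewrite expRD; ring.
have E2 : (gammaE (a + b) * betaE b a = \int[mu]_u \int[mu]_s (EFin \o h) (s, u))%E.
  rewrite {1}/gammaE -ge0_integralZr; first last.
  - exact: betaE_ge0.
  - by move=> t _; rewrite lee_fin gammaf_ge0.
  - by apply: mg; exact: measurable_itv.
  - exact: measurable_itv.
  rewrite integral_mkcond; apply: eq_integral => u _; rewrite patchE.
  case: ifPn => [|/negP] /[!inE] /=; rewrite in_itv /= andbT => u0; last first.
    rewrite integral0_eq // => s _; rewrite /h /=.
    by case: ifPn => // /andP[s0 su]; case: u0; exact: lt_trans su.
  have := @integral_beta_kernel b a 0 u u0; rewrite subr0 => K.
  rewrite /gammaf EFinM -muleA (muleC (expR _)%:E) muleA (addrC a b) -K.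
  rewrite -ge0_integralZr; first last.
  - by rewrite lee_fin expR_ge0.
  - by move=> t _; rewrite lee_fin mulr_ge0 ?powR_ge0.
  - apply/measurable_EFinP; apply: measurable_funTS; apply: measurable_funM.
      exact: measurable_powR_cstB.
    exact: measurable_powR_Bcst.
  - exact: measurable_itv.
  rewrite integral_mkcond; apply: eq_integral => s _; rewrite patchE /h /=.
  case: ifPn => [|/negP] /[!inE] /=; rewrite in_itv /= => su; last by rewrite (negbTE (introN idP su)).
  rewrite su -EFinM subr0; congr EFin; ring.
by rewrite E1 E2; exact: (@fubini_tonelli _ _ _ _ R mu mu (EFin \o h) mh h0).
Qed.

End gamma_beta_theory.

Section Gamma_theory.
Variable R : realType.
Local Notation mu := (@lebesgue_measure R).
Implicit Types (a b p x y z t s u : R).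

Lemma GammaK x : 0 < x -> ((Gamma x)%:E = gammaE x)%E.
Proof.
move=> x0; rewrite /Gamma /Rintegral -/(gammaE x) fineK //.
by rewrite ge0_fin_numE ?gammaE_ge0 // gammaE_lty.
Qed.

Lemma Gamma_ge0 x : 0 <= Gamma x.
Proof. by apply: fine_ge0; exact: gammaE_ge0. Qed.

Lemma integrable_gammaf x : 0 < x -> mu.-integrable `]0, +oo[ (EFin \o gammaf x).
Proof.
move=> x0; apply/integrableP; split.
  by apply/measurable_EFinP; apply: measurable_funTS; exact: measurable_gammaf.
have -> : (\int[mu]_(t in `]0%R, +oo[) `|(EFin \o gammaf x) t| = gammaE x)%E.
  by apply: eq_integral => t _; rewrite /= ger0_norm ?gammaf_ge0.
exact: gammaE_lty.
Qed.

Lemma Gamma1 : Gamma 1 = 1 :> R.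
Proof.
have := integral_expRNc (@ltr01 R); rewrite invr1 => H.
rewrite /Gamma /Rintegral -[RHS]/(fine 1%E) -H; congr fine.
by apply: eq_integral => t _; rewrite subrr powRr0 !mul1r.
Qed.

Lemma GammaD1 x : 0 < x -> Gamma (x + 1) = x * Gamma x.
Proof.
move=> x0; have := @gammaE_betaE R x 1.
have -> : betaE 1 x = (x^-1)%:E.
  rewrite -(integral_powR01 x0); apply: eq_integral => z _.
  by rewrite subrr powRr0 mul1r.
rewrite -!GammaK ?addr_gt0 // Gamma1 mule1 => -[->].
by rewrite mulrCA mulfV ?gt_eqF // mulr1.
Qed.

Lemma Gamma_nat n : Gamma n.+1%:R = n`!%:R :> R.
Proof.
elim: n => [|n IH]; first by rewrite Gamma1 fact0.
by rewrite -natr1 GammaD1 ?ltr0n // IH factS natrM.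
Qed.

Lemma Gamma_log_convex x y : 0 < x -> 0 < y ->
  Gamma ((x + y) / 2) ^+ 2 <= Gamma x * Gamma y.
Proof.
move=> x0 y0; set m := (x + y) / 2.
have m0 : 0 < m by rewrite /m divr_gt0 // addr_gt0.
have key l : 2 * l * Gamma m <= l ^+ 2 * Gamma x + Gamma y.
  have I c z : 0 < z -> mu.-integrable `]0, +oo[ (EFin \o (fun t => c * gammaf z t)).
    move=> z0; rewrite (_ : EFin \o _ = (fun t => c%:E * (EFin \o gammaf z) t)%E) //.
    by apply: integrableZl; [exact: measurable_itv|exact: integrable_gammaf].
  rewrite /Gamma -!RintegralZl; [|exact: measurable_itv|exact: integrable_gammaf|exact: measurable_itv|exact: integrable_gammaf].
  rewrite -RintegralD; [|exact: measurable_itv|exact: I|exact: integrable_gammaf].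
  apply: le_Rintegral; [exact: measurable_itv|exact: I| |].
    rewrite (_ : EFin \o _ = (EFin \o (fun t => l ^+ 2 * gammaf x t)%R) \+ (EFin \o gammaf y))%E //.
    by apply: integrableD; [exact: measurable_itv|exact: I|exact: integrable_gammaf].
  move=> t; rewrite /= in_itv /= andbT => t0.
  pose q z := t `^ ((z - 1) / 2) * expR (- t / 2).
  have qq v w : gammaf ((v + w) / 2) t = q v * q w.
    rewrite /gammaf /q mulrACA -expRD -powRD; last by rewrite (gt_eqF t0) implybT.
    by congr (_ `^ _ * expR _); field.
  have qz : forall v, t `^ (v - 1) * expR (- t) = q v * q v.
    move=> v.
    by rewrite -qq /gammaf; congr (_ `^ _ * _); field.
  have qm : t `^ (m - 1) * expR (- t) = q x * q y by rewrite -qq.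
  rewrite /gammaf qm !qz.
  have := sqr_ge0 (l * q x - q y); nra.
move: key (Gamma_ge0 x) (Gamma_ge0 y) (Gamma_ge0 m).
move: (Gamma x) (Gamma y) (Gamma m) => a b c key a0 b0 c0.
have [a00|an0] := eqVneq a 0.
  suff -> : c = 0 by rewrite expr0n mulr_ge0.
  apply/eqP/negPn/negP => mn0.
  have := key ((b + 1) / c); rewrite a00 mulr0 add0r -mulrA mulfVK //; lra.
have {}a0 : 0 < a by rewrite lt0r an0.
have := key (c / a); rewrite -(ler_pM2r a0).
have -> : 2 * (c / a) * c * a = 2 * c ^+ 2 by field.
have -> : ((c / a) ^+ 2 * a + b) * a = c ^+ 2 + a * b by field.
lra.
Qed.

Lemma Gamma_gt0 x : 0 < x -> 0 < Gamma x.
Proof.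
move=> x0; rewrite lt0r Gamma_ge0 andbT; apply/negP => /eqP Gx0.
pose m := (Num.trunc x).+1%:R : R.
have mx : x < m by exact: truncnS_gt.
have := @Gamma_log_convex x (2 * m - x) x0 ltac:(lra).
have -> : (x + (2 * m - x)) / 2 = m by field.
rewrite Gx0 mul0r /m Gamma_nat => h.
by have := lt_le_trans (_ : 0 < (Num.trunc x)`!%:R ^+ 2) h; rewrite ltxx exprn_gt0 // ?ltr0n ?fact_gt0 // => /(_ isT).
Qed.

Lemma betaE_Gamma a b : 0 < a -> 0 < b ->
  betaE a b = (Gamma a * Gamma b / Gamma (a + b))%:E.
Proof.
move=> a0 b0; have ab0 := addr_gt0 a0 b0.
have := @gammaE_betaE R b a; rewrite -!GammaK // addrC -?GammaK // ?(addrC b a) // => H.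
have G0 := Gamma_gt0 ab0.
have : ((Gamma (a + b))^-1%:E * ((Gamma b)%:E * (Gamma a)%:E) = betaE a b)%E.
  by rewrite H muleA -EFinM mulVf ?gt_eqF // mul1e.
by move=> <-; rewrite -!EFinM; congr EFin; ring.
Qed.

Lemma Gamma_half_sqr : Gamma (1 / 2) ^+ 2 = pi :> R.
Proof.
suff -> : Gamma (1 / 2) = Num.sqrt pi :> R by rewrite sqr_sqrtr // pi_ge0.
have h0 : 0 < 1 / 2 :> R by rewrite divr_gt0.
have := @ge0_substitution_oy R 0 (fun r => r ^+ 2) (fun r => 2 * r) (gammaf (1 / 2)).
rewrite expr0n /= -/(gammaE (1 / 2)) -GammaK // => H.
suff : ((Gamma (1 / 2))%:E = (Num.sqrt pi : R)%:E)%E by case.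
rewrite H.
- have -> : (Num.sqrt pi)%:E = (2%:E * \int[mu]_(x in `]0%R, +oo[) (gauss_fun x)%:E)%E.
    rewrite integral_itv_obnd_cbnd ?integral0y_gauss; last first.
      by apply/measurable_EFinP; apply: measurable_funTS; exact: measurable_gauss_fun.
    by rewrite -EFinM mulrC divfK.
  rewrite -ge0_integralZl_EFin; [|exact: measurable_itv|by move=> x _; rewrite lee_fin gauss_fun_ge0| |by []]; last first.
    by apply/measurable_EFinP; apply: measurable_funTS; exact: measurable_gauss_fun.
  apply: eq_integral => r /[!inE] /=; rewrite in_itv /= andbT => r0.
  rewrite -EFinM; congr EFin; rewrite /gammaf /gauss_fun.
  have -> : (r ^+ 2) `^ (1 / 2 - 1) = r^-1.
    rewrite -(powR_mulrn 2 (ltW r0)) -powRrM.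
    have -> : 2%:R * (1 / 2 - 1) = - 1 :> R by field.
    by rewrite powR_inv1 // ltW.
  by field; rewrite gt_eqF.
- move=> x y; rewrite !in_itv /= !andbT => x0 y0 xy.
  by rewrite ltr_pXn2r // nnegrE.
- by move=> b _; apply: continuous_subspaceT; exact: exprn_continuous.
- move=> M; exists (`|M| + 1); first by have := normr_ge0 M; lra.
  have := ler_norm M; have := normr_ge0 M; nra.
- by move=> r _; apply: is_derive_eq; rewrite /GRing.scale /=; ring.
- by move=> r _; apply: cvgM; [exact: cvg_cst|exact: cvg_id].
- by move=> r; rewrite in_itv /= andbT => r0; rewrite mulr_ge0 // ltW.
- by move=> r; rewrite in_itv /= andbT; exact: continuous_gammaf.
- by move=> r _; exact: gammaf_ge0.
Qed.

Lemma lebesgue_measure_reflect c (A : set R) : measurable A ->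
  mu A = pushforward mu ((fun x => c - x) : measurableTypeR R -> measurableTypeR R) A.
Proof.
have mf : measurable_fun setT ((fun x => c - x) : measurableTypeR R -> measurableTypeR R).
  by apply: measurable_funB; [exact: measurable_cst|exact: measurable_id].
move=> mA; apply: (@lebesgue_measure_unique R (pushforward mu ((fun x => c - x) : measurableTypeR R -> measurableTypeR R))) => //= _ [[a b]] _ <-.
rewrite /pushforward (_ : _ @^-1` _ = `[c - b, c - a[%classic).
  by rewrite !lebesgue_measure_itv /= !lte_fin ltrD2l ltrN2 -!EFinB; case: ifP => // _; congr EFin; ring.
by apply/seteqP; split => x /=; rewrite !in_itv /=; lra.
Qed.

Lemma ge0_integral_reflect c (D : set R) (f : R -> \bar R) : measurable D ->
  measurable_fun D f -> (forall x, D x -> (0 <= f x)%E) ->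
  (\int[mu]_(x in D) f x = \int[mu]_(x in (fun x => c - x)%R @^-1` D) f (c - x)%R)%E.
Proof.
move=> mD mf f0.
have mr : measurable_fun setT ((fun x => c - x) : measurableTypeR R -> measurableTypeR R).
  by apply: measurable_funB; [exact: measurable_cst|exact: measurable_id].
rewrite -(@ge0_integral_pushforward _ _ _ _ _ _ mr mu D f) //.
by apply: eq_measure_integral => A mA _; exact: lebesgue_measure_reflect.
by move=> x /[!inE]; exact: f0.
Qed.

Lemma betaE_half x : betaE x (1 / 2) = ((2 `^ (2 * x - 1))%:E * betaE x x)%E.
Proof.
have m2 : measurable_fun setT (fun z : R => ((1 - z) `^ (x - 1) * z `^ (x - 1))%:E).
  apply/measurable_EFinP; apply: measurable_funM; last exact: measurable_powR.
  exact: measurable_powR_cstB.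
pose I := (\int[mu]_(z in `](2^-1)%R, 1%R[) ((1 - z) `^ (x - 1) * z `^ (x - 1))%:E)%E.
have f0 z : (0 <= ((1 - z) `^ (x - 1) * z `^ (x - 1))%:E)%E by rewrite lee_fin mulr_ge0 ?powR_ge0.
have mitv (i : interval R) : measurable ([set` i] : set R) by exact: measurable_itv.
have E1 : betaE x x = (2%:E * I)%E.
  rewrite /betaE.
  have -> : `]0, 1[%classic = `]0, 2^-1[%classic `|` `[2^-1, 1[%classic :> set R.
    by apply/seteqP; split => t /=; rewrite !in_itv /=; have [|] := ltP t 2^-1; lra.
  rewrite ge0_integral_setU => //; first last.
  - by apply/disj_setPS => t /= []; rewrite !in_itv /=; lra.
  - by apply: (measurable_funS measurableT).
  rewrite -integral_itv_obnd_cbnd; last exact: (measurable_funS measurableT).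
  rewrite -/I.
  rewrite (@ge0_integral_reflect 1 `]0, 2^-1[) //; last exact: (measurable_funS measurableT).
  rewrite (_ : _ @^-1` _ = `](2^-1)%R, 1%R[%classic); last first.
    by apply/seteqP; split => t /=; rewrite !in_itv /=; lra.
  have -> : (\int[mu]_(z in `](2^-1)%R, 1%R[) ((1 - (1 - z)) `^ (x - 1) * (1 - z) `^ (x - 1))%:E = I)%E.
    by apply: eq_integral => z _; rewrite subKr mulrC.
  have -> : (2%:E = 1%:E + 1%:E :> \bar R)%E by rewrite -EFinD.
  by rewrite ge0_muleDl ?lee_fin // !mul1e.
have := @ge0_substitution_oo R 2^-1 1 (fun z => (2 * z - 1) ^+ 2) (fun z => 4 * (2 * z - 1))
  (fun y => (1 - y) `^ (x - 1) * y `^ (1 / 2 - 1)).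
rewrite (_ : (2 * 2^-1 - 1) ^+ 2 = 0 :> R); last by field.
rewrite (_ : (2 * 1 - 1) ^+ 2 = 1 :> R); last by ring.
rewrite -/(betaE x (1 / 2)) => ->; first last.
- by move=> y _; rewrite mulr_ge0 ?powR_ge0.
- move=> y; rewrite in_itv /= => /andP[y0 y1]; apply: cvgM; last exact: continuous_powR.
  apply: (@continuous_comp _ _ _ (fun z => 1 - z) (fun z : R => z `^ (x - 1))).
    by apply: cvgB; [exact: cvg_cst|exact: cvg_id].
  by apply: continuous_powR; rewrite subr_gt0.
- by move=> z; rewrite in_itv /=; lra.
- move=> z _; apply: cvgM; first exact: cvg_cst.
  by apply: cvgB; [apply: cvgM; [exact: cvg_cst|exact: cvg_id]|exact: cvg_cst].
- by move=> z _; apply: is_derive_eq; rewrite /GRing.scale /=; ring.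
- apply: continuous_subspaceT => z; apply: (@continuous_comp _ _ _ (fun z : R => 2 * z - 1) (fun z : R => z ^+ 2)).
    by apply: cvgB; [apply: cvgM; [exact: cvg_cst|exact: cvg_id]|exact: cvg_cst].
  exact: exprn_continuous.
- by move=> y z; rewrite !in_itv /= => /andP[y0 _] /andP[z0 _] yz; nra.
- by rewrite invf_lt1 // ltr1n.
rewrite E1 muleA -EFinM /I -ge0_integralZl_EFin; [|exact: mitv|by move=> z _; exact: f0|by apply: (measurable_funS measurableT)|by rewrite mulr_ge0 ?powR_ge0].
apply: eq_integral => z /[!inE] /=; rewrite in_itv /= => /andP[z0 z1].
rewrite -EFinM; congr EFin.
have w0 : 0 < 2 * z - 1 by have := z0; lra.
have z00 : 0 < z by have := z0; lra.
have -> : 1 - (2 * z - 1) ^+ 2 = 4 * ((1 - z) * z) by ring.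
have -> : ((2 * z - 1) ^+ 2) `^ (1 / 2 - 1) = (2 * z - 1)^-1.
  rewrite -(powR_mulrn 2 (ltW w0)) -powRrM.
  have -> : 2%:R * (1 / 2 - 1) = - 1 :> R by field.
  by rewrite powR_inv1 // ltW.
have P2 : 2 `^ (2 * x - 1) = 4 `^ (x - 1) * 2 :> R.
  have -> : 4 = 2 `^ 2%:R :> R by rewrite powR_mulrn //; ring.
  rewrite -powRrM -[X in _ = _ * X](powRr1 (ler0n R 2)) -powRD ?pnatr_eq0 ?implybT //.
  by congr (_ `^ _); ring.
rewrite P2 !powRM ?subr_ge0 ?mulr_ge0 ?subr_ge0 ?ltW //.
by field; rewrite gt_eqF.
Qed.

Lemma Gamma_duplication x : 0 < x ->
  Gamma x * Gamma (x + 1 / 2) * 2 `^ (2 * x - 1) = Gamma (1 / 2) * Gamma (2 * x).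
Proof.
move=> x0; have h0 : 0 < 1 / 2 :> R by rewrite divr_gt0.
have x20 : 0 < x + x by rewrite addr_gt0.
have xh0 : 0 < x + 1 / 2 by rewrite addr_gt0.
have := betaE_half x; rewrite !betaE_Gamma // -EFinM => -[].
have Gx := Gamma_gt0 x0; have Gh := Gamma_gt0 h0; have Gxx := Gamma_gt0 x20; have Gxh := Gamma_gt0 xh0.
have -> : 2 * x = x + x by ring.
move: Gx Gh Gxx Gxh; move: (Gamma x) (Gamma (1 / 2)) (Gamma (x + x)) (Gamma (x + 1 / 2)) (2 `^ _).
move=> a b c d P a0 b0 c0 d0 H; apply: (mulfI (lt0r_neq0 a0)).
transitivity ((P * (a * a / c)) * d * c); first by field; rewrite gt_eqF.
by rewrite -H; field; rewrite gt_eqF.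
Qed.

End Gamma_theory.

Section Gamma_bounds_abstract.
Variable R : realType.
Implicit Types (a b c m x y z s : R).

(* Abstracting [Gamma] keeps the conversion tests of the arithmetic tactics from
   unfolding integrals. *)
Variables (G : R -> R) (p : R).
Hypothesis p0 : 0 < p.
Hypothesis G_gt0 : forall x, 0 < x -> 0 < G x.
Hypothesis G_D1 : forall x, 0 < x -> G (x + 1) = x * G x.
Hypothesis G_half_sqr_le : forall x, 0 < x -> G (x + 1 / 2) ^+ 2 <= x * G x ^+ 2.
Hypothesis G_reflection_ge : forall z, 0 < z -> z < 1 -> p <= G z * G (1 - z).
Hypothesis G_half_sqr : G (1 / 2) ^+ 2 = p.
Hypothesis G_duplication : forall x, 0 < x ->
  G x * G (x + 1 / 2) * 2 `^ (2 * x - 1) = G (1 / 2) * G (2 * x).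

Let G_ge0 x : 0 < x -> 0 <= G x. Proof. by move=> /G_gt0 /ltW. Qed.
Let S1 n : n.+1%:R = n%:R + 1 :> R. Proof. by rewrite -addn1 natrD. Qed.
Let S2 n : n.+2%:R = n%:R + 2 :> R. Proof. by rewrite -addn2 natrD. Qed.

Lemma parity_product_bound m (e : nat -> R) : 0 < m ->
  e 0%N = (G (m / 2 + 1))^-1 -> e 1%N = (G ((m + 1) / 2))^-1 ->
  (forall n, e n.+2 = (m - n%:R) / 2 * e n) ->
  forall n, m < n%:R -> `|e n| <= G ((n%:R - m) / 2) / p.
Proof.
move=> m0 e0 e1 eS.
have exact_n n : (n%:R < m + 2 -> e n = (G ((m - n%:R) / 2 + 1))^-1) /\
                 (n.+1%:R < m + 2 -> e n.+1 = (G ((m - n.+1%:R) / 2 + 1))^-1).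
  elim: n => [|n [IH1 IH2]].
    split => _; first by rewrite e0 subr0.
    by rewrite e1; congr (_^-1); congr G; field.
  split => // lt; rewrite eS IH1; last by apply: lt_trans lt; rewrite ltr_nat.
  have nm : 0 < (m - n%:R) / 2 by move: lt; rewrite (S2 n); lra.
  rewrite G_D1 // invfM mulrA mulfV ?gt_eqF // mul1r.
  by congr (_^-1); congr G; rewrite (S2 n); field.
have base n : m < n%:R -> n%:R < m + 2 -> `|e n| <= G ((n%:R - m) / 2) / p.
  move=> mn nm; rewrite (exact_n n).1 //.
  have z0 : 0 < (n%:R - m) / 2 by lra.
  have z1 : (n%:R - m) / 2 < 1 by lra.
  have -> : (m - n%:R) / 2 + 1 = 1 - (n%:R - m) / 2 by field.
  have G0 : 0 < G (1 - (n%:R - m) / 2) by apply: G_gt0; lra.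
  rewrite ger0_norm ?invr_ge0 ?(ltW G0) // ler_pdivlMr // mulrC ler_pdivrMr //.
  exact: G_reflection_ge.
have step n : (m < n%:R -> `|e n| <= G ((n%:R - m) / 2) / p) /\
              (m < n.+1%:R -> `|e n.+1| <= G ((n.+1%:R - m) / 2) / p).
  elim: n => [|n [IH1 IH2]]; split => //.
  - by move=> h; move: (lt_trans m0 h); rewrite ltxx.
  - by move=> h; apply: base => //; lra.
  - move=> h; have [|] := ltP (n.+2%:R) (m + 2); first exact: base.
    rewrite (S2 n) => h2; have := eS n; have [nm|nm] := eqVneq n%:R m.
      move=> ->; rewrite nm subrr !mul0r normr0 divr_ge0 ?(ltW p0) //.
      by apply/ltW/G_gt0; lra.
    have h3 : m < n%:R by rewrite lt_neqAle eq_sym nm /=; lra.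
    move=> ->; have z0 : 0 < (n%:R - m) / 2 by lra.
    have -> : (n%:R + 2 - m) / 2 = (n%:R - m) / 2 + 1 by field.
    rewrite G_D1 // normrM -mulrA ler_pM ?normr_ge0 ?IH1 //.
    by rewrite ler0_norm; lra.
by move=> n; case: (step n).
Qed.

Lemma envelope_bound m (al : nat -> R) : 0 < m ->
  al 0%N = (G (m + 2))^-1 -> al 1%N = ((m + 2) * G (m + 1))^-1 ->
  (forall n, (n%:R + m + 3) * al n.+2 = - (n%:R - m) * al n) ->
  forall n, m < n%:R ->
    al n ^+ 2 * (G ((n%:R + m + 3) / 2) ^+ 2 * (2 `^ (m + 1)) ^+ 2 * p) <= G ((n%:R - m) / 2) ^+ 2.
Proof.
move=> m0 al0 al1 alS n mn.
have Gh : 0 < G (1 / 2) :> R by apply: G_gt0; rewrite divr_gt0.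
have P0 : 0 < 2 `^ (m + 1) :> R by exact: powR_gt0.
pose e n := al n * G ((n%:R + m + 3) / 2) * 2 `^ (m + 1) / G (1 / 2).
have bnd : `|e n| <= G ((n%:R - m) / 2) / p.
  apply: (@parity_product_bound m) => //.
  - have h : 0 < m / 2 + 1 by lra.
    have := G_duplication h.
    have -> : 2 * (m / 2 + 1) - 1 = m + 1 by field.
    have -> : 2 * (m / 2 + 1) = m + 2 by field.
    have -> : m / 2 + 1 + 1 / 2 = (m + 3) / 2 by field.
    rewrite /e al0 add0r => D.
    have G1 := G_gt0 h; have G2 : 0 < G (m + 2) by apply: G_gt0; lra.
    have -> : (G (m + 2))^-1 * G ((m + 3) / 2) * 2 `^ (m + 1) / G (1 / 2) =
       (G (m / 2 + 1) * G ((m + 3) / 2) * 2 `^ (m + 1)) / (G (m + 2) * G (1 / 2) * G (m / 2 + 1)).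
      by field; rewrite !gt_eqF.
    by rewrite D; field; rewrite !gt_eqF.
  - have h : 0 < (m + 1) / 2 by lra.
    have := G_duplication h.
    have -> : 2 * ((m + 1) / 2) - 1 = m by field.
    have -> : 2 * ((m + 1) / 2) = m + 1 by field.
    have -> : (m + 1) / 2 + 1 / 2 = m / 2 + 1 by field.
    rewrite /e al1 => D.
    have h' : 0 < m / 2 + 1 by lra.
    have -> : (1 + m + 3) / 2 = m / 2 + 1 + 1 by field.
    rewrite (G_D1 h').
    have -> : 2 `^ (m + 1) = 2 `^ m * 2 :> R.
      by rewrite powRD ?pnatr_eq0 ?implybT // powRr1.
    have G1 := G_gt0 h; have G2 : 0 < G (m + 1) by apply: G_gt0; lra.
    have G3 := G_gt0 h'.
    have m2 : 0 < m + 2 by lra.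
    have -> : ((m + 2) * G (m + 1))^-1 * ((m / 2 + 1) * G (m / 2 + 1)) * (2 `^ m * 2) / G (1 / 2) =
      (G ((m + 1) / 2) * G (m / 2 + 1) * 2 `^ m) / (G (m + 1) * G (1 / 2) * G ((m + 1) / 2)).
      by field; rewrite !gt_eqF.
    by rewrite D; field; rewrite !gt_eqF.
  - move=> k; rewrite /e.
    have k0 : 0 <= k%:R :> R by rewrite ler0n.
    have h : 0 < (k%:R + m + 3) / 2 by lra.
    have -> : (k.+2%:R + m + 3) / 2 = (k%:R + m + 3) / 2 + 1 by rewrite (S2 k); field.
    rewrite G_D1 //.
    transitivity (((k%:R + m + 3) * al k.+2) / 2 * G ((k%:R + m + 3) / 2) * 2 `^ (m + 1) / G (1 / 2)).
      by field; rewrite gt_eqF.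
    by rewrite alS; field; rewrite gt_eqF.
have : `|e n| ^+ 2 <= (G ((n%:R - m) / 2) / p) ^+ 2.
  by rewrite lerXn2r // nnegrE // divr_ge0 ?(ltW p0) // G_ge0 //; lra.
rewrite real_normK ?num_real // /e => H.
move: H; rewrite !exprMn !exprVn G_half_sqr ler_pdivlMr ?exprn_gt0 // => H.
apply: le_trans H; rewrite le_eqVlt; apply/orP; left; apply/eqP.
by field; rewrite gt_eqF.
Qed.

(* Both G quotients are controlled by the midpoint log-convexity alone,
   since b - c >= 1/2. *)
Lemma G_half_ratio_le b c : 0 < c -> c + 1 / 2 <= b ->
  G (c + 1 / 2) * G b <= G c * G (b + 1 / 2) /\
  c * G c * G (b + 1 / 2) <= b * (G (c + 1 / 2) * G b).
Proof.
move=> c0 cb; have b0 : 0 < b by lra.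
have ch0 : 0 < c + 1 / 2 by lra.
have bh0 : 0 < b - 1 / 2 by lra.
have bh1 : 0 < b + 1 / 2 by lra.
have Gc := G_gt0 c0; have Gb := G_gt0 b0.
have Gch := G_gt0 ch0; have Gbh := G_gt0 bh0; have Gbh1 := G_gt0 bh1.
have Ec := G_half_sqr_le c0.
have Eb := G_half_sqr_le b0.
have Ech := G_half_sqr_le ch0.
have Ebh := G_half_sqr_le bh0.
have c1 : c + 1 / 2 + 1 / 2 = c + 1 by field.
have b1 : b - 1 / 2 + 1 / 2 = b by field.
have b2 : G (b + 1 / 2) = (b - 1 / 2) * G (b - 1 / 2).
  by rewrite -G_D1 //; congr G; field.
rewrite c1 G_D1 // in Ech; rewrite b1 in Ebh.
have Eb' : (b - 1 / 2) * G b ^+ 2 <= G (b + 1 / 2) ^+ 2.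
  rewrite b2 exprMn [X in _ <= X](_ : _ = (b - 1 / 2) * ((b - 1 / 2) * G (b - 1 / 2) ^+ 2)); last by ring.
  by rewrite ler_pM2l.
split.
- rewrite -(ler_pXn2r (n := 2)) ?nnegrE ?mulr_ge0 ?G_ge0 // !exprMn.
  apply: (@le_trans _ _ (c * G c ^+ 2 * G b ^+ 2)).
    by rewrite ler_pM2r ?exprn_gt0.
  rewrite mulrC mulrA mulrC ler_pM2l ?exprn_gt0 //.
  apply: le_trans Eb'; rewrite mulrC ler_pM2r ?exprn_gt0 //; lra.
- rewrite -(ler_pXn2r (n := 2)) ?nnegrE ?mulr_ge0 ?G_ge0 ?(ltW c0) ?(ltW b0) // !exprMn.
  apply: (@le_trans _ _ ((c + 1 / 2) * G (c + 1 / 2) ^+ 2 * (b * G b ^+ 2))).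
    by rewrite -!exprMn exprMn; apply: ler_pM; rewrite ?exprn_ge0 // ?mulr_ge0 ?ltW.
  rewrite [X in X <= _](_ : _ = ((c + 1 / 2) * b) * (G (c + 1 / 2) ^+ 2 * G b ^+ 2)); last by ring.
  by rewrite ler_pM2r ?mulr_gt0 ?exprn_gt0 // expr2 ler_pM2r.
Qed.

Lemma energy_bound_abstract m (al : nat -> R) : 0 < m ->
  al 0%N = (G (m + 2))^-1 -> al 1%N = ((m + 2) * G (m + 1))^-1 ->
  (forall n, (n%:R + m + 3) * al n.+2 = - (n%:R - m) * al n) ->
  forall n, m < n%:R ->
    (n%:R - m) * (n%:R + m + 1) * al n ^+ 2 + (n%:R + m + 2) ^+ 2 * al n.+1 ^+ 2
    <= 4 / p * (G (n%:R - m) / G (n%:R + m + 1)).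
Proof.
move=> m0 al0 al1 alS n mn.
have B := envelope_bound m0 al0 al1 alS.
have := B _ mn; have := B n.+1 ltac:(rewrite (S1 n); lra).
pose c := (n%:R - m) / 2; pose b := (n%:R + m + 1) / 2.
have c0 : 0 < c by rewrite /c; lra.
have cb : c + 1 / 2 <= b by rewrite /c /b; lra.
have b0 : 0 < b by lra.
have [r1 r2] := G_half_ratio_le c0 cb.
have ch0 : 0 < c + 1 / 2 by lra.
have bh0 : 0 < b + 1 / 2 by lra.
have Gc := G_gt0 c0; have Gb := G_gt0 b0.
have Gch := G_gt0 ch0; have Gbh := G_gt0 bh0.
have -> : (n.+1%:R + m + 3) / 2 = b + 1 / 2 + 1 by rewrite (S1 n) /b; field.
have -> : (n.+1%:R - m) / 2 = c + 1 / 2 by rewrite (S1 n) /c; field.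
have -> : (n%:R + m + 3) / 2 = b + 1 by rewrite /b; field.
rewrite -/c (G_D1 bh0) (G_D1 b0).
have -> : n%:R - m = 2 * c by rewrite /c; field.
have -> : n%:R + m + 1 = 2 * b by rewrite /b; field.
have -> : n%:R + m + 2 = 2 * (b + 1 / 2) by rewrite /b; field.
set P := 2 `^ (m + 1); set A := al n; set A' := al n.+1 => h2 h1.
have Dc := G_duplication c0; have Db := G_duplication b0.
have P0 : 0 < P by exact: powR_gt0.
have Q0 : 0 < 2 `^ (2 * c - 1) :> R by exact: powR_gt0.
have PE : 2 `^ (2 * b - 1) * 2 = 2 `^ (2 * c - 1) * P ^+ 2.
  have pd r q : 2 `^ (r + q) = 2 `^ r * 2 `^ q :> R by rewrite powRD // pnatr_eq0 implybT.
  have P' : P = 2 `^ m * 2 by rewrite /P pd powRr1.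
  rewrite (_ : 2 * b - 1 = (2 * c - 1) + ((m + 1) + m)); last by rewrite /b /c; field.
  by rewrite (pd (2 * c - 1)) (pd (m + 1)) -/P expr2 {3}P'; ring.
have Gh : 0 < G (1 / 2) :> R by apply: G_gt0; rewrite divr_gt0.
have -> : G (2 * c) / G (2 * b) = 2 * (G c * G (c + 1 / 2)) / (G b * G (b + 1 / 2) * P ^+ 2).
  have G2b : 0 < G (2 * b) by apply: G_gt0; rewrite mulr_gt0.
  have -> : G (2 * c) / G (2 * b) = (G (1 / 2) * G (2 * c)) / (G (1 / 2) * G (2 * b)).
    by field; rewrite !gt_eqF.
  rewrite -Dc -Db.
  have -> : P ^+ 2 = 2 `^ (2 * b - 1) * 2 / 2 `^ (2 * c - 1) by rewrite PE; field; rewrite gt_eqF.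
  by field; rewrite !gt_eqF // powR_gt0.
set Gc' := G (c + 1 / 2) in r1 r2 Gch h2 *; set Gb' := G (b + 1 / 2) in r1 r2 Gbh h2 *.
have t1 : 2 * c * (2 * b) * A ^+ 2 <= 4 / p * (G c * Gc' / (G b * Gb' * P ^+ 2)).
  have X0 : 0 < (b * G b) ^+ 2 * P ^+ 2 * p by rewrite 2?mulr_gt0 ?exprn_gt0 // mulr_gt0.
  have : A ^+ 2 <= G c ^+ 2 / ((b * G b) ^+ 2 * P ^+ 2 * p) by rewrite ler_pdivlMr.
  move=> h; apply: (@le_trans _ _ (4 * (c * b) * (G c ^+ 2 / ((b * G b) ^+ 2 * P ^+ 2 * p)))).
    rewrite (_ : 2 * c * (2 * b) = 4 * (c * b)); last by ring.
    by apply: (ler_wpM2l _ h); rewrite mulr_ge0 // mulr_ge0 // ltW.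
  have Y0 : 0 < 4 * G c / (b * G b ^+ 2 * Gb' * P ^+ 2 * p).
    by do ?[by [] | apply: divr_gt0 | apply: mulr_gt0 | apply: exprn_gt0].
  have := ler_wpM2l (ltW Y0) r2.
  set L := _ * _; set U := _ * (b * _) => LU.
  have -> : 4 * (c * b) * (G c ^+ 2 / ((b * G b) ^+ 2 * P ^+ 2 * p)) = L.
    by rewrite /L; field; rewrite !gt_eqF //; lra.
  have -> : 4 / p * (G c * Gc' / (G b * Gb' * P ^+ 2)) = U.
    by rewrite /U; field; rewrite !gt_eqF //; lra.
  exact: LU.
have t2 : (2 * (b + 1 / 2)) ^+ 2 * A' ^+ 2 <= 4 / p * (G c * Gc' / (G b * Gb' * P ^+ 2)).
  have X0 : 0 < ((b + 1 / 2) * Gb') ^+ 2 * P ^+ 2 * p by rewrite 2?mulr_gt0 ?exprn_gt0 // mulr_gt0.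
  have : A' ^+ 2 <= Gc' ^+ 2 / (((b + 1 / 2) * Gb') ^+ 2 * P ^+ 2 * p) by rewrite ler_pdivlMr.
  move=> h; apply: (@le_trans _ _ ((2 * (b + 1 / 2)) ^+ 2 * (Gc' ^+ 2 / (((b + 1 / 2) * Gb') ^+ 2 * P ^+ 2 * p)))).
    by apply: (ler_wpM2l _ h); rewrite exprn_ge0 // mulr_ge0 // ltW.
  have Y0 : 0 < 4 * Gc' / (G b * Gb' ^+ 2 * P ^+ 2 * p).
    by do ?[by [] | apply: divr_gt0 | apply: mulr_gt0 | apply: exprn_gt0].
  have := ler_wpM2l (ltW Y0) r1.
  set L := _ * (Gc' * _); set U := _ * (G c * _) => LU.
  have -> : (2 * (b + 1 / 2)) ^+ 2 * (Gc' ^+ 2 / (((b + 1 / 2) * Gb') ^+ 2 * P ^+ 2 * p)) = L.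
    by rewrite /L; field; rewrite !gt_eqF //; lra.
  have -> : 4 / p * (G c * Gc' / (G b * Gb' * P ^+ 2)) = U.
    by rewrite /U; field; rewrite !gt_eqF //; lra.
  exact: LU.
set T := 4 / p * _ in t1 t2.
have -> : 4 / p * (2 * (G c * Gc') / (G b * Gb' * P ^+ 2)) = T + T.
  by rewrite /T; field; rewrite !gt_eqF.
exact: lerD.
Qed.

End Gamma_bounds_abstract.

Section Gamma_bounds.
Variable R : realType.
Implicit Types (m x z : R).

Lemma Gamma_half_sqr_le x : 0 < x -> Gamma (x + 1 / 2) ^+ 2 <= x * Gamma x ^+ 2.
Proof.
move=> x0; have := @Gamma_log_convex R x (x + 1) x0 (addr_gt0 x0 ltr01).
rewrite GammaD1 // (_ : (x + (x + 1)) / 2 = x + 1 / 2); last by field.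
by rewrite [X in _ <= X](_ : _ = x * Gamma x ^+ 2); last by ring.
Qed.

Lemma Gamma_reflection_ge z : 0 < z -> z < 1 -> pi <= Gamma z * Gamma (1 - z).
Proof.
move=> z0 z1; rewrite -(Gamma_half_sqr R).
have := @Gamma_log_convex R z (1 - z) z0 ltac:(by rewrite subr_gt0).
by rewrite (_ : (z + (1 - z)) / 2 = 1 / 2); last by field.
Qed.

Lemma energy_bound m (al : nat -> R) : 0 < m ->
  al 0%N = (Gamma (m + 2))^-1 -> al 1%N = ((m + 2) * Gamma (m + 1))^-1 ->
  (forall n, (n%:R + m + 3) * al n.+2 = - (n%:R - m) * al n) ->
  forall n, m < n%:R ->
    (n%:R - m) * (n%:R + m + 1) * al n ^+ 2 + (n%:R + m + 2) ^+ 2 * al n.+1 ^+ 2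
    <= 4 / pi * (Gamma (n%:R - m) / Gamma (n%:R + m + 1)).
Proof.
exact: (energy_bound_abstract (pi_gt0 R) (@Gamma_gt0 R) (@GammaD1 R) Gamma_half_sqr_le
  Gamma_reflection_ge (Gamma_half_sqr R) (@Gamma_duplication R)).
Qed.

End Gamma_bounds.

(** * Legendre polynomials *)

Section legendre_expansion.
Variable R : realType.
Implicit Types (n j : nat) (x t m w : R).

Fixpoint legc n j : R :=
  if j is j'.+1 then - ((n%:R - j'%:R) * (n%:R + 1 + j'%:R)) / (2 * j'.+1%:R) * legc n j'
  else 1.

Let S1 n : n.+1%:R = n%:R + 1 :> R. Proof. by rewrite -addn1 natrD. Qed.
Let Sn0 j : j%:R + 1 != 0 :> R.
Proof. by rewrite -S1 pnatr_eq0. Qed.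

Lemma legcS n j : 2 * j.+1%:R * legc n j.+1 = - ((n%:R - j%:R) * (n%:R + 1 + j%:R)) * legc n j.
Proof. by rewrite /= (S1 j); field; rewrite Sn0. Qed.

Let legc_rec n j : legc n j.+1 =
  - ((n%:R - j%:R) * (n%:R + 1 + j%:R)) / (2 * j.+1%:R) * legc n j.
Proof. by []. Qed.

Lemma legc_gt n j : (n < j)%N -> legc n j = 0.
Proof.
move=> /subnKC <-; elim: (_ - _)%N => [|k IH].
  by rewrite addn0 legc_rec subrr mul0r oppr0 !mul0r.
by rewrite addnS legc_rec IH mulr0.
Qed.

Lemma legc_next n j : (n%:R + 1 - j%:R) * legc n.+1 j = (n%:R + 1 + j%:R) * legc n j.
Proof.
elim: j => [|j IH]; first by rewrite /= subr0 addr0.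
have := legcS n.+1 j; have := legcS n j.
rewrite (S1 n) (S1 j) => h1 h2.
apply: (mulfI (_ : 2 * (j%:R + 1) != 0)); first by rewrite mulf_neq0 // pnatr_eq0.
transitivity ((n%:R - j%:R) * (2 * (j%:R + 1) * legc n.+1 j.+1)); first by ring.
rewrite h2.
transitivity (- (n%:R - j%:R) * (n%:R + 1 + 1 + j%:R) * ((n%:R + 1 - j%:R) * legc n.+1 j)); first by ring.
rewrite IH.
transitivity ((n%:R + 1 + 1 + j%:R) * (2 * (j%:R + 1) * legc n j.+1)); last by ring.
by rewrite h1; ring.
Qed.

Lemma legc_up n j : legc n.+1 j.+1 = legc n j.+1 - (n%:R + j%:R + 1) * legc n j.
Proof.
have h2 := legcS n.+1 j; have h1 := legcS n j; have IH := legc_next n j.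
apply: (mulfI (_ : 2 * (j%:R + 1) != 0)); first by rewrite mulf_neq0 // pnatr_eq0.
rewrite mulrBr -(S1 j) h1 h2 (S1 n) (S1 j).
transitivity (- (n%:R + 1 + 1 + j%:R) * ((n%:R + 1 - j%:R) * legc n.+1 j)); first by ring.
by rewrite IH; ring.
Qed.

Lemma legc_down n j : legc n j.+1 = legc n.+1 j.+1 + (n%:R + 1 - j%:R) * legc n.+1 j.
Proof. by rewrite legc_next legc_up; ring. Qed.

Let recr k (F : nat -> R) : \sum_(j < k.+1) F j = \sum_(j < k) F j + F k.
Proof. by rewrite big_ord_recr. Qed.

(* [E j] plays the role of [w ^ (j + m + 1) / Gamma (j + m + 2)], [w = 1 - t];
   both relations are telescoping sums. *)
Lemma legc_sum_up n m w (E : nat -> R) M : (forall j, w * E j = (j%:R + m + 2) * E j.+1) ->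
  (n.+1 < M)%N ->
  (2 - w) * (- \sum_(j < M) (j%:R + m + 1) * legc n j * E j) =
  (n%:R - m) * (1 - w) * (\sum_(j < M) legc n j * E j)
  - (n%:R + m + 2) * (\sum_(j < M) legc n.+1 j * E j).
Proof.
move=> wE; case: M => // M nM.
apply/eqP; rewrite -subr_eq0; apply/eqP.
have T k : (2 - w) * (- \sum_(j < k.+1) (j%:R + m + 1) * legc n j * E j) -
  ((n%:R - m) * (1 - w) * (\sum_(j < k.+1) legc n j * E j)
  - (n%:R + m + 2) * (\sum_(j < k.+1) legc n.+1 j * E j)) = (n%:R + k%:R + 1) * legc n k * (w * E k).
  elim: k => [|k IH]; first by rewrite !big_ord1 /=; ring.
  rewrite (recr k.+1 (fun j => (j%:R + m + 1) * legc n j * E j)) (recr k.+1 (fun j => legc n j * E j)) (recr k.+1 (fun j => legc n.+1 j * E j)).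
  move: IH; set A := \sum_(_ < _) _; set B := \sum_(_ < _) _; set C := \sum_(_ < _) _ => IH.
  have -> : (n%:R + k.+1%:R + 1) * legc n k.+1 * (w * E k.+1) =
     (n%:R + k%:R + 1) * legc n k * (w * E k) + ((n%:R + k.+1%:R + 1) * legc n k.+1 * (w * E k.+1) - (n%:R + k%:R + 1) * legc n k * (w * E k)) by ring.
  rewrite -{1}IH (wE k) (legc_up n k) (S1 k).
  have h := legcS n k; rewrite (S1 k) in h.
  have : (2 * (k%:R + 1) * legc n k.+1 + (n%:R - k%:R) * (n%:R + 1 + k%:R) * legc n k) * E k.+1 = 0.
    by rewrite h; ring.
  move=> h0; rewrite -[LHS]addr0 -h0; ring.
by rewrite T legc_gt ?mulr0 ?mul0r //.
Qed.

Lemma legc_sum_down n m w (E : nat -> R) M : (forall j, w * E j = (j%:R + m + 2) * E j.+1) ->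
  (n.+1 < M)%N ->
  (2 - w) * (- \sum_(j < M) (j%:R + m + 1) * legc n.+1 j * E j) =
  - (n%:R + m + 2) * (1 - w) * (\sum_(j < M) legc n.+1 j * E j)
  + (n%:R - m) * (\sum_(j < M) legc n j * E j).
Proof.
move=> wE; case: M => // M nM.
apply/eqP; rewrite -subr_eq0; apply/eqP.
have T k : (2 - w) * (- \sum_(j < k.+1) (j%:R + m + 1) * legc n.+1 j * E j) -
  (- (n%:R + m + 2) * (1 - w) * (\sum_(j < k.+1) legc n.+1 j * E j)
  + (n%:R - m) * (\sum_(j < k.+1) legc n j * E j)) = (k%:R - n%:R - 1) * legc n.+1 k * (w * E k).
  elim: k => [|k IH]; first by rewrite !big_ord1 /=; ring.
  rewrite (recr k.+1 (fun j => (j%:R + m + 1) * legc n.+1 j * E j)) (recr k.+1 (fun j => legc n.+1 j * E j)) (recr k.+1 (fun j => legc n j * E j)).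
  move: IH; set A := \sum_(_ < _) _; set B := \sum_(_ < _) _; set C := \sum_(_ < _) _ => IH.
  have -> : (k.+1%:R - n%:R - 1) * legc n.+1 k.+1 * (w * E k.+1) =
     (k%:R - n%:R - 1) * legc n.+1 k * (w * E k) + ((k.+1%:R - n%:R - 1) * legc n.+1 k.+1 * (w * E k.+1) - (k%:R - n%:R - 1) * legc n.+1 k * (w * E k)) by ring.
  rewrite -{1}IH (wE k) (legc_down n k) (S1 k).
  have h := legcS n.+1 k; rewrite (S1 k) (S1 n) in h.
  have : (2 * (k%:R + 1) * legc n.+1 k.+1 + (n%:R + 1 - k%:R) * (n%:R + 1 + 1 + k%:R) * legc n.+1 k) * E k.+1 = 0.
    by rewrite h; ring.
  move=> h0; rewrite -[LHS]addr0 -h0; ring.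
rewrite T; move: nM; rewrite ltnS leq_eqVlt => /predU1P[<-|nM].
  by rewrite (_ : n.+1%:R - n%:R - 1 = 0 :> R) ?mul0r //; rewrite (S1 n); ring.
by rewrite legc_gt ?mulr0 ?mul0r.
Qed.

Lemma legc_bin n i : legc n i = (-1) ^+ i * 'C(n, i)%:R * ((n + i) ^_ n)%:R / (n`!%:R * 2 ^+ i) * i`!%:R.
Proof.
have nf k : k`!%:R != 0 :> R by rewrite pnatr_eq0 -lt0n fact_gt0.
elim: i => [|i IH].
  by rewrite /= expr0 bin0 addn0 ffactnn fact0 !mulr1 mul1r divff.
rewrite legc_rec IH; have [ni|ni] := ltnP n i.+1.
  rewrite (bin_small ni) mulr0 !mul0r; move: ni; rewrite ltnS leq_eqVlt => /predU1P[->|ni].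
    by rewrite subrr mul0r oppr0 !mul0r.
  by rewrite bin_small // mulr0 !mul0r mulr0.
have h1 : 'C(n, i.+1)%:R * i.+1%:R = 'C(n, i)%:R * (n%:R - i%:R) :> R.
  by rewrite -natrB ?(ltnW ni) // -!natrM mulnC mul_bin_left mulnC.
have h2 : ((n + i.+1) ^_ n)%:R * i.+1%:R = ((n + i) ^_ n)%:R * (n%:R + 1 + i%:R) :> R.
  have E k : ((n + k) ^_ n)%:R = (n + k)`!%:R / k`!%:R :> R.
    apply: (mulIf (nf k)); rewrite divfK // -natrM; congr (_%:R).
    by have := ffact_fact (leq_addr k n); rewrite addKn.
  rewrite !E addnS !factS !natrM (S1 (n + i)) natrD (S1 i); field.
  by rewrite nf Sn0.
have -> : 'C(n, i.+1)%:R = 'C(n, i)%:R * (n%:R - i%:R) / i.+1%:R :> R.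
  by rewrite -h1 mulfK // pnatr_eq0.
have -> : ((n + i.+1) ^_ n)%:R = ((n + i) ^_ n)%:R * (n%:R + 1 + i%:R) / i.+1%:R :> R.
  by rewrite -h2 mulfK // pnatr_eq0.
rewrite factS natrM !exprS (S1 i); field.
by rewrite Sn0 nf expf_neq0 ?pnatr_eq0.
Qed.

Lemma derivn_XsubC_exp (c : R) (m n : nat) :
  (('X - c%:P) ^+ m)^`(n) = ('X - c%:P) ^+ (m - n) *+ m ^_ n :> {poly R}.
Proof.
elim: n => [|n IH]; first by rewrite subn0 ffactn0 mulr1n.
rewrite derivnS IH derivMn deriv_exp derivXsubC mul1r -mulrnA subnS ffactnSr.
by rewrite mulnC.
Qed.

Lemma rodrigues_expand n : ('X^2 - 1) ^+ n =
  \sum_(i < n.+1) (2 ^+ (n - i) * 'C(n, i)%:R) *: ('X - 1%:P) ^+ (n + i) :> {poly R}.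
Proof.
have -> : ('X^2 - 1) = ('X - 1%:P) * (2%:P + ('X - 1%:P)) :> {poly R}.
  by rewrite -polyC1 -(natr1 1) polyCD polyC1; ring.
rewrite exprMn [X in _ * X]exprDn mulr_sumr; apply: eq_bigr => i _.
rewrite -polyC_exp mulrnAr mulrCA -exprD mul_polyC -scaler_nat scalerA mulrC //.
Qed.

Lemma legendre_horner n x : (legendre R n).[x] = \sum_(j < n.+1) legc n j / j`!%:R * (1 - x) ^+ j.
Proof.
have nf k : k`!%:R != 0 :> R by rewrite pnatr_eq0 -lt0n fact_gt0.
rewrite /legendre rodrigues_expand linear_sum /= hornerZ horner_sum mulr_sumr.
apply: eq_bigr => -[i /= ]; rewrite ltnS => ni _.
rewrite derivnZ derivn_XsubC_exp addKn hornerZ hornerMn horner_exp !hornerE.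
rewrite legc_bin.
have -> : 1 - x = - (x - 1) by ring.
rewrite [(- (x - 1)) ^+ i]exprNn -[_ *+ (n + i) ^_ n]mulr_natr /=.
have -> : 2 ^+ n = 2 ^+ (n - i) * 2 ^+ i :> R by rewrite -exprD subnK.
have sg : (-1) ^+ i * (-1) ^+ i = 1 :> R by rewrite -expr2 sqrr_sign.
rewrite -[LHS]mul1r -{1}sg; field.
by rewrite !nf !expf_neq0 ?pnatr_eq0.
Qed.

End legendre_expansion.

Section bounded_measurable.
Variable R : realType.
Local Notation mu := (@lebesgue_measure R).
Implicit Types (f g : R -> R).

Definition I1 f : R := \int[mu]_(x in `]-1, 1[) f x.

Definition bm f := measurable_fun (`]-1, 1[%classic : set R) f /\
  exists M, forall x, x \in `]-1, 1[ -> `|f x| <= M.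

Lemma bm_integrable f : bm f -> mu.-integrable `]-1, 1[ (EFin \o f).
Proof.
move=> [mf [M fM]].
have m11 : (mu `](-1)%R, 1%R[%classic < +oo)%E.
  by rewrite lebesgue_measure_itv /= lte_fin; case: ifP => _; rewrite ltry.
apply: (@measurable_bounded_integrable _ _ _ mu _ _ (measurable_itv `]-1, 1[)) => //.
exists M; split; first exact: num_real.
by move=> N MN x /fM fxM; exact: le_trans (ltW MN).
Qed.

Lemma bm_cst c : bm (fun=> c).
Proof. by split; [exact: measurable_cst|exists `|c|]. Qed.

Lemma bmD f g : bm f -> bm g -> bm (fun x => f x + g x).
Proof.
move=> [mf [M fM]] [mg [N gN]]; split; first exact: measurable_funD.
by exists (M + N) => x xI; apply: le_trans (ler_normD _ _) _; rewrite lerD ?fM ?gN.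
Qed.

Lemma bmM f g : bm f -> bm g -> bm (fun x => f x * g x).
Proof.
move=> [mf [M fM]] [mg [N gN]]; split; first exact: measurable_funM.
by exists (M * N) => x xI; rewrite normrM ler_pM ?fM ?gN.
Qed.

Lemma bmZ c f : bm f -> bm (fun x => c * f x).
Proof. by move=> bf; apply: bmM => //; exact: bm_cst. Qed.

Lemma bmN f : bm f -> bm (fun x => - f x).
Proof. by move=> /(bmZ (-1)); under eq_fun do rewrite mulN1r. Qed.

Lemma bmB f g : bm f -> bm g -> bm (fun x => f x - g x).
Proof. by move=> bf bg; apply: bmD => //; exact: bmN. Qed.

Lemma bm_sum (n : nat) (F : nat -> R -> R) : (forall i, bm (F i)) ->
  bm (fun x => \sum_(i < n) F i x).
Proof.
move=> bF; elim: n => [|n IH].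
  by under eq_fun do rewrite big_ord0; exact: bm_cst.
by under eq_fun do rewrite big_ord_recr /=; apply: bmD.
Qed.

Lemma bm_continuous f : {within `[-1, 1], continuous f} -> bm f.
Proof.
move=> cf; have m11 : (-1 : R) <= 1 by lra.
split.
  have mc : measurable_fun (`[-1, 1]%classic : set R) f.
    by apply: subspace_continuous_measurable_fun; [exact: measurable_itv|].
  by apply: measurable_funS mc; [exact: measurable_itv|exact: subset_itv_oo_cc].
have [c _ fc] := EVT_max m11 cf; have [d _ fd] := EVT_min m11 cf.
exists (`|f c| + `|f d|) => x /subset_itv_oo_cc xI.
have := fc _ xI; have := fd _ xI; have := ler_norm (f c); have := ler_norm (- f d).
rewrite normrN => *; rewrite ler_norml; apply/andP; split.
- by have := normr_ge0 (f c); lra.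
- by have := normr_ge0 (f d); lra.
Qed.

Lemma bm_poly (p : {poly R}) : bm (fun x => p.[x]).
Proof. by apply: bm_continuous; apply: continuous_subspaceT; exact: continuous_horner. Qed.

Lemma I1D f g : bm f -> bm g -> I1 (fun x => f x + g x) = I1 f + I1 g.
Proof. by move=> bf bg; rewrite /I1 RintegralD //; exact: bm_integrable. Qed.

Lemma I1Z c f : bm f -> I1 (fun x => c * f x) = c * I1 f.
Proof. by move=> bf; rewrite /I1 RintegralZl //; exact: bm_integrable. Qed.

Lemma I1N f : bm f -> I1 (fun x => - f x) = - I1 f.
Proof. by move=> /(I1Z (-1)); under [in LHS]eq_fun do rewrite mulN1r; rewrite mulN1r. Qed.

Lemma I1B f g : bm f -> bm g -> I1 (fun x => f x - g x) = I1 f - I1 g.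
Proof. by move=> bf bg; rewrite I1D ?I1N //; exact: bmN. Qed.

Lemma I1_eq f g : (forall x, x \in `]-1, 1[ -> f x = g x) -> I1 f = I1 g.
Proof. by move=> fg; apply: eq_Rintegral => x /[!inE]; exact: fg. Qed.

Lemma I1_0 : I1 (fun=> 0) = 0.
Proof. by have := I1Z 0 (bm_cst 0); under eq_fun do rewrite mul0r; rewrite mul0r. Qed.

Lemma I1_sum (n : nat) (F : nat -> R -> R) : (forall i, bm (F i)) ->
  I1 (fun x => \sum_(i < n) F i x) = \sum_(i < n) I1 (F i).
Proof.
move=> bF; elim: n => [|n IH].
  by under eq_fun do rewrite big_ord0; rewrite big_ord0 I1_0.
under eq_fun do rewrite big_ord_recr /=.
by rewrite I1D ?IH ?big_ord_recr //; exact: bm_sum.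
Qed.

Lemma le_I1 f g : bm f -> bm g -> (forall x, x \in `]-1, 1[ -> f x <= g x) -> I1 f <= I1 g.
Proof. by move=> bf bg fg; apply: le_Rintegral => //; exact: bm_integrable. Qed.

Lemma I1_ge0 f : (forall x, x \in `]-1, 1[ -> 0 <= f x) -> 0 <= I1 f.
Proof. by move=> f0; exact: Rintegral_ge0. Qed.

Lemma I1_cauchy_schwarz f g : bm f -> bm g ->
  I1 (fun x => f x * g x) ^+ 2 <= I1 (fun x => f x ^+ 2) * I1 (fun x => g x ^+ 2).
Proof.
move=> bf bg.
set A := I1 (fun x => f x ^+ 2); set B := I1 (fun x => g x ^+ 2); set C := I1 _.
have bff : bm (fun x => f x ^+ 2) by apply: bmM.
have bgg : bm (fun x => g x ^+ 2) by apply: bmM.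
have bfg : bm (fun x => f x * g x) by apply: bmM.
have key (l : R) : 0 <= l ^+ 2 * A + B - 2 * l * C.
  have : 0 <= I1 (fun x => (l * f x - g x) ^+ 2) by apply: I1_ge0 => x _; exact: sqr_ge0.
  under eq_fun => x.
    rewrite (_ : (_ - _) ^+ 2 = (l ^+ 2 * f x ^+ 2 + g x ^+ 2) - 2 * l * (f x * g x)); last by ring.
    over.
  have b1 := bmZ (l ^+ 2) bff; have b2 := bmZ (2 * l) bfg.
  by rewrite (I1B (bmD b1 bgg) b2) (I1D b1 bgg) (I1Z _ bff) (I1Z _ bfg).
have A0 : 0 <= A by apply: I1_ge0 => x _; exact: sqr_ge0.
have B0 : 0 <= B by apply: I1_ge0 => x _; exact: sqr_ge0.
have [A00|An0] := eqVneq A 0.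
  suff -> : C = 0 by rewrite A00 mul0r expr0n.
  apply/eqP/negPn/negP => Cn0.
  have := key ((B + 1) / C); rewrite A00 mulr0 add0r -mulrA divfK //; lra.
have {}A0 : 0 < A by rewrite lt0r An0.
have := key (C / A); rewrite -(ler_pM2r A0) mul0r.
have -> : ((C / A) ^+ 2 * A + B - 2 * (C / A) * C) * A = A * B - C ^+ 2 by field.
by rewrite subr_ge0.
Qed.

End bounded_measurable.

Section legendre_orthogonality.
Variable R : realType.
Local Notation mu := (@lebesgue_measure R).
Implicit Types (p q : {poly R}) (n m : nat).

Definition intp p : R := I1 (fun x => p.[x]).

Lemma intpD p q : intp (p + q) = intp p + intp q.
Proof. by rewrite /intp -I1D; [apply: I1_eq => x _; rewrite hornerD|exact: bm_poly|exact: bm_poly]. Qed.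

Lemma intpZ c p : intp (c *: p) = c * intp p.
Proof. by rewrite /intp -I1Z; [apply: I1_eq => x _; rewrite hornerZ|exact: bm_poly]. Qed.

Lemma intp_deriv p : intp p^`() = p.[1] - p.[-1].
Proof.
have H : (\int[mu]_(x in `[(-1)%R, 1%R]) (p^`().[x])%:E = (p.[1])%:E - (p.[-1])%:E)%E.
  apply: (@continuous_FTC2 R (horner p^`()) (horner p)).
  - by lra.
  - by apply: continuous_subspaceT; exact: continuous_horner.
  - split => [x _||].
    + exact: derivable_horner.
    + by apply: cvg_at_right_filter; exact: continuous_horner.
    + by apply: cvg_at_left_filter; exact: continuous_horner.
  - by move=> x _; rewrite derive1E; have := is_derive_poly p x => ?; rewrite derive_val.
rewrite /intp /I1 /Rintegral -(@integral_itv_bndoo R (-1) 1 _ true false).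
  by rewrite H.
by apply/measurable_EFinP; case: (bm_poly p^`()).
Qed.

Lemma intp_by_parts p q : (p * q).[1] = 0 -> (p * q).[-1] = 0 -> intp (p * q^`()) = - intp (p^`() * q).
Proof.
move=> h1 h2; have := intp_deriv (p * q); rewrite h1 h2 subrr derivM intpD => /eqP.
by rewrite addrC addr_eq0 => /eqP.
Qed.

Lemma derivn_root_factor (c : R) n j r : (j <= n)%N ->
  exists r', ((('X - c%:P) ^+ n * r)^`(j)) = ('X - c%:P) ^+ (n - j) * r' :> {poly R}.
Proof.
elim: j => [|j IH] jn; first by exists r; rewrite subn0.
have [r' E] := IH (ltnW jn); rewrite derivnS E derivM deriv_exp derivXsubC mul1r.
exists (r' *+ (n - j) + ('X - c%:P) * r'^`()).
have -> : (n - j = (n - j.+1).+1)%N by rewrite subnSK.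
by rewrite /= exprSr -mulr_natr -[r' *+ _]mulr_natr; ring.
Qed.

Let V n : {poly R} := ('X^2 - 1) ^+ n.

Lemma rodrigues_root n j (c : R) : (j < n)%N -> c ^+ 2 = 1 -> ((V n)^`(j)).[c] = 0.
Proof.
move=> jn c1.
have -> : V n = ('X - c%:P) ^+ n * ('X + c%:P) ^+ n.
  by rewrite /V -exprMn; congr (_ ^+ n); rewrite -subr_sqr -polyC_exp c1.
have [r' ->] := @derivn_root_factor c n j (('X + c%:P) ^+ n) (ltnW jn).
by rewrite hornerM horner_exp hornerXsubC subrr expr0n subn_eq0 leqNgt jn mul0r.
Qed.

Lemma intp_rodrigues_parts n j p : (j <= n)%N ->
  intp (p * (V n)^`(n)) = (-1) ^+ j * intp (p^`(j) * (V n)^`(n - j)).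
Proof.
elim: j => [|j IH] jn; first by rewrite expr0 mul1r subn0.
rewrite IH ?(ltnW jn) //.
have nj : (n - j.+1 < n)%N by rewrite ltn_subrL (leq_trans _ jn).
rewrite -(subnSK jn) [(V n)^`((n - j.+1).+1)]derivnS intp_by_parts.
- by rewrite -derivnS exprS; ring.
- by rewrite hornerM (rodrigues_root nj) ?mulr0 // expr1n.
- by rewrite hornerM (rodrigues_root nj) ?mulr0 // sqrrN expr1n.
Qed.

Lemma rodrigues_monic n : V n \is monic /\ size (V n) = n.*2.+1.
Proof.
have h : ('X^2 - 1 : {poly R}) \is monic by rewrite -polyC1 monicXnsubC.
have s3 : size ('X^2 - 1 : {poly R}) = 3%N by rewrite -polyC1 size_XnsubC.
have mV : V n \is monic by exact: rpredX.
split => //; have := size_exp ('X^2 - 1 : {poly R}) n; rewrite s3 /= mul2n => <-.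
by rewrite prednK // lt0n size_poly_eq0 monic_neq0.
Qed.

Lemma coef_rodrigues_gt n i : (n < i)%N -> (V n)^`(n)`_i = 0.
Proof.
move=> ni; rewrite coef_derivn nth_default ?mul0rn // (rodrigues_monic n).2.
by rewrite -addnn -addnS leq_add2l.
Qed.

Lemma coef_rodrigues_top n : (V n)^`(n)`_n = (n.*2 ^_ n)%:R.
Proof.
rewrite coef_derivn addnn; congr (_ *+ _).
have [mV sV] := rodrigues_monic n.
by have := monicP mV; rewrite lead_coefE sV.
Qed.

Lemma derivn_rodrigues n : (V n)^`(n)^`(n) = ((n.*2)`!%:R)%:P.
Proof.
apply/polyP => i; rewrite coef_derivn coefC; case: eqP => [->|/eqP i0].
  rewrite addn0 coef_rodrigues_top ffactnn -mulrnA.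
  by have := ffact_fact (leq_addl n n); rewrite addnK addnn => ->.
by rewrite coef_rodrigues_gt ?mul0rn // -{1}[n]addn0 ltn_add2l lt0n.
Qed.

Let c n : R := (2 ^+ n * n`!%:R)^-1.

Let S1 n : n.+1%:R = n%:R + 1 :> R. Proof. by rewrite -addn1 natrD. Qed.

Lemma intp_one : intp 1 = 2.
Proof.
have := intp_deriv 'X; rewrite derivX !hornerX => ->; ring.
Qed.

Lemma intp_rodrigues_rec n : (2 * n%:R + 3) * intp (V n.+1) = - (2 * (n%:R + 1) * intp (V n)).
Proof.
apply/eqP; rewrite -addr_eq0; apply/eqP.
have <- : intp ('X * V n.+1)^`() = 0.
  have r1 : (V n.+1).[1] = 0 by apply: (@rodrigues_root n.+1 0) => //; rewrite expr1n.
  have r2 : (V n.+1).[-1] = 0 by apply: (@rodrigues_root n.+1 0) => //; rewrite sqrrN expr1n.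
  by rewrite intp_deriv 2!hornerM r1 r2 !mulr0 subrr.
rewrite -!intpZ -intpD; congr intp.
rewrite derivM derivX mul1r /V deriv_exp derivB derivXn -polyC1 derivC subr0 /= expr1.
rewrite -!mul_polyC.
rewrite (_ : (2 * n%:R + 3)%:P = 2 * n%:R + 3); last by rewrite !(rmorphD, rmorphM, rmorph_nat) /=.
rewrite (_ : (2 * (n%:R + 1))%:P = 2 * (n%:R + 1)); last by rewrite !(rmorphD, rmorphM, rmorph_nat, rmorph1) /=.
rewrite -[_ *+ n.+1]mulr_natr -(mulr_natr 'X 2) exprS; ring.
Qed.

Let nf k : k`!%:R != 0 :> R.
Proof. by rewrite pnatr_eq0 -lt0n fact_gt0. Qed.

Lemma intp_rodrigues n :
  (-1) ^+ n * intp (V n) * (2 * n%:R + 1) * (n.*2)`!%:R = 2 * (2 ^+ n * n`!%:R) ^+ 2.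
Proof.
elim: n => [|n IH]; first by rewrite /V !expr0 intp_one fact0; ring.
have E := intp_rodrigues_rec n.
have -> : (n.+1.*2)`!%:R = (2 * n%:R + 2) * (2 * n%:R + 1) * (n.*2)`!%:R :> R.
  rewrite doubleS !factS !natrM (S1 n.*2.+1) (S1 n.*2) -mul2n natrM; ring.
rewrite (S1 n) factS natrM (S1 n) !exprS.
transitivity (- (-1) ^+ n * ((2 * n%:R + 3) * intp (V n.+1)) * ((2 * n%:R + 2) * (2 * n%:R + 1) * (n.*2)`!%:R)); first by ring.
rewrite E.
transitivity ((2 * (n%:R + 1)) ^+ 2 * ((-1) ^+ n * intp (V n) * (2 * n%:R + 1) * (n.*2)`!%:R)); first by ring.
by rewrite IH; ring.
Qed.

Lemma legendreE n : legendre R n = c n *: (V n)^`(n). Proof. by []. Qed.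

Lemma legendre_orthogonal_lt m n : (m < n)%N -> intp (legendre R m * legendre R n) = 0.
Proof.
move=> mn; rewrite (legendreE n) -scalerAr intpZ (intp_rodrigues_parts _ (leqnn n)).
rewrite (_ : (legendre R m)^`(n) = 0) ?mul0r.
  have -> : intp 0 = 0 by rewrite -(scale0r 0) intpZ mul0r.
  by rewrite !mulr0.
have -> : (legendre R m)^`(n) = c m *: (V m)^`(n + m).
  by rewrite legendreE derivnZ /derivn iterD.
rewrite derivn_poly0 ?scaler0 // (rodrigues_monic m).2.
by rewrite -addnn -addSn leq_add2r.
Qed.

Lemma legendre_norm n : intp (legendre R n * legendre R n) = 2 / (2 * n%:R + 1).
Proof.
have p0 : 2 * n%:R + 1 != 0 :> R by rewrite gt_eqF // ltr_wpDl // mulr_ge0.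
have c0 : 2 ^+ n * n`!%:R != 0 :> R by rewrite mulf_neq0 // expf_neq0 // pnatr_eq0.
rewrite {2}(legendreE n) -scalerAr intpZ (intp_rodrigues_parts _ (leqnn n)) subnn derivn0.
rewrite (legendreE n) derivnZ derivn_rodrigues -scalerAl intpZ mul_polyC intpZ.
apply: (mulIf p0); rewrite divfK //.
apply: (mulIf (mulf_neq0 c0 c0)); rewrite -expr2 -(intp_rodrigues n) /c.
by field; rewrite nf expf_neq0 // pnatr_eq0.
Qed.

Lemma legendre_orthogonal m n :
  intp (legendre R m * legendre R n) = if m == n then 2 / (2 * n%:R + 1) else 0.
Proof.
have [->|] := eqVneq m n; first exact: legendre_norm.
by rewrite neq_ltn => /orP[mn|nm]; [|rewrite mulrC]; exact: legendre_orthogonal_lt.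
Qed.

Lemma legendre_span N p : (size p <= N.+1)%N ->
  exists a : nat -> R, p = \sum_(n < N.+1) a n *: legendre R n.
Proof.
have top n : (legendre R n)`_n != 0.
  have h : (n.*2 ^_ n)%:R != 0 :> R by rewrite pnatr_eq0 -lt0n ffact_gt0 -addnn leq_addr.
  by rewrite legendreE coefZ coef_rodrigues_top mulf_neq0 // invr_eq0 mulf_neq0 // expf_neq0 // pnatr_eq0.
have gt n i : (n < i)%N -> (legendre R n)`_i = 0.
  by move=> ni; rewrite legendreE coefZ coef_rodrigues_gt ?mulr0.
have red n q : (size q <= n.+1)%N ->
    (size (q - (q`_n / (legendre R n)`_n) *: legendre R n)%R <= n)%N.
  move=> /leq_sizeP sq; apply/leq_sizeP => j; rewrite leq_eqVlt coefB [X in _ - X]coefZ => /predU1P[<-|nj].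
    by rewrite divfK ?subrr.
  by rewrite (sq j) // (gt n j) // mulr0 subr0.
elim: N p => [|N IH] p sp.
  exists (fun=> p`_0 / (legendre R 0)`_0); rewrite big_ord1; apply/eqP.
  by rewrite -subr_eq0 -size_poly_leq0 red.
have [a E] := IH _ (red _ _ sp).
exists (fun n => if n == N.+1 then p`_N.+1 / (legendre R N.+1)`_N.+1 else a n).
rewrite big_ord_recr /= eqxx -[LHS](subrK ((p`_N.+1 / (legendre R N.+1)`_N.+1) *: legendre R N.+1)).
congr (_ + _); rewrite E; apply: eq_bigr => -[i /= iN] _.
by rewrite ltn_eqF.
Qed.

End legendre_orthogonality.

(** * Legendre expansion of truncated powers *)

Section truncated_power.
Variable R : realType.
Local Notation mu := (@lebesgue_measure R).
Variable m : R.
Hypothesis m0 : 0 < m.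
Implicit Types (n j N M : nat) (t x w : R).

Definition kern t x : R := if t < x then (x - t) `^ m / Gamma (m + 1) else 0.

Let G1 : 0 < Gamma (m + 1). Proof. by apply: Gamma_gt0; rewrite addr_gt0. Qed.
Let S1 n : n.+1%:R = n%:R + 1 :> R. Proof. by rewrite -addn1 natrD. Qed.
Let n0 n : 0 <= n%:R :> R. Proof. by rewrite ler0n. Qed.

Lemma kern_ge0 t x : 0 <= kern t x.
Proof. by rewrite /kern; case: ifP => // _; rewrite divr_ge0 ?powR_ge0 ?ltW. Qed.

Lemma measurable_kern t : measurable_fun setT (kern t).
Proof.
apply: measurable_fun_ifT; [|apply: measurable_funM|exact: measurable_cst].
- by apply: measurable_fun_ltr; [exact: measurable_cst|exact: measurable_id].
- exact: measurable_powR_Bcst.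
- exact: measurable_cst.
Qed.

Lemma bm_kern t : bm (kern t).
Proof.
split; first by apply: measurable_funTS; exact: measurable_kern.
exists ((1 + `|t|) `^ m / Gamma (m + 1)) => x; rewrite in_itv /= => /andP[x1 x2].
rewrite ger0_norm ?kern_ge0 // /kern; case: ifP => [tx|_]; last by rewrite divr_ge0 ?powR_ge0 ?ltW.
have t1 := ler_norm (- t); rewrite normrN in t1; have t2 := normr_ge0 t.
rewrite ler_pM2r ?invr_gt0 //; apply: ge0_ler_powR; rewrite ?nnegrE ?(ltW m0) //; lra.
Qed.

Lemma I1_kern (t : R) (f : R -> R) : -1 <= t ->
  I1 (fun x => kern t x * f x) =
  \int[mu]_(x in `]t, 1[) ((x - t) `^ m / Gamma (m + 1) * f x).
Proof.
move=> t1; rewrite /I1 Rintegral_mkcond [RHS]Rintegral_mkcond; apply: eq_Rintegral => x _.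
rewrite !patchE /kern !mem_setE /= !in_itv /=.
have [tx|tx] := ltP t x; last by rewrite mul0r; case: ifP.
by rewrite (le_lt_trans t1 tx).
Qed.

Lemma Rintegral_beta_kernel (a b y x : R) : y < x -> 0 < a -> 0 < b ->
  \int[mu]_(z in `]y, x[) ((x - z) `^ (a - 1) * (z - y) `^ (b - 1)) =
  (x - y) `^ (a + b - 1) * (Gamma a * Gamma b / Gamma (a + b)).
Proof.
by move=> yx a0 b0; rewrite /Rintegral integral_beta_kernel // betaE_Gamma.
Qed.

Lemma beta_kernel_integrable (a b y x : R) : y < x -> 0 < a -> 0 < b ->
  mu.-integrable `]y, x[ (EFin \o (fun z => (x - z) `^ (a - 1) * (z - y) `^ (b - 1))).
Proof.
move=> yx a0 b0; apply/integrableP; split.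
  apply/measurable_EFinP; apply: measurable_funTS; apply: measurable_funM.
    exact: measurable_powR_cstB.
  exact: measurable_powR_Bcst.
have -> : (\int[mu]_(z in `]y, x[) `|(EFin \o (fun z => (x - z) `^ (a - 1) * (z - y) `^ (b - 1))%R) z|)%E
  = (((x - y) `^ (a + b - 1))%:E * betaE a b)%E.
  rewrite -integral_beta_kernel //; apply: eq_integral => z _ /=.
  by rewrite ger0_norm // mulr_ge0 ?powR_ge0.
by rewrite betaE_Gamma // -EFinM ltry.
Qed.

Definition legk j t : R := (1 - t) `^ (j%:R + m + 1) / Gamma (j%:R + m + 2).

Lemma I1_kern_pow t j : -1 <= t -> t < 1 ->
  I1 (fun x => kern t x * (1 - x) ^+ j) = j`!%:R * legk j t.
Proof.
move=> t1 t2; rewrite I1_kern //.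
have gj : 0 < j%:R + 1 :> R by rewrite ltr_wpDl.
have gm : 0 < m + 1 by rewrite addr_gt0.
transitivity (\int[mu]_(x in `]t, 1[) ((Gamma (m + 1))^-1 * ((1 - x) `^ (j%:R + 1 - 1) * (x - t) `^ (m + 1 - 1)))).
  apply: eq_Rintegral => x /[!inE] /=; rewrite in_itv /= => /andP[tx x1].
  by rewrite !addrK powR_mulrn ?subr_ge0 ?(ltW x1) //; ring.
have fin := @beta_kernel_integrable (j%:R + 1) (m + 1) t 1 t2 gj gm.
rewrite RintegralZl //.
rewrite Rintegral_beta_kernel // -[in Gamma (j%:R + 1)](S1 j) Gamma_nat /legk.
rewrite (_ : j%:R + 1 + (m + 1) - 1 = j%:R + m + 1); last by ring.
rewrite (_ : j%:R + 1 + (m + 1) = j%:R + m + 2); last by ring.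
have gjm : 0 < j%:R + m + 2 by have := n0 j; move: m0; lra.
move: G1 (Gamma_gt0 gjm); set g := Gamma (m + 1); set g' := Gamma _; clearbody g g' => g0 g0'.
by field; rewrite (gt_eqF g0) (gt_eqF g0').
Qed.

Definition leg_kern n t : R := I1 (fun x => kern t x * (legendre R n).[x]).

Lemma leg_kernE n M t : (n < M)%N -> -1 <= t -> t < 1 ->
  leg_kern n t = \sum_(j < M) legc R n j * legk j t.
Proof.
move=> nM t1 t2; have nf k : k`!%:R != 0 :> R by rewrite pnatr_eq0 -lt0n fact_gt0.
have bj j : bm (fun x => kern t x * (1 - x) ^+ j).
  apply: bmM; first exact: bm_kern.
  have := bm_poly ((1 - 'X : {poly R}) ^+ j).
  by under [X in bm X -> _]eq_fun do rewrite horner_exp !hornerE.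
transitivity (\sum_(j < n.+1) legc R n j * legk j t).
  rewrite /leg_kern.
  transitivity (I1 (fun x => \sum_(j < n.+1) legc R n j / j`!%:R * (kern t x * (1 - x) ^+ j))).
    apply: I1_eq => x _; rewrite legendre_horner mulr_sumr; apply: eq_bigr => j _; ring.
  rewrite (@I1_sum R n.+1 (fun j x => legc R n j / j`!%:R * (kern t x * (1 - x) ^+ j))); last by move=> j; apply: bmZ.
  apply: eq_bigr => j _; rewrite I1Z // I1_kern_pow // mulrA divfK //.
rewrite -!(big_mkord xpredT (fun j => legc R n j * legk j t)) (big_cat_nat (leq0n n.+1) nM) /=.
rewrite [X in _ + X]big_nat_cond [X in _ + X]big1 ?addr0 // => j /andP[/andP[nj _] _].
by rewrite legc_gt ?mul0r.
Qed.

Lemma kern_norm t : -1 <= t -> t < 1 ->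
  I1 (fun x => kern t x ^+ 2) = (1 - t) `^ (2 * m + 1) / ((2 * m + 1) * Gamma (m + 1) ^+ 2).
Proof.
move=> t1 t2.
have g2 : 0 < 2 * m + 1 by move: m0; lra.
transitivity ((Gamma (m + 1))^-1 ^+ 2 * \int[mu]_(x in `]t, 1[) ((1 - x) `^ (1 - 1) * (x - t) `^ (2 * m + 1 - 1))).
  rewrite -RintegralZl //; last exact: beta_kernel_integrable.
  transitivity (I1 (fun x => kern t x * kern t x)); first by [].
  rewrite I1_kern //; apply: eq_Rintegral => x /[!inE] /=; rewrite in_itv /= => /andP[tx x1].
  rewrite /kern tx subrr powRr0 mul1r addrK.
  have -> : (x - t) `^ (2 * m) = (x - t) `^ m * (x - t) `^ m.
    by rewrite -powRD ?(gt_eqF m0) ?subr_eq0 ?(gt_eqF tx) ?implybT //; congr (_ `^ _); ring.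
  ring.
rewrite Rintegral_beta_kernel // Gamma1 mul1r.
rewrite (_ : 1 + (2 * m + 1) - 1 = 2 * m + 1); last by ring.
rewrite (_ : 1 + (2 * m + 1) = 2 * m + 1 + 1); last by ring.
rewrite (GammaD1 g2).
move: (Gamma_gt0 g2) G1; set g := Gamma (m + 1); set g' := Gamma _; clearbody g g' => g0 g0'.
set P := _ `^ _; clearbody P.
by field; rewrite (gt_eqF g0) (gt_eqF g0') (gt_eqF g2).
Qed.

(* [(1 - t ^ 2) * leg_kern n ' t] *)
Definition dleg_kern n t : R :=
  (n%:R - m) * t * leg_kern n t - (n%:R + m + 2) * leg_kern n.+1 t.

Lemma legkS t j : t < 1 -> (1 - t) * legk j t = (j%:R + m + 2) * legk j.+1 t.
Proof.
move=> t1; have w0 : 0 < 1 - t by rewrite subr_gt0.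
have j0 : 0 < j%:R + m + 2 by have := n0 j; move: m0; lra.
rewrite /legk (S1 j) (_ : j%:R + 1 + m + 2 = j%:R + m + 2 + 1); last by ring.
rewrite (GammaD1 j0) (_ : j%:R + 1 + m + 1 = 1 + (j%:R + m + 1)); last by ring.
rewrite (@powRD _ _ 1); last by rewrite (gt_eqF w0) implybT.
rewrite powRr1 ?(ltW w0) //.
move: (Gamma_gt0 j0); set g := Gamma _; set P := _ `^ _; clearbody g P => g0.
by field; rewrite (gt_eqF g0) (gt_eqF j0).
Qed.

Lemma dleg_kernE n M t : (n.+1 < M)%N -> -1 <= t -> t < 1 ->
  dleg_kern n t = (1 + t) * (- \sum_(j < M) (j%:R + m + 1) * legc R n j * legk j t).
Proof.
move=> nM t1 t2; have := @legc_sum_up R n m (1 - t) (legk^~ t) M (fun j => legkS j t2) nM.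
rewrite (_ : 2 - (1 - t) = 1 + t); last by ring.
rewrite (_ : 1 - (1 - t) = t); last by ring.
by move=> ->; rewrite /dleg_kern !(@leg_kernE _ M) // ltnW.
Qed.

Lemma dleg_kernS n t : -1 <= t -> t < 1 ->
  dleg_kern n.+1 t = - (n%:R + m + 2) * t * leg_kern n.+1 t + (n%:R - m) * leg_kern n t.
Proof.
move=> t1 t2; rewrite (@dleg_kernE _ n.+3) //.
have := @legc_sum_down R n m (1 - t) (legk^~ t) n.+3 (fun j => legkS j t2) (ltnW (ltnSn _)).
rewrite (_ : 2 - (1 - t) = 1 + t); last by ring.
rewrite (_ : 1 - (1 - t) = t); last by ring.
by move=> ->; rewrite !(@leg_kernE _ n.+3) //; rewrite ?ltnS ?leqW.
Qed.

Lemma is_derive_legk j t : t < 1 ->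
  is_derive t 1 (legk j) (- (j%:R + m + 1) * legk j t / (1 - t)).
Proof.
move=> t1; have w0 : 0 < 1 - t by rewrite subr_gt0.
have d1 : is_derive t (1 : R) (fun s : R => 1 - s) (-1).
  by apply: is_derive_eq; ring.
have := @is_derive1_powR R (j%:R + m + 1) (1 - t) w0 => d2.
have d3 : is_derive t (1 : R) (fun s : R => (1 - s) `^ (j%:R + m + 1)) (- ((j%:R + m + 1) * (1 - t) `^ (j%:R + m + 1 - 1))).
  have := @is_derive1_comp R (fun y => y `^ (j%:R + m + 1)) (fun s : R => 1 - s) t _ _ d2 d1.
  by rewrite mulrN1.
have -> : legk j = (fun s => (Gamma (j%:R + m + 2))^-1 *: (1 - s) `^ (j%:R + m + 1)).
  by apply/funext => s; rewrite /legk mulrC.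
apply: is_derive_eq.
rewrite /GRing.scale /= powRB ?(gt_eqF w0) ?implybT // powRr1 ?(ltW w0) //.
ring.
Qed.

Lemma is_derive_leg_kern n t : -1 < t -> t < 1 ->
  is_derive t 1 (leg_kern n) (dleg_kern n t / (1 - t ^+ 2)).
Proof.
move=> t1 t2.
have E : {near t, leg_kern n =1 (fun s => \sum_(j < n.+2) legc R n j * legk j s)}.
  have tI : t \in `]-1, 1[ by rewrite in_itv /= t1.
  apply: filterS (near_in_itvoo tI) => s; rewrite in_itv /= => /andP[s1 s2].
  by rewrite (@leg_kernE _ n.+2) // ltW.
have E0 : leg_kern n t = \sum_(j < n.+2) legc R n j * legk j t by exact: nbhs_singleton E.
have D : is_derive t 1 (fun s => \sum_(j < n.+2) legc R n j * legk j s)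
    (\sum_(j < n.+2) legc R n j * (- (j%:R + m + 1) * legk j t / (1 - t))).
  rewrite (_ : (fun s => _) = \sum_(j < n.+2) (fun s => legc R n j *: legk j s)); last first.
    by apply/funext => s; rewrite fct_sumE.
  by apply: is_derive_sum => j; have d := is_derive_legk j t2; exact: is_deriveZ.
apply: (@near_eq_is_derive _ _ _ (fun s => \sum_(j < n.+2) legc R n j * legk j s)).
  by apply: filterS E => s ->.
have w1 : 0 < 1 - t by rewrite subr_gt0.
have w2 : 0 < 1 + t by rewrite -ltrBlDl sub0r.
rewrite (@dleg_kernE _ n.+2) // ?ltW //.
rewrite (_ : _ / _ = \sum_(j < n.+2) legc R n j * (- (j%:R + m + 1) * legk j t / (1 - t))) //.
transitivity (- (\sum_(j < n.+2) (j%:R + m + 1) * legc R n j * legk j t) / (1 - t)).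
  set X := \sum_(_ < _) _; field.
  by rewrite !gt_eqF //= (_ : 1 - t ^+ 2 = (1 - t) * (1 + t)) ?mulr_gt0 //; ring.
by rewrite -sumrN mulr_suml; apply: eq_bigr => j _; ring.
Qed.

Definition sonin n t : R :=
  (n%:R - m) * (n%:R + m + 1) * leg_kern n t ^+ 2 + dleg_kern n t ^+ 2 / (1 - t ^+ 2).

Lemma one_sub_sqr_gt0 t : -1 < t -> t < 1 -> 0 < 1 - t ^+ 2.
Proof.
move=> t1 t2; rewrite (_ : 1 - t ^+ 2 = (1 - t) * (1 + t)); last by ring.
by apply: mulr_gt0; lra.
Qed.

Lemma is_derive_dleg_kern n t : -1 < t -> t < 1 ->
  is_derive t 1 (dleg_kern n)
    (- ((n%:R - m) * (n%:R + m + 1)) * leg_kern n t - 2 * (m + 1) * t * dleg_kern n t / (1 - t ^+ 2)).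
Proof.
move=> t1 t2; have v0 := one_sub_sqr_gt0 t1 t2.
have dy := is_derive_leg_kern n t1 t2; have dz := is_derive_leg_kern n.+1 t1 t2.
apply: is_derive_eq.
rewrite /GRing.scale /= (dleg_kernS n (ltW t1) t2) /dleg_kern.
by field; rewrite gt_eqF.
Qed.

Lemma is_derive_sonin n t : -1 < t -> t < 1 ->
  is_derive t 1 (sonin n) (- (2 * (2 * m + 1)) * t * (dleg_kern n t / (1 - t ^+ 2)) ^+ 2).
Proof.
move=> t1 t2; have v0 := one_sub_sqr_gt0 t1 t2.
have dy := is_derive_leg_kern n t1 t2; have dz := is_derive_dleg_kern n t1 t2.
have dv : is_derive t (1 : R) (fun s : R => (1 - s ^+ 2)^-1) (2 * t / (1 - t ^+ 2) ^+ 2).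
  have dq : is_derive t (1 : R) (fun s : R => 1 - s ^+ 2) (- (2 * t)).
    by apply: is_derive_eq; rewrite /GRing.scale /=; ring.
  have dvq := @is_deriveV R (fun s : R => 1 - s ^+ 2) t _ _ (lt0r_neq0 v0) dq.
  apply: (is_derive_eq dvq).
  by rewrite /GRing.scale /=; field; rewrite gt_eqF.
apply: is_derive_eq.
rewrite /GRing.scale /=.
by field; rewrite gt_eqF.
Qed.

(* The Sonin function increases up to [0] and decreases afterwards. *)
Lemma sonin_le n t : -1 < t -> t < 1 -> sonin n t <= sonin n 0.
Proof.
move=> t1 t2.
have cS a b : -1 < a -> b < 1 -> {within `[a, b], continuous (sonin n)}.
  move=> a1 b1; apply: continuous_in_subspaceT => s /[!inE] /=; rewrite in_itv /= => /andP[sa sb].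
  apply: differentiable_continuous; apply/derivable1_diffP.
  by have [] := is_derive_sonin n (lt_le_trans a1 sa) (le_lt_trans sb b1).
have dS s : -1 < s -> s < 1 -> derivable (sonin n) s 1 /\
    derive1 (sonin n) s = - (2 * (2 * m + 1)) * s * (dleg_kern n s / (1 - s ^+ 2)) ^+ 2.
  move=> s1 s2; have d := is_derive_sonin n s1 s2; split; first by case: d.
  by rewrite derive1E derive_val.
have m21 : 0 <= 2 * (2 * m + 1) by move: m0; lra.
have [t0|t0] := leP 0 t.
- apply: (@ler0_derive1_nincr R (sonin n) 0 t _ _ _ 0 t (lexx _) t0 (lexx _)).
  + by move=> s; rewrite in_itv /= => /andP[s0 st]; apply: (dS s _ _).1; lra.
  + move=> s; rewrite in_itv /= => /andP[s0 st]; rewrite (dS s _ _).2; [|lra|lra].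
    by rewrite mulNr mulNr oppr_le0; apply: mulr_ge0; [apply: mulr_ge0; [exact: m21|exact: ltW]|exact: sqr_ge0].
  + by apply: cS; lra.
- apply: (@ger0_derive1_ndecr R (sonin n) t 0 _ _ _ t 0 (lexx _) (ltW t0) (lexx _)).
  + by move=> s; rewrite in_itv /= => /andP[s0 st]; apply: (dS s _ _).1; lra.
  + move=> s; rewrite in_itv /= => /andP[s0 st]; rewrite (dS s _ _).2; [|lra|lra].
    rewrite mulNr -mulrN; apply: mulr_ge0; last exact: sqr_ge0.
    by apply: mulr_ge0; [exact: m21|rewrite oppr_ge0; exact: ltW].
  + by apply: cS; lra.
Qed.

Lemma kern_residual N t : -1 < t -> t < 1 ->
  I1 (fun x => kern t x ^+ 2) - \sum_(n < N.+1) (2 * n%:R + 1) / 2 * leg_kern n t ^+ 2 =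
  (dleg_kern N t ^+ 2 / (1 - t ^+ 2) + (N%:R - m) ^+ 2 * leg_kern N t ^+ 2) / (2 * (2 * m + 1)).
Proof.
move=> t1 t2; have v0 := one_sub_sqr_gt0 t1 t2.
have m21 : 0 < 2 * m + 1 by move: m0; lra.
have w0 : 0 < 1 - t by rewrite subr_gt0.
have w1 : 0 < 1 + t by lra.
elim: N => [|N IH].
  rewrite big_ord1 (dleg_kernE (M := 2)) ?(ltW t1) // (leg_kernE (M := 1)) ?(ltW t1) //.
  rewrite kern_norm ?(ltW t1) // !big_ord_recr !big_ord0 /=.
  rewrite !subrr /legk !mul0r !add0r !mul1r ?oppr0 ?mul0r ?mulr0 ?addr0.
  have m1 : 0 < m + 1 by lra.
  have -> : m + 2 = m + 1 + 1 by ring.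
  rewrite (GammaD1 m1).
  have -> : (1 - t) `^ (2 * m + 1) = (1 - t) * ((1 - t) `^ m) ^+ 2.
    have P r q : (1 - t) `^ (r + q) = (1 - t) `^ r * (1 - t) `^ q by apply: powRD; rewrite (gt_eqF w0) implybT.
    by rewrite (_ : 2 * m + 1 = m + m + 1) ?P ?powRr1 ?(ltW w0) //; ring.
  have -> : (1 - t) `^ (m + 1) = (1 - t) * (1 - t) `^ m.
    by rewrite powRD ?(gt_eqF w0) ?implybT // powRr1 ?(ltW w0) // mulrC.
  move: G1; set g := Gamma _; set Q := (1 - t) `^ m; clearbody g Q => g0.
  have -> : 1 - t ^+ 2 = (1 - t) * (1 + t) by ring.
  field; rewrite (gt_eqF g0) (gt_eqF w0) (gt_eqF w1) (gt_eqF m1) //=.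
  have g3 : 0 < Gamma (1 + m + 2) by apply: Gamma_gt0; move: m0; lra.
  by rewrite (gt_eqF m21) (gt_eqF g3).
rewrite big_ord_recr /= opprD addrA IH (dleg_kernS N (ltW t1) t2) (S1 N).
rewrite /dleg_kern; field.
by rewrite (gt_eqF v0) gt_eqF //; lra.
Qed.

End truncated_power.

Section legendre_projection.
Variable R : realType.
Implicit Types (f e : R -> R) (N n : nat).

Lemma I1_orth_proj N f e : bm e ->
  (forall n, (n <= N)%N -> I1 (fun x => e x * (legendre R n).[x]) = 0) ->
  I1 (fun x => e x * (legendre_proj N f).[x]) = 0.
Proof.
move=> be eP; rewrite /legendre_proj.
transitivity (I1 (fun x => \sum_(n < N.+1) legendre_coef f n * (e x * (legendre R n).[x]))).
  apply: I1_eq => x _; rewrite horner_sum mulr_sumr; apply: eq_bigr => n _.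
  by rewrite hornerZ mulrCA.
have bP n : bm (fun x => e x * (legendre R n).[x]) by apply: bmM => //; exact: bm_poly.
rewrite (@I1_sum R N.+1 (fun n x => legendre_coef f n * (e x * (legendre R n).[x]))); last first.
  by move=> n; exact: bmZ.
by rewrite big1 // => n _; rewrite I1Z // eP ?mulr0 // -ltnS.
Qed.

Lemma legendre_proj_orth N f n : bm f -> (n <= N)%N ->
  I1 (fun x => (f x - (legendre_proj N f).[x]) * (legendre R n).[x]) = 0.
Proof.
move=> bf nN; have bP k := bm_poly (legendre R k).
under eq_fun do rewrite mulrBl.
rewrite I1B; [|exact: bmM|by apply: bmM => //; exact: bm_poly].
apply/eqP; rewrite subr_eq0; apply/eqP.
transitivity (\sum_(k < N.+1) legendre_coef f k * intp (legendre R k * legendre R n)).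
  rewrite (bigD1 (Ordinal (nN : (n < N.+1)%N))) //= legendre_orthogonal eqxx big1 ?addr0.
    rewrite /legendre_coef -/(I1 _); set X := I1 _; clearbody X.
    have n21 : 0 < 2 * n%:R + 1 :> R by rewrite ltr_wpDl // mulr_ge0.
    by field; rewrite gt_eqF.
  move=> k /eqP kn; rewrite legendre_orthogonal; case: eqP => [E|]; rewrite ?mulr0 //.
  by case: kn; apply/val_inj.
transitivity (intp (legendre_proj N f * legendre R n)); last by apply: I1_eq => x _; rewrite hornerM.
rewrite /legendre_proj mulr_suml.
transitivity (I1 (fun x => \sum_(k < N.+1) legendre_coef f k * (legendre R k * legendre R n).[x])).
  rewrite (@I1_sum R N.+1 (fun k x => legendre_coef f k * (legendre R k * legendre R n).[x])).
    by apply: eq_bigr => k _; rewrite I1Z //; exact: bm_poly.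
  by move=> k; apply: bmZ; exact: bm_poly.
apply: I1_eq => x _; rewrite horner_sum; apply: eq_bigr => k _.
by rewrite !hornerM (hornerZ (legendre_coef f k)) mulrA.
Qed.

Lemma legendre_proj_residual N f : bm f ->
  I1 (fun x => (f x - (legendre_proj N f).[x]) ^+ 2) =
  I1 (fun x => f x ^+ 2)
  - \sum_(n < N.+1) (2 * n%:R + 1) / 2 * I1 (fun x => f x * (legendre R n).[x]) ^+ 2.
Proof.
move=> bf; have bq := bm_poly (legendre_proj N f).
have br := bmB bf bq.
transitivity (I1 (fun x => (f x - (legendre_proj N f).[x]) * f x)
    - I1 (fun x => (f x - (legendre_proj N f).[x]) * (legendre_proj N f).[x])).
  rewrite -(I1B (bmM br bf) (bmM br bq)); apply: I1_eq => x _; ring.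
rewrite (I1_orth_proj f br) ?subr0; last by move=> n nN; exact: legendre_proj_orth.
under [in LHS]eq_fun do rewrite mulrBl.
rewrite (I1B (bmM bf bf) (bmM bq bf)); congr (_ - _).
transitivity (I1 (fun x => \sum_(n < N.+1) legendre_coef f n * (f x * (legendre R n).[x]))).
  apply: I1_eq => x _; rewrite /legendre_proj horner_sum mulr_suml; apply: eq_bigr => n _.
  by rewrite (hornerZ (legendre_coef f n)); ring.
have bP n : bm (fun x => f x * (legendre R n).[x]) by apply: bmM => //; exact: bm_poly.
rewrite (@I1_sum R N.+1 (fun n x => legendre_coef f n * (f x * (legendre R n).[x]))).
  apply: eq_bigr => n _; rewrite I1Z // /legendre_coef -/(I1 (fun x => f x * _)).
  by set X := I1 _; clearbody X; ring.
by move=> n; exact: bmZ.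
Qed.

End legendre_projection.

Section kernel_bound.
Variable R : realType.
Local Notation mu := (@lebesgue_measure R).
Variable m : R.
Hypothesis m0 : 0 < m.
Let G1 : 0 < Gamma (m + 1). Proof. by apply: Gamma_gt0; rewrite addr_gt0. Qed.
Let S1 n : n.+1%:R = n%:R + 1 :> R. Proof. by rewrite -addn1 natrD. Qed.
Implicit Types (n N : nat) (t : R).
Local Notation kern := (kern m).
Local Notation leg_kern := (leg_kern m).
Local Notation dleg_kern := (dleg_kern m).
Local Notation sonin := (sonin m).

Lemma kern_residual_le N t : m < N%:R -> -1 < t -> t < 1 ->
  I1 (fun x => kern t x ^+ 2) - \sum_(n < N.+1) (2 * n%:R + 1) / 2 * leg_kern n t ^+ 2
  <= 2 / ((2 * m + 1) * pi) * (Gamma (N%:R - m) / Gamma (N%:R + m + 1)).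
Proof.
move=> mN t1 t2; rewrite kern_residual //.
have m21 : 0 < 2 * (2 * m + 1) by move: m0; lra.
have m22 : 0 < 2 * m + 1 by move: m0; lra.
have Nm : 0 < N%:R - m by lra.
have z1 : (-1 : R) <= 0 by lra.
have E : dleg_kern N t ^+ 2 / (1 - t ^+ 2) + (N%:R - m) ^+ 2 * leg_kern N t ^+ 2 <= sonin N 0.
  apply: le_trans (sonin_le m0 N t1 t2); rewrite /sonin addrC lerD2r.
  rewrite expr2 ler_wpM2r ?sqr_ge0 // ler_wpM2l ?(ltW Nm) //; move: m0; lra.
rewrite ler_pdivrMr //; apply: (le_trans E).
have L0 : leg_kern 0 0 = (Gamma (m + 2))^-1.
  by rewrite (leg_kernE m0 (M := 1)) // big_ord1 mul1r /legk subr0 powR1 mul1r !add0r.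
have L1' : leg_kern 1 0 = ((m + 2) * Gamma (m + 1))^-1.
  have := dleg_kernE m0 (n := 0) (M := 2) (t := 0) isT z1 ltr01.
  rewrite /dleg_kern mulr0 mul0r sub0r !big_ord_recr big_ord0 /= subrr /legk.
  rewrite !subr0 !powR1 !add0r !mul0r !oppr0 !mul0r !mulr0 !mul0r !addr0 !mulr1 !mul1r.
  have m1 : 0 < m + 1 by move: m0; lra.
  have -> : m + 2 = m + 1 + 1 by ring.
  rewrite (GammaD1 m1); move: G1; set g := Gamma _; set y := leg_kern _ _; clearbody g y => g0 /oppr_inj H.
  have m2 : 0 < m + 1 + 1 by lra.
  apply: (mulfI (lt0r_neq0 m2)); rewrite H; field.
  by rewrite (gt_eqF g0) (gt_eqF m1) gt_eqF //; lra.
have LS n : (n%:R + m + 3) * leg_kern n.+2 0 = - (n%:R - m) * leg_kern n 0.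
  have := dleg_kernS m0 n z1 ltr01; rewrite /dleg_kern !mulr0 !mul0r sub0r add0r (S1 n) => H.
  by rewrite mulNr -H; ring.
have := energy_bound m0 L0 L1' LS mN.
rewrite /sonin /dleg_kern expr0n /= subr0 invr1 mulr1 mulr0 mul0r sub0r sqrrN exprMn.
move=> H; apply: (le_trans H).
rewrite le_eqVlt; apply/orP; left; apply/eqP.
set X := Gamma (N%:R - m) / _; move: (pi_gt0 R); set p := pi; clearbody p X => p0; field.
by rewrite (gt_eqF p0) (gt_eqF m22).
Qed.

Lemma proj_kern_le N t (e : R -> R) : bm e ->
  (forall n, (n <= N)%N -> I1 (fun x => e x * (legendre R n).[x]) = 0) ->
  m < N%:R -> -1 < t -> t < 1 ->
  `|I1 (fun x => e x * kern t x)| <= Num.sqrt (I1 (fun x => e x ^+ 2)) * L2_const m N.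
Proof.
move=> be eP mN t1 t2; have bk := bm_kern m0 t.
have bq := bm_poly (legendre_proj N (kern t)).
have br := bmB bk bq.
have -> : I1 (fun x => e x * kern t x) = I1 (fun x => e x * (kern t x - (legendre_proj N (kern t)).[x])).
  under [in RHS]eq_fun do rewrite mulrBr.
  by rewrite (I1B (bmM be bk) (bmM be bq)) (I1_orth_proj _ be eP) subr0.
rewrite -sqrtr_sqr /L2_const -sqrtrM; last by apply: I1_ge0 => x _; exact: sqr_ge0.
rewrite ler_wsqrtr //; apply: le_trans (I1_cauchy_schwarz be br) _.
rewrite ler_wpM2l //; first by apply: I1_ge0 => x _; exact: sqr_ge0.
by rewrite legendre_proj_residual //; exact: kern_residual_le.
Qed.

End kernel_bound.

(** * Pairing with fractional integrals of BV functions *)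

Section bounded_variation_control.
Variable R : realType.
Local Notation mu := (@lebesgue_measure R).
Implicit Types (a b x y l : R) (g V : R -> R).

Definition controls a b g V := forall x y, a <= x -> x <= y -> y <= b -> `|g y - g x| <= V y - V x.

Lemma BV_controls a b g : a <= b -> bounded_variation a b g ->
  controls a b g (fun x => fine (total_variation a x g)).
Proof.
move=> ab BVg x y ax xy yb.
have fin z : a <= z -> z <= b -> total_variation a z g \is a fin_num.
  by move=> az zb; apply/(bounded_variationP _ az); exact: bounded_variationl BVg.
have ay := le_trans ax xy; have xb := le_trans xy yb.
have := total_variationD g ax xy.
have := fin _ ax xb; have := fin _ ay yb; have := total_variation_ge g xy.
case: (total_variation a y g) => // r; case: (total_variation a x g) => // s.
case: (total_variation x y g) => //= t; rewrite lee_fin => gt _ _ [->].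
by rewrite addrAC subrr add0r.
Qed.

Variables (a b : R) (g V : R -> R).
Hypothesis ab : a < b.
Hypothesis gV : controls a b g V.

Lemma controls_nd x y : a <= x -> x <= y -> y <= b -> V x <= V y.
Proof. by move=> ax xy yb; rewrite -subr_ge0; apply: le_trans (gV ax xy yb). Qed.

Lemma controls_nd2 x y : a <= x -> x <= y -> y <= b -> V x + g x <= V y + g y.
Proof. by move=> ax xy yb; have := gV ax xy yb; rewrite ler_norml => /andP[]; lra. Qed.

Lemma controls_bounded x : a <= x -> x <= b -> `|g x| <= `|g a| + (V b - V a).
Proof.
move=> ax xb; have := gV (lexx a) ax xb; have := controls_nd ax xb (lexx b).
by have := ler_normD (g a) (g x - g a); rewrite (addrC (g a)) subrK; lra.
Qed.

Lemma controls_measurable (D : set R) : measurable D -> D `<=` `[a, b]%classic -> measurable_fun D g.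
Proof.
move=> mD Dab.
have cl x y : x <= y -> [/\ a <= clamp a b x, clamp a b x <= clamp a b y & clamp a b y <= b].
  by move=> xy; have [? _] := clamp_itv x (ltW ab); have [_ ?] := clamp_itv y (ltW ab);
    have [? _] := clamp_le (ltW ab) xy.
have m1 : measurable_fun D (fun x => V (clamp a b x)).
  by apply: nondecreasing_measurable => // x y /cl[? ? ?]; exact: controls_nd.
have m2 : measurable_fun D (fun x => V (clamp a b x) + g (clamp a b x)).
  by apply: nondecreasing_measurable => // x y /cl[? ? ?]; exact: controls_nd2.
apply: eq_measurable_fun (measurable_funB m2 m1) => x /[!inE] /Dab /=.
by rewrite in_itv /= => /andP[ax xb]; rewrite /= (clamp_id ax xb) addrAC subrr add0r.
Qed.

Lemma controls_cvg_at_right : cvg (g x @[x --> a^'+]).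
Proof.
have lim1 (h : R -> R) : (forall x y, a <= x -> x <= y -> y <= b -> h x <= h y) ->
    cvg (h x @[x --> a^'+]).
  move=> hnd; apply: (cvgP (inf (h @` [set` Interval (BRight a) (BLeft b)]))).
  apply: nondecreasing_at_right_cvgr; first by rewrite bnd_simp.
    move=> x y; rewrite !in_itv /= => /andP[ax xb] /andP[ay yb] xy.
    by apply: hnd => //; exact: ltW.
  exists (h a) => _ [x /= + <-]; rewrite in_itv /= => /andP[ax xb].
  by apply: hnd => //; exact: ltW.
have -> : g = (fun x => (V x + g x) - V x) by apply/funext => x; rewrite addrAC subrr add0r.
exact: is_cvgB (lim1 _ controls_nd2) (lim1 _ controls_nd).
Qed.

End bounded_variation_control.

Section riesz_kernel.
Variable R : realType.
Local Notation mu := (@lebesgue_measure R).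
Variable m : R.
Hypothesis m0 : 0 < m.
Implicit Types (a b p x y t : R).
Local Notation kern := (kern m).

Definition riesz x y : R := if y < x then (x - y) `^ (m - 1) / Gamma m else 0.

Let g0 : 0 < Gamma m. Proof. exact: Gamma_gt0. Qed.

Lemma riesz_ge0 x y : 0 <= riesz x y.
Proof. by rewrite /riesz; case: ifP => // _; apply: divr_ge0; [exact: powR_ge0|exact: ltW]. Qed.

Lemma riesz_eq0 x y : x <= y -> riesz x y = 0.
Proof. by rewrite /riesz ltNge => ->. Qed.

Lemma measurable_riesz x : measurable_fun setT (riesz x).
Proof.
apply: measurable_fun_ifT; [|apply: measurable_funM|exact: measurable_cst].
- by apply: measurable_fun_ltr; [exact: measurable_id|exact: measurable_cst].
- exact: measurable_powR_cstB.
- exact: measurable_cst.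
Qed.

Lemma integral_riesz p x : (\int[mu]_(y in `]p, +oo[) (riesz x y)%:E = (kern p x)%:E)%E.
Proof.
have [xp|px] := leP x p.
  rewrite /kern ltNge xp /= integral0_eq // => y /=; rewrite in_itv /= andbT => py.
  by rewrite /riesz ltNge (le_trans xp (ltW py)).
rewrite integral_mkcond.
transitivity (\int[mu]_y ((fun y => (Gamma m)^-1%:E * ((x - y) `^ (m - 1) * (y - p) `^ (1 - 1))%:E) \_ `]p, x[) y)%E.
  apply: eq_integral => y _; rewrite !patchE /riesz !mem_setE /= !in_itv /= andbT.
  have [py|] := ltP p y => //=; case: ltP => // yx.
  by rewrite -EFinM subrr powRr0 mulr1 mulrC.
rewrite -integral_mkcond ge0_integralZl_EFin; [|by []|by move=> y _; rewrite lee_fin mulr_ge0 ?powR_ge0| |by rewrite invr_ge0; exact: ltW].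
  rewrite integral_beta_kernel // (betaE_Gamma m0 ltr01) -!EFinM /kern px; congr EFin.
  rewrite Gamma1 addrK (GammaD1 m0).
  move: g0; set g := Gamma m; set P := _ `^ _; clearbody g P => g0'.
  by field; rewrite (gt_eqF g0') (gt_eqF m0).
have := beta_kernel_integrable px m0 ltr01.
by move=> /measurable_int.
Qed.

Lemma riesz_integrable p x : mu.-integrable `]p, +oo[ (EFin \o riesz x).
Proof.
apply/integrableP; split.
  by apply/measurable_EFinP; apply: measurable_funTS; exact: measurable_riesz.
rewrite (_ : \int[mu]_(y in _) _ = (kern p x)%:E)%E ?ltry // -integral_riesz.
by apply: eq_integral => y _; rewrite /= ger0_norm ?riesz_ge0.
Qed.

Lemma Rintegral_riesz a b x : a <= b ->
  \int[mu]_(y in `]a, b]) riesz x y = kern a x - kern b x.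
Proof.
move=> ab; have E p : \int[mu]_(y in `]p, +oo[) riesz x y = kern p x.
  by rewrite /Rintegral integral_riesz.
have -> : kern b x = kern a x - \int[mu]_(y in `]a, b]) riesz x y; last by ring.
rewrite -(E a) -(E b); have := @Rintegral_itvB R (riesz x) (BRight a) (BInfty _ false) b (riesz_integrable a x).
by move=> <- //; rewrite bnd_simp.
Qed.

End riesz_kernel.

Section step_approximation.
Variable R : realType.
Local Notation mu := (@lebesgue_measure R).
Variables (m theta : R) (g V : R -> R).
Hypotheses (m0 : 0 < m) (theta_ge : -1 <= theta) (theta_lt : theta < 1).
Hypothesis gV : controls theta 1 g V.
Implicit Types (a b p x y t : R).
Local Notation kern := (kern m).
Local Notation riesz := (riesz m).

Lemma riesz_mul_integrable a b x : theta <= a -> b <= 1 ->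
  mu.-integrable `]a, b] (EFin \o (fun y => g y * riesz x y)).
Proof.
move=> ta b1.
have sub : `]a, b]%classic `<=` `[theta, 1]%classic.
  move=> y /=; rewrite !in_itv /= => /andP[ay yb].
  by rewrite (le_trans ta (ltW ay)) (le_trans yb b1).
have mab := @measurable_itv R `]a, b].
pose M := `|g theta| + (V 1 - V theta).
apply: (@le_integrable _ _ _ mu _ mab _ (EFin \o (fun y => M * riesz x y))).
- apply/measurable_EFinP; apply: measurable_funM.
    exact: controls_measurable gV _ mab sub.
  by apply: measurable_funTS; exact: measurable_riesz.
- move=> y yab; rewrite /= lee_fin !normrM; apply: ler_wpM2r; first by [].
  have := sub _ yab; rewrite /= in_itv /= => /andP[ty y1].
  by apply: le_trans (controls_bounded gV ty y1) _; exact: ler_norm.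
- have ir : mu.-integrable `]a, b] (EFin \o riesz x).
    apply: integrableS (riesz_integrable m0 a x) => //.
    by apply: subset_itvl; rewrite bnd_simp.
  exact: (@integrableZl _ _ R mu `]a, b]%classic mab _ _ ir).
Qed.

Lemma riesz_cell a b x : theta <= a -> a <= b -> b <= 1 ->
  `|\int[mu]_(y in `]a, b]) (g y * riesz x y) - g b * (kern a x - kern b x)|
  <= (V b - V a) * (kern a x - kern b x).
Proof.
move=> ta ab b1; have mab := @measurable_itv R `]a, b].
have ir : mu.-integrable `]a, b] (EFin \o riesz x).
  apply: integrableS (riesz_integrable m0 a x) => //.
  by apply: subset_itvl; rewrite bnd_simp.
have iz c : mu.-integrable `]a, b] (EFin \o (fun y => c * riesz x y)).
  exact: (@integrableZl _ _ R mu `]a, b]%classic mab _ _ ir).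
have ig := riesz_mul_integrable x ta b1.
rewrite -(Rintegral_riesz m0 x ab) -!RintegralZl // -RintegralB //.
have iB : mu.-integrable `]a, b] (EFin \o (fun y => g y * riesz x y - g b * riesz x y)).
  by apply: (integrableB _ ig (iz (g b))).
apply: le_trans (le_normr_Rintegral _ iB) _; first by [].
apply: le_Rintegral; [by []|exact: integrable_norm iB|exact: iz|].
move=> y /=; rewrite in_itv /= => /andP[ay yb].
rewrite -mulrBl normrM (ger0_norm (riesz_ge0 m0 x y)); apply: ler_wpM2r; first exact: riesz_ge0.
have ty := le_trans ta (ltW ay).
rewrite distrC; apply: le_trans (gV ty yb b1) _.
by rewrite lerD2l lerN2; exact: (controls_nd gV ta (ltW ay) (le_trans yb b1)).
Qed.

Lemma riesz_steps (p : nat -> R) n x : p 0%N = theta ->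
  (forall i, p i <= p i.+1) -> p n <= 1 ->
  `|\int[mu]_(y in `]theta, p n]) (g y * riesz x y)
    - \sum_(i < n) g (p i.+1) * (kern (p i) x - kern (p i.+1) x)|
  <= \sum_(i < n) (V (p i.+1) - V (p i)) * (kern (p i) x - kern (p i.+1) x).
Proof.
move=> p0 pS; have pge i : theta <= p i by elim: i => [|i IH]; rewrite ?p0 // (le_trans IH).
elim: n => [|n IH] pn.
  by rewrite !big_ord0 p0 set_itv_ge ?bnd_simp ?ltxx // Rintegral_set0 subr0 normr0.
rewrite !big_ord_recr /=; have pn' := le_trans (pS n) pn.
have := @Rintegral_itvB R (fun y => g y * riesz x y) (BRight theta) (BRight (p n.+1)) (p n).
move=> /(_ (riesz_mul_integrable x (lexx theta) pn)); rewrite !bnd_simp => /(_ (pge n) (pS n)) E.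
have -> : \int[mu]_(y in `]theta, p n.+1]) (g y * riesz x y) =
  \int[mu]_(y in `]theta, p n]) (g y * riesz x y) + \int[mu]_(y in `]p n, p n.+1]) (g y * riesz x y).
  by rewrite -E; ring.
rewrite opprD addrACA; apply: le_trans (ler_normD _ _) _.
by apply: lerD; [exact: IH|exact: riesz_cell].
Qed.

End step_approximation.

Section kernel_mean.
Variable R : realType.
Variable m : R.
Hypothesis m0 : 0 < m.
Implicit Types (s t : R).
Local Notation kern := (kern m).

Lemma kern1 x : x \in `]-1, 1[ -> kern 1 x = 0.
Proof. by rewrite in_itv /= => /andP[_ x1]; rewrite /kern ltNge (ltW x1). Qed.

Lemma I1_kern1 t : -1 <= t -> t <= 1 -> I1 (kern t) = (1 - t) `^ (m + 1) / Gamma (m + 2).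
Proof.
move=> t1; rewrite le_eqVlt => /predU1P[->|t2].
  rewrite (I1_eq kern1) I1_0 subrr powR0 ?mul0r // gt_eqF //; move: m0; lra.
have := I1_kern_pow m0 0 t1 t2; rewrite /legk fact0 mul1r !add0r => <-.
by apply: I1_eq => x _; rewrite expr0 mulr1.
Qed.

Lemma I1_kern_lip s t : -1 <= s -> s <= t -> t <= 1 ->
  I1 (kern s) - I1 (kern t) <= (m + 1) * 2 `^ m / Gamma (m + 2) * (t - s).
Proof.
move=> s1 st t1; rewrite !I1_kern1 //; [|exact: le_trans st|exact: le_trans t1].
have m1 : 0 < m + 1 by rewrite addr_gt0.
have g0 : 0 < Gamma (m + 2) by apply: Gamma_gt0; rewrite addr_gt0.
rewrite -mulrBl mulrAC ler_pM2r ?invr_gt0 //.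
move: st; rewrite le_eqVlt => /predU1P[->|st]; first by rewrite !subrr mulr0.
have ba : 1 - t < 1 - s by rewrite ltrD2l ltrN2.
have b0 : 0 <= 1 - t by rewrite subr_ge0.
have [|z|c] := @MVT R (fun z => z `^ (m + 1)) (fun z => (m + 1) * z `^ (m + 1 - 1)) _ _ ba.
- move=> z; rewrite in_itv /= => /andP[z1 _]; apply: is_derive1_powR; exact: le_lt_trans z1.
- have a0 : 0 < 1 - s by exact: le_lt_trans ba.
  apply: (continuous_subspaceW _ (within_continuous_powR m1 a0)) => y /=.
  by rewrite !in_itv /= => /andP[/(le_trans b0) -> ->].
rewrite in_itv /= => /andP[c1 c2] ->; rewrite addrK.
have -> : 1 - s - (1 - t) = t - s by ring.
have ts : 0 <= t - s by rewrite subr_ge0 ltW.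
have c0 := le_lt_trans b0 c1.
apply: ler_wpM2r => //; apply: ler_wpM2l; first exact: ltW.
apply: ge0_ler_powR; rewrite ?nnegrE ?(ltW m0) ?(ltW c0) //; lra.
Qed.

End kernel_mean.

Section halfline.
Variable R : realType.
Local Notation mu := (@lebesgue_measure R).
Variables (m theta : R) (g V e w : R -> R) (C : R).
Hypotheses (m0 : 0 < m) (theta_ge : -1 <= theta) (theta_lt : theta < 1).
Hypothesis gV : controls theta 1 g V.
Hypotheses (be : bm e) (bw : bm w).
Hypothesis wE : forall x, x \in `]-1, 1[ ->
  w x = \int[mu]_(y in `]theta, 1]) (g y * riesz m x y).
Local Notation kern := (kern m).
Let Psi t := I1 (fun x => e x * kern t x).
Hypothesis PsiC : forall t, -1 < t -> t < 1 -> `|Psi t| <= C.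

Lemma kern_summation_by_parts (p : nat -> R) n : p 0%N = theta ->
  (forall i, p i <= p i.+1) -> p n.+1 <= 1 -> (forall i, (i < n)%N -> -1 < p i.+1 /\ p i.+1 < 1) ->
  `|\sum_(i < n.+1) g (p i.+1) * (Psi (p i) - Psi (p i.+1)) + g (p n.+1) * Psi (p n.+1)|
  <= `|g (p 1%N)| * `|Psi theta| + C * (V (p n.+1) - V (p 1%N)).
Proof.
move=> p0 pS; have pge i : theta <= p i by elim: i => [|i IH]; rewrite ?p0 // (le_trans IH).
elim: n => [|n IH] pn pI.
  rewrite big_ord1 (subrr (V (p 1%N))) mulr0 addr0 p0; move: (Psi theta) (Psi (p 1%N)) => y z.
  by rewrite mulrBr subrK normrM.
have pn' : p n.+1 <= 1 by apply: le_trans (pS _) pn.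
have {}IH := IH pn' (fun i iN => pI i (ltnW iN)).
rewrite big_ord_recr /=.
have -> : \sum_(i < n.+1) g (p i.+1) * (Psi (p i) - Psi (p i.+1))
    + g (p n.+2) * (Psi (p n.+1) - Psi (p n.+2)) + g (p n.+2) * Psi (p n.+2) =
  (\sum_(i < n.+1) g (p i.+1) * (Psi (p i) - Psi (p i.+1)) + g (p n.+1) * Psi (p n.+1))
    + (g (p n.+2) - g (p n.+1)) * Psi (p n.+1).
  by move: (\sum_(_ < _) _) (Psi (p n.+1)) (Psi (p n.+2)) => s a b; ring.
apply: le_trans (ler_normD _ _) _.
have -> : C * (V (p n.+2) - V (p 1%N)) = C * (V (p n.+1) - V (p 1%N)) + (V (p n.+2) - V (p n.+1)) * C by ring.
rewrite addrA lerD // normrM; apply: ler_pM => //; first exact: gV.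
by have [p1 p2] := pI n (ltnSn n); exact: PsiC.
Qed.

Let M := xget 0 [set M | 0 <= M /\ forall x, x \in `]-1, 1[ -> `|e x| <= M].

Let MP : 0 <= M /\ forall x, x \in `]-1, 1[ -> `|e x| <= M.
Proof.
have [_ [N eN]] := be; apply: (@xgetPex _ 0 [set M | 0 <= M /\ forall x, x \in `]-1, 1[ -> `|e x| <= M]).
by exists `|N|; split => // x /eN h; apply: le_trans (ler_norm N).
Qed.

Let D := M * ((m + 1) * 2 `^ m / Gamma (m + 2) * (1 - theta)) * (V 1 - V theta).

Lemma halfline_step n :
  `|I1 (fun x => e x * w x)| <=
  `|g (theta + (1 - theta) / n.+1%:R)| * `|Psi theta| + C * (V 1 - V theta) + D * n.+1%:R^-1.
Proof.
have [M0 eM] := MP.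
pose h := (1 - theta) / n.+1%:R; pose p i : R := theta + i%:R * h.
have h0 : 0 < h by rewrite divr_gt0 ?subr_gt0.
have p0 : p 0%N = theta by rewrite /p mul0r addr0.
have pSE i : p i.+1 = p i + h by rewrite /p -addn1 natrD mulrDl mul1r addrA.
have pS i : p i <= p i.+1 by rewrite pSE lerDl ltW.
have pn : p n.+1 = 1 by rewrite /p /h mulrC divfK ?pnatr_eq0 // addrC subrK.
have p1 : p 1%N = theta + (1 - theta) / n.+1%:R by rewrite /p mul1r.
have plt i : (i < n.+1)%N -> p i < 1.
  by move=> iN; rewrite -pn /p ltrD2l ltr_pM2r // ltr_nat.
have pgt i : theta < p i.+1 by rewrite /p ltrDl mulr_gt0.
have pge i : theta <= p i by case: i => [|i]; [rewrite p0|exact: ltW].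
have pge1 i : -1 <= p i by exact: le_trans (pge i).
have ple i : (i <= n.+1)%N -> p i <= 1.
  by rewrite leq_eqVlt => /predU1P[->|/plt/ltW //]; rewrite pn.
have pI i : (i < n)%N -> -1 < p i.+1 /\ p i.+1 < 1.
  by move=> iN; split; [exact: le_lt_trans (pgt i)|exact: plt].
have bk t := bm_kern m0 t.
pose s x := \sum_(i < n.+1) g (p i.+1) * (kern (p i) x - kern (p i.+1) x).
pose r x := \sum_(i < n.+1) (V (p i.+1) - V (p i)) * (kern (p i) x - kern (p i.+1) x).
have bF (c : nat -> R) i : bm (fun x => c i * (kern (p i) x - kern (p i.+1) x)).
  by apply: bmZ; exact: bmB.
have bs : bm s by exact: (bm_sum n.+1 (bF (fun i => g (p i.+1)))).
have br : bm r by exact: (bm_sum n.+1 (bF (fun i => V (p i.+1) - V (p i)))).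
have wsr x : x \in `]-1, 1[ -> `|w x - s x| <= r x.
  move=> xI; rewrite wE // -pn; apply: riesz_steps => //; by rewrite pn.
have Psi1 : Psi 1 = 0.
  rewrite /Psi -[RHS](I1_0 R); apply: I1_eq => x xI.
  by rewrite kern1 // mulr0.
have Is : I1 (fun x => e x * s x) = \sum_(i < n.+1) g (p i.+1) * (Psi (p i) - Psi (p i.+1)).
  transitivity (I1 (fun x => \sum_(i < n.+1) g (p i.+1) * (e x * kern (p i) x - e x * kern (p i.+1) x))).
    by apply: I1_eq => x _; rewrite /s mulr_sumr; apply: eq_bigr => i _; ring.
  have bek t := bmM be (bk t).
  rewrite (@I1_sum R n.+1 (fun i x => g (p i.+1) * (e x * kern (p i) x - e x * kern (p i.+1) x))); last first.
    by move=> i; apply: bmZ; exact: bmB.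
  apply: eq_bigr => i _; rewrite (I1Z _ (bmB (bek (p i)) (bek (p i.+1)))).
  by rewrite (I1B (bek (p i)) (bek (p i.+1))).
have B1 : `|I1 (fun x => e x * s x)| <= `|g (p 1%N)| * `|Psi theta| + C * (V 1 - V (p 1%N)).
  have := @kern_summation_by_parts p n p0 pS; rewrite pn Psi1 mulr0 addr0 -Is.
  by apply.
have Ir : I1 r <= (m + 1) * 2 `^ m / Gamma (m + 2) * h * (V 1 - V theta).
  rewrite /r (@I1_sum R n.+1 (fun i x => (V (p i.+1) - V (p i)) * (kern (p i) x - kern (p i.+1) x))); last first.
    by move=> i; exact: (bF (fun i => V (p i.+1) - V (p i))).
  set L := (m + 1) * _ / _.
  have -> : L * h * (V 1 - V theta) = \sum_(i < n.+1) (V (p i.+1) - V (p i)) * (L * h).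
    rewrite -mulr_suml mulrC -pn -p0 -(big_mkord xpredT (fun i => V (p i.+1) - V (p i))).
    by rewrite (telescope_sumr (fun i => V (p i))).
  apply: ler_sum => i _; have bB := bmB (bk (p i)) (bk (p i.+1)).
  rewrite (I1Z _ bB); apply: ler_wpM2l.
    by rewrite subr_ge0; apply: (controls_nd gV) => //; exact: ple.
  rewrite (I1B (bk _) (bk _)); have := I1_kern_lip m0 (pge1 i) (pS i) (ple i.+1 (ltn_ord i)).
  by rewrite -/L [in p i.+1 - p i]pSE (addrC (p i)) addrK.
have B2 : `|I1 (fun x => e x * w x) - I1 (fun x => e x * s x)| <= M * I1 r.
  rewrite -(I1B (bmM be bw) (bmM be bs)) -(I1Z M br).
  have bd : bm (fun x => e x * w x - e x * s x) by apply: bmB; apply: bmM.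
  have hh x : x \in `]-1, 1[ -> `|e x * w x - e x * s x| <= M * r x.
    by move=> xI; rewrite -mulrBr normrM; apply: ler_pM => //; [exact: eM|exact: wsr].
  rewrite ler_norml; apply/andP; split.
    rewrite -(I1N (bmZ M br)); apply: le_I1 => //; first by apply: bmN; exact: bmZ.
    by move=> x /hh; rewrite ler_norml => /andP[].
  apply: le_I1 => //; first exact: bmZ.
  by move=> x /hh; rewrite ler_norml => /andP[].
have V1 : V theta <= V (p 1%N) by exact: (controls_nd gV (lexx theta) (pge 1%N) (ple 1%N isT)).
have CV : C * (V 1 - V (p 1%N)) <= C * (V 1 - V theta).
  have {}C0 : 0 <= C.
    by apply: le_trans (PsiC (t := (theta + 1) / 2) _ _) => //; move: theta_ge theta_lt; lra.
  by apply: ler_wpM2l => //; lra.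
have -> : I1 (fun x => e x * w x) = I1 (fun x => e x * s x) + (I1 (fun x => e x * w x) - I1 (fun x => e x * s x)) by ring.
apply: le_trans (ler_normD _ _) _; apply: lerD.
  by rewrite -p1; apply: le_trans B1 _; rewrite lerD2l.
apply: le_trans B2 _; apply: le_trans (ler_wpM2l M0 Ir) _.
by rewrite /D /h !mulrA; rewrite le_eqVlt; apply/orP; left; apply/eqP; ring.
Qed.

Lemma cvg_invS : (fun n => (n.+1%:R : R)^-1) @ \oo --> (0 : R).
Proof. exact: cvg_harmonic. Qed.

Lemma halfline_bound0 : Psi theta = 0 -> `|I1 (fun x => e x * w x)| <= C * (V 1 - V theta).
Proof.
move=> P0; have cst : (fun n => C * (V 1 - V theta) + D * n.+1%:R^-1) @ \oo --> C * (V 1 - V theta) + D * 0.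
  by apply: cvgD; [exact: cvg_cst|apply: cvgMr; exact: cvg_invS].
rewrite mulr0 addr0 in cst; rewrite -(cvg_lim (@Rhausdorff R) cst).
apply: limr_ge; first by apply: cvgP cst.
by apply: nearW => n; have := halfline_step n; rewrite P0 normr0 mulr0 add0r.
Qed.

Lemma halfline_bound : -1 < theta ->
  `|I1 (fun x => e x * w x)| <= C * (`|lim (g x @[x --> theta^'+])| + (V 1 - V theta)).
Proof.
move=> t1; have PC := PsiC t1 theta_lt; set l := lim _.
have cg := controls_cvg_at_right theta_lt gV; rewrite -/l in cg.
have cp : g (theta + (1 - theta) / n.+1%:R) @[n --> \oo] --> l.
  move/cvg_at_rightP : cg; apply; split.
    by move=> n; rewrite ltrDl divr_gt0 ?subr_gt0.
  rewrite -[X in _ --> X]addr0 -(mulr0 (1 - theta)).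
  by apply: cvgD; [exact: cvg_cst|apply: cvgMr; exact: cvg_invS].
have cst : (fun n => `|g (theta + (1 - theta) / n.+1%:R)| * `|Psi theta| + C * (V 1 - V theta) + D * n.+1%:R^-1)
    @ \oo --> `|l| * `|Psi theta| + C * (V 1 - V theta) + D * 0.
  apply: cvgD; last by apply: cvgMr; exact: cvg_invS.
  by apply: cvgD; [apply: cvgMl; exact: cvg_norm|exact: cvg_cst].
rewrite mulr0 addr0 in cst.
apply: (@le_trans _ _ (`|l| * `|Psi theta| + C * (V 1 - V theta))).
  rewrite -(cvg_lim (@Rhausdorff R) cst).
  apply: limr_ge; first by apply: cvgP cst.
  by apply: nearW => n; exact: halfline_step.
by rewrite [leRHS]mulrDr lerD2r mulrC ler_wpM2r.
Qed.

End halfline.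

(** * Fractional integrals and the Taylor remainder *)

Section ae_integral.
Local Open Scope ereal_scope.
Context d (T : measurableType d) (R : realType).
Variable mu : {measure set T -> \bar R}.
Implicit Types (D : set T) (f g : T -> \bar R).
Import HBNNSimple.

Let ae_le_integral f g : (forall x, 0 <= f x) -> (forall x, 0 <= g x) ->
  {ae mu, forall x, f x = g x} -> \int[mu]_x f x <= \int[mu]_x g x.
Proof.
move=> f0 g0 [N [mN N0 fgN]].
rewrite !ge0_integralTE //; apply: ge_ereal_sup => _ [h /= hf <-].
have mNC : measurable (~` N) by exact: measurableC.
have E : sintegral mu h = sintegral mu (proj_nnsfun h mNC).
  rewrite -!integralT_nnsfun; apply: ae_eq_integral => //.
  - exact/measurable_EFinP.
  - exact/measurable_EFinP.
  - exists N; split => // x /= hx; apply: contrapT => Nx; apply: hx => _.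
    by rewrite mindicE mem_set // mulr1.
rewrite E; apply: ereal_sup_ubound; exists (proj_nnsfun h mNC) => //= x.
rewrite mindicE; have [/set_mem Nx|_] := boolP (x \in ~` N); last by rewrite mulr0.
rewrite mulr1; suff <- : f x = g x by exact: hf.
by apply: contrapT => fgx; apply: Nx; exact: fgN.
Qed.

(* The integral is a supremum over simple functions below the integrand, so it
   makes sense for non-measurable integrands and only depends on their class. *)
Lemma ae_eq_integral_nonmeasurable D f g : ae_eq mu D f g ->
  \int[mu]_(x in D) f x = \int[mu]_(x in D) g x.
Proof.
move=> fg; rewrite integral_mkcond [RHS]integral_mkcond.
have {}fg : {ae mu, forall x, (f \_ D) x = (g \_ D) x}.
  apply: filterS fg => x fgx; rewrite !patchE; case: ifP => // /set_mem; exact: fgx.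
rewrite integralE [RHS]integralE; congr (_ - _); apply/eqP; rewrite eq_le; apply/andP; split;
  apply: ae_le_integral => //; by apply: filterS fg => x; rewrite ?funeposE ?funenegE => ->.
Qed.

Lemma ae_eq_Rintegral D (f g : T -> R) : {ae mu, forall x, D x -> f x = g x} ->
  (\int[mu]_(x in D) f x = \int[mu]_(x in D) g x)%R.
Proof.
move=> fg; congr fine; apply: ae_eq_integral_nonmeasurable.
by apply: filterS fg => x + Dx => /(_ Dx) ->.
Qed.

Lemma ae_mono (P Q : T -> Prop) : (forall x, P x -> Q x) ->
  {ae mu, forall x, P x} -> {ae mu, forall x, Q x}.
Proof. by move=> PQ; apply: filterS. Qed.

End ae_integral.

Section fractional_semigroup.
Variable R : realType.
Local Notation mu := (@lebesgue_measure R).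
Implicit Types (a b x y z theta : R) (g h : R -> R).

Lemma integral_riesz_riesz a b x y : 0 < a -> 0 < b ->
  (\int[mu]_z (riesz a x z * riesz b z y)%:E = (riesz (a + b) x y)%:E)%E.
Proof.
move=> a0 b0; have [xy|yx] := leP x y.
  rewrite [in RHS]/riesz ltNge xy /= integral0_eq // => z _; rewrite /riesz.
  have [zx|] := ltP z x; last by rewrite mul0r.
  by rewrite [in X in _ * X]ltNge (ltW (lt_le_trans zx xy)) mulr0.
have ga := Gamma_gt0 a0; have gb := Gamma_gt0 b0.
transitivity (\int[mu]_z ((fun z => ((Gamma a)^-1 * (Gamma b)^-1)%:E * ((x - z) `^ (a - 1) * (z - y) `^ (b - 1))%:E) \_ `]y, x[) z)%E.
  apply: eq_integral => z _; rewrite patchE /riesz mem_setE /= in_itv /=.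
  have [zx|] := ltP z x; last by rewrite andbF mul0r.
  have [yz|] := ltP y z; last by rewrite mulr0.
  by rewrite mulrACA mulrC EFinM.
rewrite -integral_mkcond ge0_integralZl_EFin; [|by []|by move=> z _; rewrite lee_fin mulr_ge0 ?powR_ge0| |by rewrite mulr_ge0 ?invr_ge0 ?ltW].
  rewrite integral_beta_kernel // (betaE_Gamma a0 b0) -!EFinM /riesz yx; congr EFin.
  have gab := Gamma_gt0 (addr_gt0 a0 b0).
  move: ga gb gab; set g1 := Gamma a; set g2 := Gamma b; set g3 := Gamma (a + b).
  set P := _ `^ _; clearbody g1 g2 g3 P => g10 g20 g30.
  by field; rewrite (gt_eqF g10) (gt_eqF g20) (gt_eqF g30).
by have := beta_kernel_integrable yx a0 b0 => /measurable_int.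
Qed.

Lemma riesz_le a theta x y : 1 <= a -> theta < y -> riesz a x y <= `|x - theta| `^ (a - 1) / Gamma a.
Proof.
move=> a1 ty; have a0 : 0 < a by exact: lt_le_trans a1.
have ga := Gamma_gt0 a0.
rewrite /riesz; case: ifP => [yx|_]; last by apply: divr_ge0; [exact: powR_ge0|exact: ltW].
rewrite ler_pM2r ?invr_gt0 //; apply: ge0_ler_powR; rewrite ?nnegrE ?subr_ge0 ?(ltW yx) //.
by apply: le_trans (ler_norm _); rewrite lerD2l lerN2 ltW.
Qed.

Lemma integrable_mul_riesz a theta x g : 1 <= a -> mu.-integrable setT (EFin \o g) ->
  (forall y, y <= theta -> g y = 0) ->
  mu.-integrable setT (EFin \o (fun y => g y * riesz a x y)).
Proof.
move=> a1 ig g0; have a0 : 0 < a by exact: lt_le_trans a1.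
pose M := `|x - theta| `^ (a - 1) / Gamma a.
have iM : mu.-integrable setT (EFin \o (fun y => M * g y)) by exact: (@integrableZl _ _ R mu setT measurableT M _ ig).
have mg : measurable_fun setT g by apply/measurable_EFinP; exact: measurable_int ig.
apply: (le_integrable _ _ _ iM) => //.
  by apply/measurable_EFinP; apply: measurable_funM => //; exact: measurable_riesz.
move=> y _; rewrite /= lee_fin normrM (normrM M) mulrC.
have [yt|ty] := leP y theta; first by rewrite g0 // normr0 !mulr0.
rewrite ler_wpM2r // (ger0_norm (riesz_ge0 a0 x y)).
by apply: le_trans (riesz_le x a1 ty) _; exact: ler_norm.
Qed.

Lemma measurable_riesz2 b : measurable_fun setT (fun zy : R * R => riesz b zy.1 zy.2).
Proof.
apply: measurable_fun_ifT; [|apply: measurable_funM|exact: measurable_cst].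
- by apply: measurable_fun_ltr; [exact: measurable_snd|exact: measurable_fst].
- apply: (measurableT_comp (measurable_powR _)).
  by apply: measurable_funB; [exact: measurable_fst|exact: measurable_snd].
- exact: measurable_cst.
Qed.

Lemma measurable_riesz_l b y : measurable_fun setT (fun z : R => riesz b z y).
Proof.
apply: measurable_fun_ifT; [|apply: measurable_funM|exact: measurable_cst].
- by apply: measurable_fun_ltr; [exact: measurable_cst|exact: measurable_id].
- exact: measurable_powR_Bcst.
- exact: measurable_cst.
Qed.

Lemma riesz_semigroup a b theta x g h : 0 < a -> 0 < b -> 1 <= a + b ->
  mu.-integrable setT (EFin \o g) -> (forall y, y <= theta -> g y = 0) ->
  {ae mu, forall z, z < x -> h z = \int[mu]_y (g y * riesz b z y)} ->
  \int[mu]_z (h z * riesz a x z) = \int[mu]_y (g y * riesz (a + b) x y).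
Proof.
move=> a0 b0 ab1 ig g0 hE.
have mg : measurable_fun setT g by apply/measurable_EFinP; exact: measurable_int ig.
pose F (zy : R * R) := (riesz a x zy.1 * (g zy.2 * riesz b zy.1 zy.2))%:E.
have mF : measurable_fun setT F.
  apply/measurable_EFinP; apply: measurable_funM.
    exact: (measurableT_comp (measurable_riesz a x) measurable_fst).
  apply: measurable_funM; last exact: measurable_riesz2.
  exact: (measurableT_comp mg measurable_snd).
have irr y : mu.-integrable setT (EFin \o (fun z => riesz a x z * riesz b z y)).
  apply/integrableP; split.
    apply/measurable_EFinP; apply: measurable_funM; first exact: measurable_riesz.
    exact: measurable_riesz_l.
  rewrite (_ : \int[mu]_z _ = (riesz (a + b) x y)%:E)%E ?ltry // -integral_riesz_riesz //.
  apply: eq_integral => z _; rewrite /= ger0_norm //; apply: mulr_ge0; exact: riesz_ge0.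
have col (c : R) y : (\int[mu]_z (riesz a x z * (c * riesz b z y))%:E = (c * riesz (a + b) x y)%:E)%E.
  rewrite EFinM -(integral_riesz_riesz x y a0 b0) -(integralZl _ (irr y)) //.
  by apply: eq_integral => z _; rewrite /= mulrCA EFinM.
have iF : (mu \x mu)%E.-integrable setT F.
  have [_] := @integrable21ltyP _ _ _ _ R mu mu F mF; apply; have /integrableP[_] := integrable_mul_riesz x ab1 ig g0.
  apply: le_lt_trans; rewrite le_eqVlt; apply/orP; left; apply/eqP.
  apply: eq_integral => y _; rewrite /= normrM (ger0_norm (riesz_ge0 (addr_gt0 a0 b0) x y)) -col.
  apply: eq_integral => z _; rewrite /F /= !normrM.
  rewrite (ger0_norm (riesz_ge0 a0 x z)) (ger0_norm (riesz_ge0 b0 z y)); exact: erefl.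
have fub : (\int[mu]_z \int[mu]_y F (z, y) = \int[mu]_y \int[mu]_z F (z, y))%E.
  exact: etrans (integral12_prod_meas1 iF) (esym (integral21_prod_meas1 iF)).
have RE y : (\int[mu]_z F (z, y) = (g y * riesz (a + b) x y)%:E)%E by exact: (col (g y) y).
rewrite {1}/Rintegral; transitivity (fine (\int[mu]_z \int[mu]_y F (z, y))%E); last first.
  by rewrite fub /Rintegral; congr fine; apply: eq_integral => y _; rewrite RE.
congr fine; apply: ae_eq_integral_nonmeasurable.
have FF := @ae_filter_ringOfSetsType _ _ R mu.
apply: (@filterS2 _ _ FF _ _ _ _ hE (ae_integrable1 iF)) => z hz iz _.
rewrite /= /F /=; have [zx|xz] := ltP z x; last first.
  rewrite (riesz_eq0 a xz) mulr0; apply/esym; apply: integral0_eq => y _; by rewrite mul0r.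
move: iz; rewrite /F /=; move: (riesz a x z) => c iz.
have [c0|cn0] := eqVneq c 0.
  by rewrite c0 mulr0; apply/esym; apply: integral0_eq => y _; rewrite mul0r.
have ig' : mu.-integrable setT (EFin \o (fun y => g y * riesz b z y)).
  have iz' := @integrableZl _ _ R mu setT measurableT c^-1 _ iz.
  have E y : (EFin \o (fun y => g y * riesz b z y)) y = ((c^-1)%:E * (c * (g y * riesz b z y))%:E)%E.
    by rewrite -EFinM (mulKf cn0).
  by move: iz'; under eq_fun do rewrite -E.
rewrite (hz zx) mulrC EFinM /Rintegral fineK; last exact: integrable_fin_num.
by rewrite -(@integralZl _ _ R mu setT measurableT _ ig').
Qed.

End fractional_semigroup.

Section taylor.
Variable R : realType.
Local Notation mu := (@lebesgue_measure R).
Variables (theta : R) (k : nat) (U : nat -> R -> R).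
Hypothesis theta_lt : theta < 1.
Hypothesis UE : forall j x, (j < k)%N -> theta <= x -> x <= 1 ->
  U j x = U j theta + \int[mu]_(y in `]theta, x]) U j.+1 y.
Hypothesis iU : forall j, (0 < j)%N -> (j <= k)%N -> mu.-integrable `]theta, 1] (EFin \o U j).
Implicit Types (x y z : R) (j : nat).

Let D : set R := `]theta, 1]%classic.
Let one : R -> R := fun=> 1.
Let G j := U j \_ D.

Definition taylor_poly : {poly R} :=
  \sum_(i < k) (U i theta / i`!%:R) *: ('X - theta%:P) ^+ i.

Let iG j : (0 < j)%N -> (j <= k)%N -> mu.-integrable setT (EFin \o G j).
Proof.
move=> j0 jk; rewrite /G -restrict_EFin.
by have [+ _] := @integrable_mkcond _ _ R mu D (EFin \o U j) (measurable_itv _); apply; exact: iU.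
Qed.

Let G_left (f : R -> R) y : y <= theta -> (f \_ D) y = 0.
Proof. by move=> yt; rewrite patchE /D mem_setE /= in_itv /= ltNge yt. Qed.

Let G_in (f : R -> R) y : theta < y -> y <= 1 -> (f \_ D) y = f y.
Proof. by move=> ty y1; rewrite patchE /D mem_setE /= in_itv /= ty y1. Qed.

Let riesz_left (b : R) (f : R -> R) z : z <= theta -> \int[mu]_y ((f \_ D) y * riesz b z y) = 0.
Proof.
move=> zt; rewrite /Rintegral integral0_eq // => y _.
have [yt|ty] := leP y theta; first by rewrite G_left // mul0r.
by rewrite riesz_eq0 ?mulr0 // (le_trans zt) // ltW.
Qed.

Lemma riesz1 x y : riesz 1 x y = if y < x then 1 else 0.
Proof. by rewrite /riesz subrr powRr0 Gamma1 divr1. Qed.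

Lemma Rintegral_riesz1 j x : (0 < j)%N -> (j <= k)%N -> x <= 1 ->
  \int[mu]_y (G j y * riesz 1 x y) = \int[mu]_(y in `]theta, x]) U j y.
Proof.
move=> j0 jk x1; rewrite -Rintegral_itv_bndo_bndc; last first.
  apply: integrableS (iU j0 jk) => //.
  by apply: subset_itvl; rewrite bnd_simp.
rewrite [RHS]Rintegral_mkcond; apply: eq_Rintegral => y _.
rewrite riesz1 /G !patchE /D !mem_setE /= !in_itv /=.
have [yx|xy] := ltP y x; last by rewrite mulr0 andbF.
by rewrite mulr1 (ltW (lt_le_trans yx x1)) andbT.
Qed.

Lemma Rintegral_cst_riesz j x : (0 < j)%N -> theta < x -> x <= 1 ->
  \int[mu]_y ((one \_ D) y * riesz j%:R x y) = (x - theta) ^+ j / j`!%:R.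
Proof.
move=> j0 tx x1; have j0' : 0 < j%:R :> R by rewrite ltr0n.
transitivity (\int[mu]_(y in D) riesz j%:R x y).
  rewrite [RHS]Rintegral_mkcond; apply: eq_Rintegral => y _.
  by rewrite !patchE; case: ifP; rewrite /one ?mul1r ?mul0r.
rewrite /D Rintegral_riesz ?ltW // /kern tx ltNge x1 subr0.
by rewrite natr1 Gamma_nat powR_mulrn // subr_ge0 ltW.
Qed.

Lemma taylor_step j x : (0 < j)%N -> (j < k)%N -> theta < x -> x <= 1 ->
  \int[mu]_y (G j y * riesz j%:R x y) =
  U j theta * ((x - theta) ^+ j / j`!%:R) + \int[mu]_y (G j.+1 y * riesz j.+1%:R x y).
Proof.
move=> j0 jk tx x1; have j1 : 1 <= j%:R :> R by rewrite ler1n.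
have j0' : 0 < j%:R :> R by rewrite ltr0n.
have iD : mu.-integrable setT (EFin \o (one \_ D)).
  rewrite -restrict_EFin.
  have [+ _] := @integrable_mkcond _ _ R mu D (EFin \o one) (measurable_itv _); apply.
  have Dfin : (mu D < +oo)%E.
    have -> : mu D = (if (theta < 1)%R then 1%:E - theta%:E else 0)%E by rewrite /D lebesgue_measure_itv.
    by rewrite theta_lt -EFinB ltry.
  apply: (@measurable_bounded_integrable _ _ _ mu _ _ (measurable_itv `]theta, 1])) => //.
    exact: measurable_cst.
  exists 1; split; first exact: num_real.
  by move=> N N1 z _; rewrite /= normr1 ltW.
have i1 := integrable_mul_riesz x j1 (iG j0 (ltnW jk)) (@G_left _).
have i2 := integrable_mul_riesz x j1 iD (@G_left _).
have S : \int[mu]_z ((G j z - U j theta * (one \_ D) z) * riesz j%:R x z) =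
    \int[mu]_y (G j.+1 y * riesz (j%:R + 1) x y).
  apply: (riesz_semigroup j0' ltr01 _ (iG _ _) (@G_left _)) => //; first by rewrite lerDr.
  apply: aeW => z zx; have [zt|tz] := leP z theta.
    by rewrite /G !G_left // mulr0 subr0 riesz_left.
  have z1 := le_trans (ltW zx) x1.
  by rewrite Rintegral_riesz1 // /G !G_in // (UE jk (ltW tz) z1) /one mulr1 addrAC subrr add0r.
have iz := @integrableZl _ _ R mu setT measurableT (U j theta) _ i2.
have SB := RintegralB measurableT i1 iz.
have SZ := RintegralZl (U j theta) measurableT i2.
rewrite -(Rintegral_cst_riesz j0 tx x1) -SZ -(natr1 j) -S.
apply/eqP; rewrite addrC -subr_eq; apply/eqP; rewrite -[LHS]SB.
by apply: eq_Rintegral => z _; rewrite [RHS]mulrBl (mulrA (U j theta)).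
Qed.

Lemma taylor_riesz j x : (0 < j)%N -> (j <= k)%N -> theta < x -> x <= 1 ->
  U 0%N x = \sum_(i < j) U i theta * ((x - theta) ^+ i / i`!%:R)
            + \int[mu]_y (G j y * riesz j%:R x y).
Proof.
move=> + + tx x1; elim: j => // -[_ _ k0|j IH _ jk].
  rewrite big_ord1 expr0 fact0 divr1 mulr1 Rintegral_riesz1 //.
  by apply: UE => //; exact: ltW.
apply: (etrans (IH isT (ltnW jk))); rewrite (taylor_step (ltn0Sn j) jk tx x1) [in RHS]big_ord_recr.
exact: addrA.
Qed.

Lemma taylor_poly_horner x :
  taylor_poly.[x] = \sum_(i < k) U i theta * ((x - theta) ^+ i / i`!%:R).
Proof.
rewrite horner_sum; apply: eq_bigr => i _.
by rewrite hornerZ horner_exp !hornerE mulrAC.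
Qed.

Lemma taylor_remainder_frac (m : R) (g : R -> R) x : 0 < m -> m < k%:R ->
  {ae mu, forall z, z \in `]theta, 1] ->
    g z = \int[mu]_(y in `]theta, 1]) (U k y * riesz (k%:R - m) z y)} ->
  theta < x -> x <= 1 ->
  U 0%N x - taylor_poly.[x] = \int[mu]_(y in `]theta, 1]) (g y * riesz m x y).
Proof.
move=> m0 mk gE tx x1; have k0 : (0 < k)%N by rewrite -(ltr0n R) (lt_trans m0).
rewrite taylor_poly_horner (taylor_riesz k0 (leqnn k) tx x1) addrAC subrr add0r.
have km : 0 < k%:R - m by rewrite subr_gt0.
have kE : k%:R = m + (k%:R - m) by ring.
have restr (f : R -> R) b z : \int[mu]_(y in D) (f y * riesz b z y) = \int[mu]_y ((f \_ D) y * riesz b z y).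
  rewrite Rintegral_mkcond; apply: eq_Rintegral => y _.
  by rewrite !patchE; case: ifP; rewrite ?mul0r.
rewrite [RHS]restr [in LHS]kE; apply/esym.
apply: (riesz_semigroup m0 km _ (iG _ _) (@G_left _)) => //; first by rewrite -kE ler1n.
apply: ae_mono gE => z gz zx; have [zt|tz] := leP z theta.
  by rewrite G_left // riesz_left.
have z1 := le_trans (ltW zx) x1.
by rewrite G_in // gz ?restr // in_itv /= tz z1.
Qed.

Lemma taylor_remainder (g : R -> R) x : (0 < k)%N ->
  {ae mu, forall z, z \in `]theta, 1[ -> g z = U k z} ->
  theta < x -> x <= 1 ->
  U 0%N x - taylor_poly.[x] = \int[mu]_(y in `]theta, 1]) (g y * riesz k%:R x y).
Proof.
move=> k0 gE tx x1.
rewrite taylor_poly_horner (taylor_riesz k0 (leqnn k) tx x1) addrAC subrr add0r.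
transitivity (\int[mu]_(y in D) (U k y * riesz k%:R x y)).
  rewrite [RHS]Rintegral_mkcond; apply: eq_Rintegral => y _.
  by rewrite /G !patchE; case: ifP; rewrite ?mul0r.
apply: ae_eq_Rintegral; apply: ae_mono gE => z gz.
rewrite /D /= in_itv /= => /andP[tz _]; have [xz|zx] := leP x z; first by rewrite riesz_eq0 // !mulr0.
by rewrite gz // in_itv /= tz (lt_le_trans zx x1).
Qed.

End taylor.

(** * Reflection and the two one-sided bounds *)

Section reflection.
Variable R : realType.
Local Notation mu := (@lebesgue_measure R).
Implicit Types (f g : R -> R) (D : set R).

Lemma Rintegral_opp D f : measurable D -> measurable_fun D f ->
  \int[mu]_(x in D) f x = \int[mu]_(x in -%R @^-1` D) f (- x).
Proof.
move=> mD mf; have mE : measurable_fun D (EFin \o f) by exact/measurable_EFinP.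
have refl (h : R -> \bar R) : measurable_fun D h -> (forall x, 0 <= h x)%E ->
    (\int[mu]_(x in D) h x = \int[mu]_(x in -%R @^-1` D) h (- x)%R)%E.
  move=> mh h0; rewrite (ge0_integral_reflect 0 mD mh) //.
  rewrite (_ : (fun x => 0 - x) @^-1` D = -%R @^-1` D).
    by apply: eq_integral => x _; rewrite sub0r.
  by apply/seteqP; split => x /=; rewrite sub0r.
congr fine; rewrite integralE [RHS]integralE.
rewrite (refl _ (measurable_funepos mE)) // (refl _ (measurable_funeneg mE)) //.
by congr (_ - _)%E; apply: eq_integral => x _; rewrite ?funeposE ?funenegE.
Qed.

Lemma ae_opp (P : R -> Prop) : {ae mu, forall x, P x} -> {ae mu, forall x, P (- x)}.
Proof.
move=> [A [mA A0 PA]]; exists (-%R @^-1` A); split.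
- by rewrite -[X in measurable X]setTI; apply: (@oppr_measurable R setT).
- have := lebesgue_measure_reflect 0 mA; rewrite A0 /pushforward => ->.
  by congr (mu _); apply/seteqP; split => x /=; rewrite sub0r.
- by move=> x /= Px; apply: PA.
Qed.

Lemma opp_itv_oo (a b : R) : -%R @^-1` `]a, b[%classic = `]- b, - a[%classic.
Proof. by apply/seteqP; split => x /=; rewrite !in_itv /=; lra. Qed.

Lemma opp_itv_oc (a b : R) : -%R @^-1` `]a, b]%classic = `[- b, - a[%classic.
Proof. by apply/seteqP; split => x /=; rewrite !in_itv /=; lra. Qed.

Lemma bm_opp f : bm f -> bm (fun x => f (- x)).
Proof.
move=> [mf [M fM]]; split; last by exists M => x; rewrite in_itv /= => h; apply: fM; rewrite in_itv /=; lra.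
rewrite -[X in measurable_fun _ X]/(f \o -%R).
apply: (measurable_comp _ _ mf); [by []| |by apply: measurable_funTS; exact: oppr_measurable].
by move=> _ [x + <-]; rewrite /= !in_itv /= => /andP[x1 x2]; rewrite ltrN2 ltrNl x1 x2.
Qed.

Lemma I1_opp f : bm f -> I1 f = I1 (fun x => f (- x)).
Proof. by move=> [mf _]; rewrite /I1 Rintegral_opp // opp_itv_oo opprK. Qed.

Lemma Rintegral_scale D f (c : R) : c != 0 -> measurable D -> measurable_fun D f ->
  \int[mu]_(x in D) (c * f x) = c * \int[mu]_(x in D) f x.
Proof.
move=> c0 mD.
have junk h : measurable_fun D h -> ~ mu.-integrable D (EFin \o h) -> \int[mu]_(x in D) h x = 0.
  move=> mh nint; rewrite /Rintegral integralE.
  have mE : measurable_fun D (EFin \o h) by exact/measurable_EFinP.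
  have A0 : (0 <= \int[mu]_(x in D) (EFin \o h)^\+ x)%E by exact: integral_ge0.
  have B0 : (0 <= \int[mu]_(x in D) (EFin \o h)^\- x)%E by exact: integral_ge0.
  have AB : (\int[mu]_(x in D) `|(EFin \o h) x| =
     \int[mu]_(x in D) (EFin \o h)^\+ x + \int[mu]_(x in D) (EFin \o h)^\- x)%E.
    rewrite -ge0_integralD //; [|exact: measurable_funepos|exact: measurable_funeneg].
    by apply: eq_integral => x _; rewrite -[LHS]/((abse \o (EFin \o h)) x) fune_abse.
  case: (\int[mu]_(x in D) (EFin \o h)^\+ x)%E A0 AB => [a _||] //.
    case: (\int[mu]_(x in D) (EFin \o h)^\- x)%E B0 => [b _ AB||] //.
    by case: nint; apply/integrableP; split => //; rewrite AB -EFinD ltry.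
  by case: (\int[mu]_(x in D) (EFin \o h)^\- x)%E B0.
move=> mf; have [intf|nf] := pselect (mu.-integrable D (EFin \o f)); first exact: RintegralZl.
rewrite (junk _ mf nf) mulr0; apply: junk; first exact: measurable_funM.
move=> icf; apply: nf.
have := @integrableZl _ _ R mu D mD c^-1 _ icf.
have E x : (EFin \o f) x = ((c^-1)%:E * (EFin \o (fun x => (c * f x)%R)) x)%E.
  by rewrite /= -EFinM mulKf.
by under eq_fun do rewrite -E.
Qed.

End reflection.

Section fractional_integrals.
Variable R : realType.
Local Notation mu := (@lebesgue_measure R).
Implicit Types (f g : R -> R) (rho theta x y z : R).

Lemma frac_int_left_ae theta rho f g z : rho != 0 ->
  {ae mu, forall y, theta < y -> y < z -> f y = g y} ->
  frac_int_left theta rho f z = frac_int_left theta rho g z.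
Proof.
move=> r0 fg; rewrite /frac_int_left (negbTE r0); congr (_ * _).
apply: ae_eq_Rintegral; apply: ae_mono fg => y h /=.
by rewrite in_itv /= => /andP[ty yz]; rewrite h.
Qed.

Lemma frac_int_right_ae theta rho f g z : rho != 0 ->
  {ae mu, forall y, z < y -> y < theta -> f y = g y} ->
  frac_int_right theta rho f z = frac_int_right theta rho g z.
Proof.
move=> r0 fg; rewrite /frac_int_right (negbTE r0); congr (_ * _).
apply: ae_eq_Rintegral; apply: ae_mono fg => y h /=.
by rewrite in_itv /= => /andP[ty yz]; rewrite h.
Qed.

Lemma frac_int_left_riesz theta rho g z : 0 < rho -> measurable_fun setT g -> z <= 1 ->
  frac_int_left theta rho g z = \int[mu]_(y in `]theta, 1]) (g y * riesz rho z y).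
Proof.
move=> r0 mg z1; rewrite /frac_int_left (gt_eqF r0).
have G0 := Gamma_gt0 r0.
transitivity ((Gamma rho)^-1 * \int[mu]_(y in `]theta, z[) (g y * (z - y) `^ (rho - 1))).
  congr (_ * _); apply: eq_Rintegral => y _.
  by rewrite -powRN opprB.
rewrite -Rintegral_scale ?invr_eq0 ?gt_eqF //; last first.
  apply: measurable_funTS; apply: measurable_funM => //.
  exact: measurable_powR_cstB.
rewrite Rintegral_mkcond [RHS]Rintegral_mkcond; apply: eq_Rintegral => y _.
rewrite !patchE !mem_setE /= !in_itv /= /riesz.
have [yz|_] := ltP y z; last by rewrite mulr0 andbF; case: ifP.
rewrite (ltW (lt_le_trans yz z1)) andbT; case: ifP => // _.
by rewrite mulrC mulrA.
Qed.

Lemma frac_int_right_opp theta rho g z : 0 < rho -> measurable_fun setT g ->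
  frac_int_right theta rho g z = frac_int_left (- theta) rho (fun y => g (- y)) (- z).
Proof.
move=> r0 mg; rewrite /frac_int_left /frac_int_right (gt_eqF r0).
apply: (congr1 (GRing.mul (Gamma rho)^-1)).
have mh : measurable_fun setT (fun y => g y / (y - z) `^ (1 - rho)).
  apply: measurable_funM => //; under eq_fun do rewrite -powRN.
  exact: measurable_powR_Bcst.
apply: etrans (Rintegral_opp (measurable_itv `]z, theta[) (measurable_funTS mh)) _.
by rewrite opp_itv_oo; apply: eq_Rintegral => y _; rewrite (addrC (- y)).
Qed.

End fractional_integrals.

Section legendre_orthogonal_complement.
Variable R : realType.
Implicit Types (f e : R -> R) (N n : nat).

Lemma size_legendre n : (size (legendre R n) <= n.+1)%N.
Proof. by apply/leq_sizeP => i ni; rewrite legendreE coefZ coef_rodrigues_gt ?mulr0. Qed.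

Lemma legendre_proj_orth_poly N f (p : {poly R}) : bm f -> (size p <= N.+1)%N ->
  I1 (fun x => (f x - (legendre_proj N f).[x]) * p.[x]) = 0.
Proof.
move=> bf /legendre_span[a ->].
have bP n : bm (fun x => (f x - (legendre_proj N f).[x]) * (legendre R n).[x]).
  by apply: bmM; [apply: bmB => //|]; exact: bm_poly.
transitivity (I1 (fun x => \sum_(n < N.+1) a n * ((f x - (legendre_proj N f).[x]) * (legendre R n).[x]))).
  apply: I1_eq => x _; rewrite [X in _ * X]horner_sum mulr_sumr; apply: eq_bigr => n _.
  by rewrite (hornerZ (a n)) mulrCA.
rewrite (@I1_sum R N.+1 (fun n x => a n * ((f x - (legendre_proj N f).[x]) * (legendre R n).[x]))).
  by rewrite big1 // => n _; rewrite I1Z // legendre_proj_orth ?mulr0 // -ltnS.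
by move=> n; exact: bmZ.
Qed.

End legendre_orthogonal_complement.

Section one_sided_bounds.
Variable R : realType.
Local Notation mu := (@lebesgue_measure R).
Variables (N k : nat) (e : R -> R).
Hypothesis be : bm e.
Hypothesis e_orth : forall p : {poly R}, (size p <= N.+1)%N -> I1 (fun x => e x * p.[x]) = 0.
Implicit Types (U : nat -> R -> R) (g f : R -> R) (m theta : R).

Lemma bm_right theta f : bm f -> bm (fun x => if theta < x then f x else 0).
Proof.
move=> bf; have [mf [M fM]] := bf; split.
  have mi : measurable_fun setT (fun x : R => if theta < x then 1 : R else 0).
    apply: measurable_fun_ifT; [|exact: measurable_cst|exact: measurable_cst].
    by apply: measurable_fun_ltr; [exact: measurable_cst|exact: measurable_id].
  have := measurable_funM (measurable_funTS mi) mf.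
  apply: eq_measurable_fun => x _ /=.
  by case: ifP; rewrite ?mul1r ?mul0r.
exists M => x /fM h; case: ifP => // _; rewrite normr0; exact: le_trans h.
Qed.

Let Cst m := Num.sqrt (I1 (fun x => e x ^+ 2)) * L2_const m N.

Let kern_le m t : 0 < m -> m < N%:R -> -1 < t -> t < 1 ->
  `|I1 (fun x => e x * kern m t x)| <= Cst m.
Proof.
move=> m0 mN; apply: proj_kern_le => // n nN; apply: e_orth.
by apply: leq_trans (size_legendre R _) _.
Qed.

Let TVE theta g : theta <= 1 ->
  fine (total_variation theta 1 g) - fine (total_variation theta theta g) = fine (total_variation theta 1 g).
Proof. by move=> t1; rewrite total_variationxx subr0. Qed.

Lemma right_bound U m theta g : bm (U 0%N) -> 0 < m -> m < k%:R -> m < N%:R ->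
  -1 < theta -> theta < 1 ->
  (forall j x, (j < k)%N -> theta <= x -> x <= 1 ->
    U j x = U j theta + \int[mu]_(y in `]theta, x]) U j.+1 y) ->
  (forall j, (0 < j)%N -> (j <= k)%N -> mu.-integrable `]theta, 1] (EFin \o U j)) ->
  bounded_variation theta 1 g ->
  {ae mu, forall z, z \in `]theta, 1] ->
    g z = \int[mu]_(y in `]theta, 1]) (U k y * riesz (k%:R - m) z y)} ->
  `|I1 (fun x => e x * (if theta < x then U 0%N x - (taylor_poly theta k U).[x] else 0))|
  <= Cst m * (`|lim (g x @[x --> theta^'+])| + fine (total_variation theta 1 g)).
Proof.
move=> bU m0 mk mN t1 t2 UE iU bv gE.
rewrite -(TVE g (ltW t2)).
apply: (halfline_bound m0 (ltW t1) t2 (BV_controls (ltW t2) bv) be) => //.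
- by apply: bm_right; apply: bmB => //; exact: bm_poly.
- move=> x; rewrite in_itv /= => /andP[x1 x2]; case: ifP => [tx|/negbT].
    by apply: (taylor_remainder_frac t2 UE iU m0 mk gE tx); exact: ltW.
  rewrite -leNgt => xt; rewrite /Rintegral integral0_eq // => y /=.
  rewrite in_itv /= => /andP[ty _]; rewrite riesz_eq0 ?mulr0 //.
  by rewrite (le_trans xt) // ltW.
- by move=> t; exact: kern_le.
Qed.

Lemma whole_bound U g : bm (U 0%N) -> (0 < k)%N -> (k < N)%N ->
  (forall j x, (j < k)%N -> -1 <= x -> x <= 1 ->
    U j x = U j (-1) + \int[mu]_(y in `](-1), x]) U j.+1 y) ->
  (forall j, (0 < j)%N -> (j <= k)%N -> mu.-integrable `](-1), 1] (EFin \o U j)) ->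
  bounded_variation (-1) 1 g ->
  {ae mu, forall z, z \in `](-1)%R, 1%R[ -> g z = U k z} ->
  `|I1 (fun x => e x * (U 0%N x - (taylor_poly (-1) k U).[x]))|
  <= Cst k%:R * fine (total_variation (-1) 1 g).
Proof.
move=> bU k0 kN UE iU bv gE; have m1 : (-1 : R) < 1 by lra.
have k0' : 0 < k%:R :> R by rewrite ltr0n.
rewrite -(TVE g (ltW m1)).
apply: (halfline_bound0 k0' (lexx _) m1 (BV_controls (ltW m1) bv) be) => //.
- by apply: bmB => //; exact: bm_poly.
- move=> x; rewrite in_itv /= => /andP[x1 x2].
  by apply: (taylor_remainder m1 UE iU k0 gE x1); exact: ltW.
- by move=> t; apply: kern_le => //; rewrite ltr_nat.
- pose p : {poly R} := (Gamma (k%:R + 1))^-1 *: ('X - (-1)%:P) ^+ k.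
  have sp : (size p <= N.+1)%N.
    apply: leq_trans (size_scale_leq _ _) _.
    by rewrite size_exp_XsubC // ltnS ltnW.
  rewrite -[RHS](e_orth sp); apply: I1_eq => x; rewrite in_itv /= => /andP[x1 x2].
  rewrite /kern x1 /p hornerZ horner_exp !hornerE opprK powR_mulrn; first exact: mulrAC.
  by rewrite -lerBlDr sub0r ltW.
Qed.

End one_sided_bounds.

Section derivative_sequences.
Variable R : realType.
Local Notation mu := (@lebesgue_measure R).
Implicit Types (U : nat -> R -> R) (u f g : R -> R) (k j : nat) (x y z : R).

Definition antideriv_seq k U :=
  [/\ forall j x y, (j < k)%N -> -1 <= x -> x <= y -> y <= 1 ->
        U j y - U j x = \int[mu]_(t in `]x, y]) U j.+1 t,
      forall j, (j <= k)%N -> mu.-integrable setT (EFin \o U j) & bm (U 0%N)].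

Lemma integrable_patch (D : set R) f : measurable D -> mu.-integrable D (EFin \o f) ->
  mu.-integrable setT (EFin \o (f \_ D)).
Proof.
move=> mD intf; rewrite -restrict_EFin.
by have [+ _] := @integrable_mkcond _ _ R mu D (EFin \o f) mD; apply.
Qed.

Lemma antideriv_seq_derivn k u : (0 < k)%N -> derivs_abs_cont (-1) 1 k u ->
  exists U, [/\ antideriv_seq k U, forall x, x \in `]-1, 1[ -> U 0%N x = u x &
    {ae mu, forall x, x \in `]-1, 1[ -> derivn_in (-1) 1 k u x = U k x}].
Proof.
move=> k0 [_ ac]; have m11 : (-1 : R) < 1 by lra.
have cont j : (j < k)%N -> {within `[-1, 1], continuous (derivn_in (-1) 1 j u)}.
  by move=> jk; apply: abs_cont_continuous; [exact: ltW|exact: ac].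
have ftc j : (j < k)%N -> exists g, [/\ mu.-integrable setT (EFin \o g),
    (forall x y, -1 <= x -> x <= y -> y <= 1 ->
      derivn_in (-1) 1 j u y - derivn_in (-1) 1 j u x = \int[mu]_(t in `]x, y]) g t) &
    {ae mu, forall x, x \in `]-1, 1[ -> derivn_in (-1) 1 j.+1 u x = g x}].
  by move=> jk; have [g ig [gE gae]] := abs_cont_FTC m11 (ac _ jk); exists g.
have k1 : (k.-1 < k)%N by rewrite prednK.
have [gk [igk gkE gkae]] := ftc _ k1; rewrite prednK // in gkae.
pose I : set R := `[-1, 1]%classic.
pose U j := if (j < k)%N then (derivn_in (-1) 1 j u) \_ I else gk.
have UI j x : (j < k)%N -> -1 <= x -> x <= 1 -> U j x = derivn_in (-1) 1 j u x.
  by move=> jk x1 x2; rewrite /U jk patchE mem_set // /I /= in_itv /= x1.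
have U0 x : x \in `]-1, 1[ -> U 0%N x = u x.
  by rewrite in_itv /= => /andP[x1 x2]; rewrite UI //; exact: ltW.
exists U; split => //; last by rewrite /U ltnn.
split.
- move=> j x y jk x1 xy y1.
  rewrite (UI j y jk (le_trans x1 xy) y1) (UI j x jk x1 (le_trans xy y1)).
  have [jk1|] := ltnP j.+1 k; last first.
    move=> kj; have jE : j = k.-1 by apply/eqP; rewrite -eqSS prednK // eqn_leq jk.
    by rewrite jE gkE // /U prednK // ltnn.
  have [g [ig gE gae]] := ftc j jk; rewrite gE //.
  have intU : mu.-integrable setT (EFin \o U j.+1).
    rewrite /U jk1; apply: integrable_patch; first exact: measurable_itv.
    by apply: continuous_compact_integrable; [exact: segment_compact|exact: cont].
  rewrite -Rintegral_itv_bndo_bndc; last exact: integrableS ig.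
  rewrite -[RHS]Rintegral_itv_bndo_bndc; last exact: integrableS intU.
  apply: ae_eq_Rintegral; apply: ae_mono gae => t gt /=.
  rewrite in_itv /= => /andP[xt ty].
  have t1 := le_lt_trans x1 xt; have t2 := lt_le_trans ty y1.
  by rewrite UI ?(ltW t1) ?(ltW t2) // gt // in_itv /= t1 t2.
- move=> j; rewrite leq_eqVlt => /predU1P[->|jk]; first by rewrite /U ltnn.
  rewrite /U jk; apply: integrable_patch; first exact: measurable_itv.
  by apply: continuous_compact_integrable; [exact: segment_compact|exact: cont].
- have [mu0 [M uM]] := bm_continuous (cont 0%N k0); split.
    by apply: eq_measurable_fun mu0 => x /[!inE] /= xI; rewrite U0.
  by exists M => x xI; rewrite U0 //; exact: uM.
Qed.

Lemma integrable_opp f : mu.-integrable setT (EFin \o f) ->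
  mu.-integrable setT (EFin \o (fun x => f (- x))).
Proof.
move=> /integrableP[mf fi].
have mf' : measurable_fun setT f by exact/measurable_EFinP.
apply/integrableP; split.
  by apply/measurable_EFinP; apply: (measurableT_comp mf'); exact: oppr_measurable.
rewrite (ge0_integral_reflect 0 measurableT) in fi => //; last exact: measurableT_comp.
by rewrite preimage_setT in fi; under eq_integral do rewrite /= -sub0r.
Qed.

Lemma antideriv_seq_opp k U : antideriv_seq k U ->
  antideriv_seq k (fun j x => (-1) ^+ j * U j (- x)).
Proof.
move=> [UE iU bU]; split.
- move=> j x y jk x1 xy y1.
  have intS (D : set R) f : measurable D -> mu.-integrable setT (EFin \o f) -> mu.-integrable D (EFin \o f).
    by move=> mD; exact: integrableS.
  have iU' := integrable_opp (iU _ jk).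
  rewrite RintegralZl //; last exact: intS.
  have -> : \int[mu]_(t in `]x, y]) U j.+1 (- t) = \int[mu]_(t in `](- y), (- x)]) U j.+1 t.
    rewrite [RHS]Rintegral_opp //; last by apply: measurable_funTS; apply/measurable_EFinP; exact: measurable_int (iU _ jk).
    rewrite opp_itv_oc !opprK -Rintegral_itv_bndo_bndc; last exact: intS.
    by rewrite Rintegral_itv_obnd_cbnd //; exact: intS.
  rewrite -UE //; [|by rewrite lerN2|by rewrite lerN2|by rewrite lerNl].
  by rewrite exprS; ring.
- move=> j jk; exact: (@integrableZl _ _ R mu setT measurableT _ _ (integrable_opp (iU _ jk))).
- by rewrite expr0; under eq_fun do rewrite mul1r; exact: bm_opp.
Qed.

Lemma horner_taylor_poly_opp k U theta x :
  (taylor_poly (- theta) k (fun j x => (-1) ^+ j * U j (- x))).[- x] = (taylor_poly theta k U).[x].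
Proof.
rewrite !taylor_poly_horner; apply: eq_bigr => i _.
have -> : - x - - theta = - (x - theta) by ring.
have s1 : (-1) ^+ i * (-1) ^+ i = 1 :> R by rewrite -expr2 sqrr_sign.
rewrite opprK (exprNn (x - theta)); set a := (-1) ^+ i in s1 *; move: (_^-1) => c.
transitivity (a * a * (U i theta * ((x - theta) ^+ i * c))); first by ring.
by rewrite s1 mul1r.
Qed.

End derivative_sequences.

Section assembly.
Variable R : realType.
Local Notation mu := (@lebesgue_measure R).
Implicit Types (U : nat -> R -> R) (u f g e : R -> R) (N k : nat) (m theta : R).

Lemma antideriv_seq_right k U theta : antideriv_seq k U -> -1 <= theta ->
  (forall j x, (j < k)%N -> theta <= x -> x <= 1 ->
    U j x = U j theta + \int[mu]_(y in `]theta, x]) U j.+1 y) /\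
  (forall j, (0 < j)%N -> (j <= k)%N -> mu.-integrable `]theta, 1] (EFin \o U j)).
Proof.
move=> [UE iU _] t1; split=> [j x jk tx x1|j _ jk].
  by rewrite -UE // addrC subrK.
by apply: integrableS (iU j jk).
Qed.

Lemma right_side N k e U m theta g u : bm e ->
  (forall p : {poly R}, (size p <= N.+1)%N -> I1 (fun x => e x * p.[x]) = 0) ->
  antideriv_seq k U -> 0 < m -> m < k%:R -> m < N%:R -> -1 < theta -> theta < 1 ->
  {ae mu, forall x, x \in `]-1, 1[ -> derivn_in (-1) 1 k u x = U k x} ->
  BV_repr theta 1 (caputo_left theta 1 k m u) g ->
  `|I1 (fun x => e x * (if theta < x then U 0%N x - (taylor_poly theta k U).[x] else 0))|
  <= Num.sqrt (I1 (fun x => e x ^+ 2)) * L2_const m N *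
     (`|lim (g x @[x --> theta^'+])| + fine (total_variation theta 1 g)).
Proof.
move=> be eo sU m0 mk mN t1 t2 uU [bv gE].
have [UE iU] := antideriv_seq_right sU (ltW t1); have [_ iU' bU] := sU.
have km : 0 < k%:R - m by rewrite subr_gt0.
apply: (right_bound be eo bU m0 mk mN t1 t2 UE iU bv).
apply: ae_mono gE => z; rewrite in_itv /= => h /andP[tz z1].
rewrite -h ?in_itv /= ?(ltW tz) //.
rewrite /caputo_left -frac_int_left_riesz //; last first.
  by apply/measurable_EFinP; exact: measurable_int (iU' _ (leqnn k)).
apply: frac_int_left_ae; first by rewrite gt_eqF.
apply: ae_mono uU => y hy ty yz.
have yI : y \in `]theta, 1[ by rewrite in_itv /= ty (lt_le_trans yz z1).
rewrite (derivn_in_sub _ _ (ltW t1) (lexx 1) yI) hy //.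
by rewrite in_itv /= (lt_trans t1 ty) (lt_le_trans yz z1).
Qed.

Lemma lim_at_left_opp g theta : cvg (g (- x) @[x --> (- theta)^'+]) ->
  lim (g (- x) @[x --> (- theta)^'+]) = lim (g x @[x --> theta^'-]).
Proof.
move=> cg; apply/esym/cvg_lim; first exact: Rhausdorff.
by apply/cvg_at_leftNP; exact: cg.
Qed.

Lemma left_side N k e U m theta g u : bm e ->
  (forall p : {poly R}, (size p <= N.+1)%N -> I1 (fun x => e x * p.[x]) = 0) ->
  antideriv_seq k U -> 0 < m -> m < k%:R -> m < N%:R -> -1 < theta -> theta < 1 ->
  {ae mu, forall x, x \in `]-1, 1[ -> derivn_in (-1) 1 k u x = U k x} ->
  BV_repr (-1) theta (caputo_right (-1) theta k m u) g ->
  `|I1 (fun x => e x * (if x < theta then U 0%N x - (taylor_poly theta k U).[x] else 0))|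
  <= Num.sqrt (I1 (fun x => e x ^+ 2)) * L2_const m N *
     (`|lim (g x @[x --> theta^'-])| + fine (total_variation (-1) theta g)).
Proof.
move=> be eo sU m0 mk mN t1 t2 uU [bv gE].
have km : 0 < k%:R - m by rewrite subr_gt0.
have s1 : -1 < - theta by rewrite ltrN2.
have s2 : - theta < 1 by rewrite ltrNl.
have [_ iU bU] := sU.
have sU' := antideriv_seq_opp sU; have [_ _ bU'] := sU'.
have [UE' iU'] := antideriv_seq_right sU' (ltW s1).
pose g' (x : R) := g (- x).
have TVg : total_variation (-1) theta g = total_variation (- theta) 1 g'.
  by rewrite total_variation_opp opprK.
have bv' : bounded_variation (- theta) 1 g'.
  apply/bounded_variationP; first exact: ltW.
  by rewrite -TVg; apply/bounded_variationP => //; exact: ltW.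
pose Uk (x : R) : R := (-1) ^+ k * U k (- x).
have gE' : {ae mu, forall z, z \in `](- theta), 1] ->
    g' z = \int[mu]_(y in `](- theta), 1]) (Uk y * riesz (k%:R - m) z y)}.
  have mU : measurable_fun setT (fun y : R => U k (- y)).
    by apply/measurable_EFinP; exact: measurable_int (integrable_opp (iU _ (leqnn k))).
  apply: ae_mono (ae_opp gE) => z; rewrite !in_itv /= => h /andP[tz z1].
  rewrite /g' -h; last by rewrite /= in_itv /= lerN2 z1 /= lerNl ltW.
  rewrite /caputo_right (@frac_int_right_ae _ _ _ _ (U k)); last 2 first.
  - by rewrite gt_eqF.
  - apply: ae_mono uU => y hy zy yt.
    have y1 : -1 < y by apply: le_lt_trans zy; rewrite lerN2.
    have yI : y \in `]-1, theta[ by rewrite in_itv /= yt y1.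
    rewrite (derivn_in_sub _ _ (lexx _) (ltW t2) yI) hy // in_itv /= y1.
    exact: lt_trans yt t2.
  rewrite frac_int_right_opp //; last first.
    by apply/measurable_EFinP; exact: measurable_int (iU _ (leqnn k)).
  rewrite opprK frac_int_left_riesz // -Rintegral_scale ?signr_eq0 //.
  - by apply: eq_Rintegral => y _; rewrite mulrA.
  - by apply: measurable_funTS; apply: measurable_funM => //; exact: measurable_riesz.
have be' := bm_opp be.
have eo' (p : {poly R}) : (size p <= N.+1)%N -> I1 (fun x => e (- x) * p.[x]) = 0.
  move=> sp; rewrite I1_opp; last by apply: bmM => //; exact: bm_poly.
  have sq : (size (p \Po (- 'X)) <= N.+1)%N.
    by rewrite size_comp_poly2 // size_polyN size_polyX.
  rewrite -[RHS](eo _ sq); apply: I1_eq => x _.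
  by rewrite opprK horner_comp hornerN hornerX.
have := right_bound be' eo' bU' m0 mk mN s1 s2 UE' iU' bv' gE'.
have -> : I1 (fun x => e (- x) ^+ 2) = I1 (fun x => e x ^+ 2).
  by rewrite [RHS]I1_opp //; apply: bmM.
have bw : bm (fun x => e x * (if x < theta then U 0%N x - (taylor_poly theta k U).[x] else 0)).
  apply: bmM => //; have := bm_opp (bm_right (- theta) (bm_opp (bmB bU (bm_poly (taylor_poly theta k U))))).
  by under eq_fun do rewrite opprK ltrN2.
rewrite -TVg -(lim_at_left_opp (controls_cvg_at_right s2 (BV_controls (ltW s2) bv'))).
rewrite (I1_opp bw) (_ : I1 (fun x => e (- x) * _) = I1 (fun x => e (- x) *
   (if - x < theta then U 0%N (- x) - (taylor_poly theta k U).[- x] else 0))) //.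
apply: I1_eq => x _; rewrite expr0 mul1r ltrNl; case: ifP => // _.
by rewrite -(horner_taylor_poly_opp k U theta (- x)) opprK.
Qed.

Lemma L2norm_I1 f : bm f -> L2norm `]-1, 1[ f = (Num.sqrt (I1 (fun x => f x ^+ 2)))%:E.
Proof.
move=> bf; have bff := bmM bf bf; rewrite /L2norm unlock /=.
have -> : (\int[mu]_x (`|(EFin \o (f \_ `](-1)%R, 1%R[)%R) x| `^ 2) = (I1 (fun x => f x ^+ 2))%:E)%E.
  rewrite /I1 /Rintegral fineK; last by apply: integrable_fin_num => //; exact: bm_integrable bff.
  rewrite [RHS]integral_mkcond; apply: eq_integral => x _.
  rewrite /= !patchE; case: ifP => _.
    by rewrite ?poweR_EFin powR_mulrn ?normr_ge0 // real_normK ?num_real.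
  by rewrite ?poweR_EFin normr0 powR0 // pnatr_eq0.
by rewrite ?poweR_EFin powR12_sqrt //; apply: I1_ge0 => x _; exact: sqr_ge0.
Qed.

Lemma L2_bound_of_dual (s L A : R) : 0 <= s -> 0 <= L * A -> s ^+ 2 <= s * L * A -> s <= L * A.
Proof.
rewrite le_eqVlt => /predU1P[<- //|s0] _; rewrite expr2 -mulrA.
by rewrite ler_pM2l.
Qed.

End assembly.

Section residual.
Variable R : realType.
Implicit Types (u f : R -> R) (U : nat -> R -> R) (N k : nat) (p : {poly R}).

Lemma bm_eq (f g : R -> R) : (forall x, x \in `]-1, 1[ -> f x = g x) -> bm f -> bm g.
Proof.
move=> fg [mf [M fM]]; split.
  by apply: eq_measurable_fun mf => x /[!inE] /= xI; rewrite fg.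
by exists M => x xI; rewrite -fg //; exact: fM.
Qed.

Lemma residual_sqr N u p : bm u -> (size p <= N.+1)%N ->
  I1 (fun x => (u x - (legendre_proj N u).[x]) ^+ 2) =
  I1 (fun x => (u x - (legendre_proj N u).[x]) * (u x - p.[x])).
Proof.
move=> bu sp; set e := fun x => u x - (legendre_proj N u).[x].
have be : bm e by apply: bmB => //; exact: bm_poly.
have eP n : (n <= N)%N -> I1 (fun x => e x * (legendre R n).[x]) = 0.
  by move=> nN; exact: legendre_proj_orth.
transitivity (I1 (fun x => e x * u x) - I1 (fun x => e x * (legendre_proj N u).[x])).
  rewrite -I1B; [|exact: bmM|by apply: bmM => //; exact: bm_poly].
  by apply: I1_eq => x _; rewrite -mulrBr.
rewrite (I1_orth_proj u be eP) -(legendre_proj_orth_poly bu sp).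
rewrite -I1B; [|exact: bmM|by apply: bmM => //; exact: bm_poly].
by apply: I1_eq => x _; rewrite -mulrBr.
Qed.

Lemma size_taylor_poly theta k U : (size (taylor_poly theta k U : {poly R}) <= k)%N.
Proof.
apply: leq_trans (size_sum _ _ _) _; apply/bigmax_leqP => i _.
by apply: leq_trans (size_scale_leq _ _) _; rewrite size_exp_XsubC.
Qed.

Lemma taylor_poly_center theta k U : (0 < k)%N ->
  (taylor_poly theta k U).[theta] = U 0%N theta :> R.
Proof.
case: k => // k _; rewrite taylor_poly_horner big_ord_recl /= expr0 fact0 divr1 mulr1.
rewrite big1 ?addr0 // => i _; by rewrite subrr expr0n /= mul0r mulr0.
Qed.

End residual.

Theorem theorem4 (R : realType) (k : nat) (u : R -> R)
    (hk : (1 <= k)%N) (hu : derivs_abs_cont (-1) 1 k u) :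
  (forall (mu theta : R) (gl gr : R -> R),
      k%:R - 1 < mu -> mu < k%:R ->
      -1 < theta -> theta < 1 ->
      BV_repr theta 1 (caputo_left theta 1 k mu u) gr ->
      BV_repr (-1) theta (caputo_right (-1) theta k mu u) gl ->
      forall N : nat, - (1 / 2) < mu -> mu < N%:R ->
      ((L2norm `]-1, 1[ (fun x => u x - (legendre_proj N u).[x]))%R
       <= (L2_const mu N)%R%:E * U_theta theta gl gr)%E)
  /\
  (forall h : R -> R,
      BV_repr (-1) 1 (derivn_in (-1) 1 k u) h ->
      forall N : nat, (k < N)%N ->
      ((L2norm `]-1, 1[ (fun x => u x - (legendre_proj N u).[x]))%R
       <= (L2_const k%:R N)%R%:E * (total_variation (-1) 1 h)%R)%E).
Proof.
have [U [sU U0 Uk]] := antideriv_seq_derivn hk hu; have [UE iU bU] := sU.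
have bu : bm u by exact: bm_eq U0 bU.
have main N (L A : R) theta : (k <= N)%N -> 0 <= L * A ->
    `|I1 (fun x => (u x - (legendre_proj N u).[x]) * (U 0%N x - (taylor_poly theta k U).[x]))|
    <= Num.sqrt (I1 (fun x => (u x - (legendre_proj N u).[x]) ^+ 2)) * L * A ->
    ((L2norm `]-1, 1[ (fun x => u x - (legendre_proj N u).[x]))%R <= L%:E * A%:E)%E.
  move=> kN LA bd; have be : bm (fun x => u x - (legendre_proj N u).[x]).
    by apply: bmB => //; exact: bm_poly.
  rewrite (L2norm_I1 be) -EFinM lee_fin; apply: (L2_bound_of_dual (sqrtr_ge0 _) LA).
  rewrite sqr_sqrtr; last by apply: I1_ge0 => x _; exact: sqr_ge0.
  rewrite {1}(residual_sqr bu (leq_trans (size_taylor_poly theta k U) (leqW kN))).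
  apply: le_trans bd; apply: le_trans (ler_norm _).
  by rewrite le_eqVlt; apply/orP; left; apply/eqP/I1_eq => x xI; rewrite U0.
have L0 m N : 0 <= L2_const m N by exact: sqrtr_ge0.
have TV0 (a b : R) f : a <= b -> 0 <= fine (total_variation a b f).
  by move=> ab; apply: fine_ge0; exact: total_variation_ge0.
split=> [m theta gl gr km mk t1 t2 hr hl N _ mN|h [bv hE] N kN].
- have m0 : 0 < m by apply: le_lt_trans km; rewrite subr_ge0 ler1n.
  have kN : (k <= N)%N.
    by rewrite -ltnS -(ltr_nat R) -natr1; rewrite -ltrBlDr; exact: lt_trans mN.
  set B := `|lim (gl x @[x --> theta^'-])| + fine (total_variation (-1) theta gl).
  set C := `|lim (gr x @[x --> theta^'+])| + fine (total_variation theta 1 gr).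
  have B0 : 0 <= B by rewrite addr_ge0 // TV0 // ltW.
  have C0 : 0 <= C by rewrite addr_ge0 // TV0 // ltW.
  have -> : U_theta theta gl gr = (B + C)%:E.
    have /fineK El : total_variation (-1) theta gl \is a fin_num.
      by apply/bounded_variationP; [exact: ltW|exact: hl.1].
    have /fineK Er : total_variation theta 1 gr \is a fin_num.
      by apply/bounded_variationP; [exact: ltW|exact: hr.1].
    rewrite /U_theta -El -Er -!EFinD /B /C; congr EFin.
    set a := fine _; set b := fine _; set c := `|_|; set d := `|_|.
    by clearbody a b c d; ring.
  have LA : 0 <= L2_const m N * (B + C) by apply: mulr_ge0; [exact: L0|exact: addr_ge0].
  apply: (main N (L2_const m N) (B + C) theta kN LA).
  set e := fun x => u x - (legendre_proj N u).[x].
  have be : bm e by apply: bmB => //; exact: bm_poly.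
  have eo (p : {poly R}) : (size p <= N.+1)%N -> I1 (fun x => e x * p.[x]) = 0.
    by move=> sp; exact: legendre_proj_orth_poly.
  have Br := right_side be eo sU m0 mk mN t1 t2 Uk hr.
  have Bl := left_side be eo sU m0 mk mN t1 t2 Uk hl.
  pose w x := U 0%N x - (taylor_poly theta k U).[x].
  have bw : bm w by apply: bmB => //; exact: bm_poly.
  have br : bm (fun x => e x * (if theta < x then w x else 0)).
    by apply: bmM => //; exact: bm_right.
  have -> : I1 (fun x => e x * w x) =
      I1 (fun x => e x * (if x < theta then w x else 0)) + I1 (fun x => e x * (if theta < x then w x else 0)).
    have bl : bm (fun x => e x * (if x < theta then w x else 0)).
      apply: bm_eq (bmB (bmM be bw) br) => x _.
      have [xt|tx|->] := ltgtP x theta.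
      + by rewrite mulr0 subr0.
      + by rewrite subrr mulr0.
      + by rewrite /w taylor_poly_center // subrr !mulr0 subr0.
    rewrite -I1D //; apply: I1_eq => x _; rewrite -mulrDr; congr (_ * _).
    have [xt|tx|->] := ltgtP x theta; rewrite ?addr0 ?add0r //.
    by rewrite /w taylor_poly_center // subrr.
  apply: le_trans (ler_normD _ _) _; rewrite [leRHS]mulrDr; exact: lerD.
- have m11 : (-1 : R) <= 1 by lra.
  have /fineK <- : total_variation (-1) 1 h \is a fin_num by exact/(bounded_variationP _ m11).
  have LA : 0 <= L2_const k%:R N * fine (total_variation (-1) 1 h) by apply: mulr_ge0; [exact: L0|exact: TV0].
  apply: (main N _ _ (-1) (ltnW kN) LA).
  have [UE' iU'] := antideriv_seq_right sU (lexx (-1)).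
  apply: (whole_bound _ _ bU hk kN UE' iU' bv).
  + by apply: bmB => //; exact: bm_poly.
  + by move=> p sp; exact: legendre_proj_orth_poly.
  + have FF := @ae_filter_ringOfSetsType _ _ R (@lebesgue_measure R).
    apply: (@filterS2 _ _ FF _ _ _ _ hE Uk) => z hz uz zI.
    rewrite -(uz zI) -hz //; move: zI; rewrite /= !in_itv /= => /andP[z1 z2].
    by rewrite !ltW.
Qed.
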